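(* Let $1>\delta_1>\delta_2>0$ and let $\mathfrak{a}>0$ be such that $\theta\ge\mathfrak{a}$ and $1-\delta_1\ge\mathfrak{a}$, where $$\theta:=\frac{\delta_1\wedge 0.5-\delta_2}{\delta_1\wedge 0.5+\delta_2}.$$ Let $b_1,b_2\in(0,1)$ satisfy the stationarity condition $\frac{b_1}{1-b_1}=\kappa\frac{b_2}{1-b_2}$ and $\mathfrak{a}\le b_i\le 1-\mathfrak{a}$ for $i=1,2$. Let $y$ be a positive integer with $y(1-\kappa)\ge1$, and set $$x_0:=y\kappa\Big(\frac{1+\kappa^{-1}\beta_1}{1+\beta_1}\Big)^2 .$$ Then: (1) There are constants $c,C>0$ depending only on $\mathfrak{a}$ such that for every positive integer $x$ and all $1\le u\le (y(1-\kappa))^{2/3}$, $$\mathbb{P}\Big[\Big|\frac{H^{(b_1,b_2)}(x,y)-\mathbb{E}[H^{(b_1,b_2)}(x,y)]}{(y(1-\kappa))^{1/3}}\Big|>u\Big]\le C\mathrm{e}^{-cu^{3/2}}+C\mathrm{e}^{-cu^2(y(1-\kappa))^{2/3}/|x-x_0|}.$$ (2) If, in addition, $\mathfrak{a}\delta_1\le 1-\kappa\le\mathfrak{a}^{-1}\delta_1$, and $A>0$ is such that $|x-x_0|\le A(y(1-\kappa))^{2/3}$, then there are constants $c,C>0$ (depending on $A$ and $\mathfrak{a}$) such that for $1\le u\le c(y(1-\kappa))^{2/3}$, $$c\,\mathrm{e}^{-Cu^{3/2}}\le \mathbb{P}\Big[\frac{H^{(b_1,b_2)}(x,y)-\mathbb{E}[H^{(b_1,b_2)}(x,y)]}{(y(1-\kappa))^{1/3}}>u\Big]\le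 C\mathrm{e}^{-cu^{3/2}}.$$ (3) If, in addition, $\mathfrak{a}\delta_1\le 1-\kappa\le\mathfrak{a}^{-1}\delta_1$, and $C_1>0$ is such that $|x-x_0|\le C_1y(1-\kappa)$, then there are constants $C_2,C,c>0$ such that for $u>C_2(y(1-\kappa))^{2/3}$, $$\mathbb{P}\Big[\big|H^{(b_1,b_2)}(x,y)-\mathbb{E}[H^{(b_1,b_2)}(x,y)]\big|>u(y(1-\kappa))^{1/3}\Big]\le C\mathrm{e}^{-cu(y(1-\kappa))^{1/3}}.$$
   Context: Stochastic six vertex (S6V) model. Fix $\delta_1,\delta_2\in[0,1]$. Vertices are $(i,j)\in\mathbb{Z}_{>0}^2$; each has two incoming edges (from $(i-1,j)$ on the left and from $(i,j-1)$ below) and two outgoing edges (to $(i+1,j)$ and to $(i,j+1)$). Boundary data specify, for each $j\ge1$, whether an arrow enters along the edge $(0,j)\to(1,j)$ (from the $y$-axis), and for each $i\ge1$ whether an arrow enters along $(i,0)\to(i,1)$ (from the $x$-axis). The configuration is sampled successively on the antidiagonals $\{i+j=n\}$, $n=2,3,\dots$; given the incoming arrows, vertices are updated independently: no incoming arrow gives no outgoing arrow; two incoming arrows give both outgoing arrows; a single arrow entering from below exits upward with probability $\delta_1$ and to the right with probability $1-\delta_1$; a single arrow entering from the left exits to the right with probability $\delta_2$ and upward with probability $1-\delta_2$. The occupied edges form up-right paths (arrows). The height function $H(x,y)$, $x,y\ge1$, is the net number of arrows crossing the straight segment from $(0,0)$ to $(x+\epsilon,y+\epsilon)$ for small $\epsilon>0$,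 an arrow crossing from left to right counting $+1$ and from right to left $-1$. For $b_1,b_2\in(0,1)$, $(b_1,b_2)$ two-sided Bernoulli initial data means all boundary arrows are present independently, an arrow entering from $(0,j)$ with probability $b_1$ and from $(i,0)$ with probability $b_2$; $H^{(b_1,b_2)}(x,y)$ denotes the resulting height function. Notation: $\kappa=(1-\delta_1)/(1-\delta_2)$ and $\beta_i=b_i/(1-b_i)$. *)

(* Defs.v *)
From HB Require Import structures.
From mathcomp Require Import all_boot all_order all_algebra.
From mathcomp Require Import reals sequences exp.
Set Implicit Arguments. Unset Strict Implicit. Unset Printing Implicit Defensive.
Import Order.TTheory GRing.Theory Num.Theory.
Local Open Scope ring_scope.

(* Stochastic six vertex model on the box [1..x] x [1..y].             *)
(* The law of the configuration inside the box (hence of H(x,y)) only  *)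
(* depends on the boundary arrows entering the box and on the vertex   *)
(* updates inside it.  We realise it on a finite probability space of  *)
(* independent Bernoulli "seeds":                                      *)
(*   L j  (j = 1..y) : arrow enters from (0,j)       ~ Bernoulli(b1)   *)
(*   B i  (i = 1..x) : arrow enters from (i,0)       ~ Bernoulli(b2)   *)
(*   c1 (i,j)        : a lone arrow from below goes up ~ Bernoulli(d1) *)
(*   c2 (i,j)        : a lone arrow from the left goes right           *)
(*                                                 ~ Bernoulli(d2)     *)
(* all mutually independent.                                          *)

(* vertex rule: (left-in, bottom-in, coin1, coin2) |-> (right-out, up-out) *)
Definition s6v_step (l b c1 c2 : bool) : bool * bool :=
  match l, b with
  | false, false => (false, false)
  | true, true => (true, true)
  | false, true => (~~ c1, c1)
  | true, false => (c2, ~~ c2)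
  end.

(* s6v_cfg Lb Bb c1 c2 i j = (right-out, up-out) of vertex (i,j), i,j >= 1;
   column i = 0 encodes the left boundary (right-out of (0,j) = Lb j),
   row j = 0 encodes the bottom boundary (up-out of (i,0) = Bb i). *)
Fixpoint s6v_cfg (Lb Bb : nat -> bool) (c1 c2 : nat -> nat -> bool) (i : nat)
  : nat -> bool * bool :=
  match i with
  | 0 => fun j => (Lb j, false)
  | i'.+1 =>
      let prev := s6v_cfg Lb Bb c1 c2 i' in
      fix colf (j : nat) : bool * bool :=
        match j with
        | 0 => (false, Bb i)
        | j'.+1 => s6v_step (prev j).1 (colf j').2 (c1 i j) (c2 i j)
        end
  end.

Definition seed (x y : nat) : finType :=
  ({ffun 'I_y -> bool} * {ffun 'I_x -> bool}
   * {ffun 'I_x * 'I_y -> bool} * {ffun 'I_x * 'I_y -> bool})%type.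

Definition ext1 (n : nat) (f : {ffun 'I_n -> bool}) (k : nat) : bool :=
  if (insub k : option 'I_n) is Some i then f i else false.

Definition ext2 (n m : nat) (f : {ffun 'I_n * 'I_m -> bool}) (i j : nat) : bool :=
  match (insub i : option 'I_n), (insub j : option 'I_m) with
  | Some a, Some b => f (a, b)
  | _, _ => false
  end.

(* the configuration generated by a seed, 1-based indices *)
Definition seed_cfg (x y : nat) (s : seed x y) : nat -> nat -> bool * bool :=
  let '(L, B, C1, C2) := s in
  s6v_cfg (fun j => ext1 L j.-1) (fun i => ext1 B i.-1)
          (fun i j => ext2 C1 i.-1 j.-1) (fun i j => ext2 C2 i.-1 j.-1).

(* Height function H(x,y): net number of arrows crossing the segment from
   (0,0) to (x+eps,y+eps) left-to-right (i.e. from above to below).  Since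
   arrows are up-right paths, this equals
     #{ arrows entering from (0,j), 1 <= j <= y }
   - #{ arrows on the edges (i,y) -> (i,y+1), 1 <= i <= x }.            *)
Definition s6v_height (x y : nat) (s : seed x y) : int :=
  let '(L, _, _, _) := s in
  (\sum_(1 <= j < y.+1) (ext1 L j.-1 : nat))%:Z
  - (\sum_(1 <= i < x.+1) ((seed_cfg s i y).2 : nat))%:Z.

Definition bern {R : numDomainType} (p : R) (b : bool) : R :=
  if b then p else 1 - p.

Definition seed_weight {R : numDomainType} (d1 d2 b1 b2 : R) (x y : nat)
  (s : seed x y) : R :=
  let '(L, B, C1, C2) := s in
  (\prod_j bern b1 (L j)) * (\prod_i bern b2 (B i))
  * (\prod_k bern d1 (C1 k)) * (\prod_k bern d2 (C2 k)).

Definition s6v_prob {R : numDomainType} (d1 d2 b1 b2 : R) (x y : nat)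
  (E : pred (seed x y)) : R :=
  \sum_(s | E s) seed_weight d1 d2 b1 b2 s.

Definition Hr {R : numDomainType} (x y : nat) (s : seed x y) : R :=
  (s6v_height s)%:~R.

Definition s6v_EH {R : numDomainType} (d1 d2 b1 b2 : R) (x y : nat) : R :=
  \sum_(s : seed x y) seed_weight d1 d2 b1 b2 s * Hr s.

Definition kappa {R : numFieldType} (d1 d2 : R) : R := (1 - d1) / (1 - d2).
Definition beta {R : numFieldType} (b : R) : R := b / (1 - b).
Definition theta {R : realFieldType} (d1 d2 : R) : R :=
  (Num.min d1 2^-1 - d2) / (Num.min d1 2^-1 + d2).
Definition Nsc {R : numFieldType} (d1 d2 : R) (y : nat) : R :=
  y%:R * (1 - kappa d1 d2).
Definition x0 {R : numFieldType} (d1 d2 b1 : R) (y : nat) : R :=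
  y%:R * kappa d1 d2
  * ((1 + (kappa d1 d2)^-1 * beta b1) / (1 + beta b1)) ^+ 2.

Definition std_hyp {R : realFieldType} (a d1 d2 b1 b2 : R) (y : nat) : Prop :=
  [/\ 0 < d2 /\ d2 < d1 /\ d1 < 1,
      0 < a /\ a <= theta d1 d2 /\ a <= 1 - d1,
      (0 < b1 /\ b1 < 1) /\ (0 < b2 /\ b2 < 1)
        /\ beta b1 = kappa d1 d2 * beta b2,
      (a <= b1 /\ b1 <= 1 - a) /\ (a <= b2 /\ b2 <= 1 - a)
    & (0 < y)%N /\ 1 <= Nsc d1 d2 y].

(* the second tail term of part (1), with the convention exp(-oo) = 0
   when x = x0 *)
Definition tail2 {R : realType} (C c u : R) (d1 d2 b1 : R) (x y : nat) : R :=
  if x%:R == x0 d1 d2 b1 y then 0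
  else C * expR (- (c * u ^+ 2 * (Nsc d1 d2 y) `^ (2 / 3)
                   / `|x%:R - x0 d1 d2 b1 y|)).

(* Main.v *)
(* Rains-EJS identity: tilting the left boundary of the model with densities
   (b1', b2) turns it into a stationary model, whose top output is a product
   measure. The exponential moment of the height is therefore explicit at the
   tilt matching the two densities; its logarithm is cubic, up to the mean, in
   the characteristic direction, whence the exponent 3/2.
   Stationary and tilted models are compared by adding second class particles on
   the upper part of the boundary and third class particles on the rest. Given
   the trajectory of the union of the two families, their labels perform an
   asymmetric exclusion dynamics started from its ground state, which is
   dominated by the reversible measure q^(number of inversions), q = d2/d1: the
   two families cannot overtake each other in large numbers. Hence the stationary
   exponential moment is at most a constant times the sum of two tilted ones.
   For the lower tail, the same comparison gives
   P(H - EH < -s) <= C exp(-c eps s) + P(H - EH < -2s), which is iterated. The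
   lower bound on the upper tail follows from the identity by Paley-Zygmund. *)
Require Import Defs.
From HB Require Import structures.
From mathcomp Require Import all_boot all_order all_algebra.
From mathcomp Require Import boolp reals topology normedtype derive realfun sequences exp.
From mathcomp Require Import perm zify ring lra.
Import Order.TTheory GRing.Theory Num.Theory numFieldNormedType.Exports.
Set Implicit Arguments. Unset Strict Implicit. Unset Printing Implicit Defensive.
Local Open Scope ring_scope.

(** * Words and exchange kernels *)

Section Words.
Variables (R : realType) (n : nat).
Implicit Types p : 'I_n * 'I_n.

(** The comparison with tilted models is one-sided. For a positive exponent the left density is
    lowered or the bottom one raised, so the family of higher priority enters ahead of the other one
    and the labels start without inversions. For a negative exponent the two families would start
    fully inverted, where the reversible measure gives no control; hence the separate argument for
    the lower tail. That argument needs two tilts of different sizes: [drift], small, on the upper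
    left boundary and [eps] on the rest. The lower left segment has order [s / (a ^+ 2 * eps)]
    sites: enough for many third class particles to enter there, and few enough that a change of
    measure from the density tilted by [2 * drift] back to [b1] is affordable. If many second class
    particles leave to the right, few third class ones leave through the top, and the union of all
    families gets a height that its upper tail forbids. This last step needs a floor [- 2 * s] under
    the original height, which is where the term at level [2 * s] in the recursion comes from. *)

Definition word (T : finType) := {ffun 'I_n -> T}.

Definition swapw (T : finType) p (w : word T) : word T :=
  [ffun k => w (tperm p.1 p.2 k)].

Definition mapw (T T' : finType) (m : T -> T') (w : word T) : word T' :=
  [ffun k => m (w k)].

Definition wcount (T : finType) (c : T) (w : word T) : nat :=
  (\sum_k (w k == c))%N.

Definition same_counts (T : finType) (w w' : word T) : Prop :=
  forall c, wcount c w = wcount c w'.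

Lemma swapwK (T : finType) p : involutive (@swapw T p).
Proof. by move=> w; apply/ffunP=> k; rewrite !ffunE tpermK. Qed.

Lemma swapw_id (T : finType) p (w : word T) : w p.1 = w p.2 -> swapw p w = w.
Proof. by move=> e; apply/ffunP=> k; rewrite ffunE; case: tpermP => // ->. Qed.

Lemma swapwL (T : finType) p (w : word T) : swapw p w p.1 = w p.2.
Proof. by rewrite ffunE tpermL. Qed.

Lemma swapwR (T : finType) p (w : word T) : swapw p w p.2 = w p.1.
Proof. by rewrite ffunE tpermR. Qed.

Lemma mapw_swapw (T T' : finType) (m : T -> T') p (w : word T) :
  mapw m (swapw p w) = swapw p (mapw m w).
Proof. by apply/ffunP=> k; rewrite !ffunE. Qed.

Lemma wcount_swapw (T : finType) p (w : word T) (c : T) :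
  wcount c (swapw p w) = wcount c w.
Proof.
rewrite /wcount (reindex_inj (@perm_inj _ (tperm p.1 p.2))) /=.
by apply: eq_bigr => k _; rewrite ffunE tpermK.
Qed.

Lemma same_counts_sum (T : finType) (P : pred T) (w w' : word T) :
  same_counts w w' -> (\sum_k P (w k) = \sum_k P (w' k))%N.
Proof.
move=> h; have e (v : word T) : (\sum_k P (v k) = \sum_c P c * wcount c v)%N.
  under [RHS]eq_bigr => c _ do rewrite big_distrr /=.
  rewrite exchange_big /=; apply: eq_bigr => k _.
  rewrite (bigD1 (v k)) //= eqxx muln1 big1 ?addn0 // => c.
  by rewrite eq_sym => /negbTE ->; rewrite muln0.
by rewrite !e; apply: eq_bigr => c _; rewrite h.
Qed.

Lemma sum_swapw (T : finType) p (F : word T -> R) :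
  \sum_w F (swapw p w) = \sum_w F w.
Proof. by rewrite [RHS](reindex_inj (inv_inj (@swapwK T p))). Qed.

Section Kernel.
Variables d1 d2 : R.
Hypothesis d1P : 0 <= d1 <= 1.
Hypothesis d2P : 0 <= d2 <= 1.

(* A colour of larger rank has priority. The pair [p] is (left input, bottom
   input) before the vertex is processed and (top output, right output) after
   it, so that going straight through the vertex amounts to a swap. *)
Definition rate (T : finType) (r : T -> nat) p (w : word T) : R :=
  if (r (w p.2) < r (w p.1))%N then d2
  else if (r (w p.1) < r (w p.2))%N then d1 else 0.

(** Observables are transported backwards: this is the conditional expectation of [F] after one
    vertex, so the head of the list in [ker] acts first in time. *)
Definition mv (T : finType) (r : T -> nat) p (F : word T -> R) (w : word T) : R :=
  (1 - rate r p w) * F w + rate r p w * F (swapw p w).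

Definition ker (T : finType) (r : T -> nat) (ps : seq ('I_n * 'I_n))
  (F : word T -> R) : word T -> R := foldr (fun p G => mv r p G) F ps.

Lemma ker_cat (T : finType) (r : T -> nat) ps qs (F : word T -> R) :
  ker r (ps ++ qs) F = ker r ps (ker r qs F).
Proof. exact: foldr_cat. Qed.

Lemma rate_01 (T : finType) (r : T -> nat) p (w : word T) : 0 <= rate r p w <= 1.
Proof. by rewrite /rate; case: ifP => _ //; case: ifP => _ //; rewrite lexx ler01. Qed.

Lemma mv_le (T : finType) (r : T -> nat) p (F G : word T -> R) w :
  F w <= G w -> F (swapw p w) <= G (swapw p w) -> mv r p F w <= mv r p G w.
Proof.
move=> h1 h2; have /andP[r0 r1] := rate_01 r p w.
by apply: lerD; apply: ler_wpM2l => //; rewrite subr_ge0.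
Qed.

(** Exchanges conserve every colour, so observables need only be compared on words with the colour
    counts of the initial word. *)
Lemma ker_le (T : finType) (r : T -> nat) ps (F G : word T -> R) w0 :
  (forall w, same_counts w w0 -> F w <= G w) -> ker r ps F w0 <= ker r ps G w0.
Proof.
elim: ps w0 => [|p ps IH] w0 h /=; first exact: h.
apply: mv_le; apply: IH => w hw; apply: h => // c.
by rewrite hw wcount_swapw.
Qed.

Lemma ker_eq (T : finType) (r : T -> nat) ps (F G : word T -> R) w0 :
  (forall w, same_counts w w0 -> F w = G w) -> ker r ps F w0 = ker r ps G w0.
Proof. by move=> h; apply/eqP; rewrite eq_le !ker_le // => w /h ->. Qed.

Lemma kerZ (T : finType) (r : T -> nat) ps a (F : word T -> R) w0 :
  ker r ps (fun w => a * F w) w0 = a * ker r ps F w0.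
Proof.
elim: ps w0 => [|p ps IH] w0 //=; rewrite /mv !IH; ring.
Qed.

Lemma kerD (T : finType) (r : T -> nat) ps (F G : word T -> R) w0 :
  ker r ps (fun w => F w + G w) w0 = ker r ps F w0 + ker r ps G w0.
Proof.
elim: ps w0 => [|p ps IH] w0 //=; rewrite /mv !IH; ring.
Qed.

Lemma ker_cst (T : finType) (r : T -> nat) ps a w0 :
  ker r ps (fun _ : word T => a) w0 = a.
Proof.
elim: ps w0 => [|p ps IH] w0 //=; rewrite /mv !IH; ring.
Qed.

(** The second clause forces merged colours of equal rank to coincide, so that exchanging them is
    invisible. *)
Definition rank_map (T T' : finType) (r : T -> nat) (r' : T' -> nat) (m : T -> T') :=
  forall a b, [/\ (r a <= r b)%N -> (r' (m a) <= r' (m b))%N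
                & r' (m a) = r' (m b) -> m a = m b].

Lemma rate_map (T T' : finType) (r : T -> nat) (r' : T' -> nat) (m : T -> T') p w :
  rank_map r r' m -> mapw m w p.1 != mapw m w p.2 ->
  rate r' p (mapw m w) = rate r p w.
Proof.
rewrite /rate !ffunE => hm ne.
have [h1 e1] := hm (w p.1) (w p.2); have [h2 _] := hm (w p.2) (w p.1).
have ne' : r' (m (w p.1)) != r' (m (w p.2)).
  by apply: contra_neq ne => /e1.
case: (ltngtP (r (w p.2)) (r (w p.1))) => [lt|lt|e].
- have := h2 (ltnW lt); rewrite leq_eqVlt eq_sym (negbTE ne') /= => ->.
  by [].
- have := h1 (ltnW lt); rewrite leq_eqVlt (negbTE ne') /= => l'.
  by rewrite ltnNge (ltnW l') /= l'.
- have := h1; have := h2; rewrite e leqnn => /(_ isT) l1 /(_ isT) l2.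
  by move: ne'; rewrite eqn_leq l1 l2.
Qed.

(** Inside a merged class an exchange fixes the merged word whatever its rate; between classes the
    rate depends only on the order of the merged ranks. This projection property lets one coloured
    kernel couple several uncoloured models. *)
Lemma ker_map (T T' : finType) (r : T -> nat) (r' : T' -> nat) (m : T -> T')
    ps (F : word T' -> R) w0 : rank_map r r' m ->
  ker r ps (fun w => F (mapw m w)) w0 = ker r' ps F (mapw m w0).
Proof.
move=> hm; elim: ps w0 => [|p ps IH] w0 //=.
rewrite /mv !IH mapw_swapw.
have [e|ne] := eqVneq (mapw m w0 p.1) (mapw m w0 p.2).
  by rewrite (swapw_id e); ring.
by rewrite (rate_map hm ne).
Qed.

Section Expectation.
Variable ps : seq ('I_n * 'I_n).

Definition wt (T : finType) (nu : 'I_n -> T -> R) (w : word T) : R :=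
  \prod_k nu k (w k).

(* [G] sees the initial and the final word. *)
Definition EX (T : finType) (r : T -> nat) (nu : 'I_n -> T -> R)
    (G : word T -> word T -> R) : R :=
  \sum_w0 wt nu w0 * ker r ps (G w0) w0.

Lemma wt_ge0 (T : finType) (nu : 'I_n -> T -> R) (w : word T) :
  (forall k c, 0 <= nu k c :> R) -> 0 <= wt nu w.
Proof. by move=> h; apply: prodr_ge0 => k _. Qed.

Lemma wt_supp (T : finType) (nu : 'I_n -> T -> R) w k : wt nu w != 0 -> nu k (w k) != 0.
Proof. by apply: contra_neq => e; rewrite /wt (bigD1 k) //= e mul0r. Qed.

Lemma EX_le (T : finType) (r : T -> nat) (nu : 'I_n -> T -> R) (F G : word T -> word T -> R) :
  (forall k c, 0 <= nu k c :> R) ->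
  (forall w0 w : word T, (forall k, nu k (w0 k) != 0) -> same_counts w w0 -> F w0 w <= G w0 w) ->
  EX r nu F <= EX r nu G.
Proof.
move=> h0 h; apply: ler_sum => w0 _.
have [->|ne] := eqVneq (wt nu w0) 0; first by rewrite !mul0r.
apply: ler_wpM2l; first exact: wt_ge0.
by apply: ker_le => w hw; apply: h => // k; apply: wt_supp.
Qed.

Lemma EXZ (T : finType) (r : T -> nat) (nu : 'I_n -> T -> R) a (F : word T -> word T -> R) :
  EX r nu (fun w0 w => a * F w0 w) = a * EX r nu F.
Proof. by rewrite /EX mulr_sumr; apply: eq_bigr => w0 _; rewrite kerZ mulrCA. Qed.

Lemma EXD (T : finType) (r : T -> nat) (nu : 'I_n -> T -> R) (F G : word T -> word T -> R) :
  EX r nu (fun w0 w => F w0 w + G w0 w) = EX r nu F + EX r nu G.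
Proof. by rewrite /EX -big_split /=; apply: eq_bigr => w0 _; rewrite kerD mulrDr. Qed.

Lemma wt_init (T : finType) (nu : 'I_n -> T -> R) (F : 'I_n -> T -> R) :
  \sum_w0 wt nu w0 * \prod_k F k (w0 k) = \prod_k \sum_c nu k c * F k c.
Proof.
rewrite bigA_distr_bigA /=; apply: eq_bigr => w _.
by rewrite /wt -big_split.
Qed.

Lemma EX_cst (T : finType) (r : T -> nat) (nu : 'I_n -> T -> R) a :
  EX r nu (fun _ _ => a) = a * \prod_k \sum_(c : T) nu k c.
Proof.
rewrite bigA_distr_bigA /= /EX mulr_sumr; apply: eq_bigr => w0 _.
by rewrite ker_cst mulrC.
Qed.

Lemma EX_map (T T' : finType) (r : T -> nat) (r' : T' -> nat) (m : T -> T') (nu : 'I_n -> T -> R)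
    (G : word T' -> word T' -> R) : rank_map r r' m ->
  EX r nu (fun w0 w => G (mapw m w0) (mapw m w)) =
  EX r' (fun k t => \sum_(c | m c == t) nu k c) G.
Proof.
move=> hm; rewrite /EX (partition_big (mapw m) xpredT) //=.
apply: eq_bigr => v _; rewrite /wt.
rewrite bigA_distr_big_dep /= mulr_suml; apply: eq_big.
  move=> w; apply/eqP/familyP => [<- k|h].
    by rewrite unfold_in /= ffunE.
  by apply/ffunP => k; rewrite ffunE; apply/eqP; have := h k; rewrite unfold_in.
by move=> w /eqP <-; rewrite (ker_map _ (G (mapw m w)) _ hm).
Qed.

End Expectation.
End Kernel.
End Words.

(** * Labels of second and third class particles *)

Section Labels.
Variable R : realType.
Implicit Types (r q : R).

(* Colours by priority: 3 is the base configuration, 2 and 1 are two families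
   of second class particles, 0 is an empty edge. *)
Notation col := 'I_4.
Notation rk := (@nat_of_ord 4).

Definition mg (c : col) : col := if c == 2%N :> nat then inord 1 else c.

Lemma mgE c : mg c = (if c == 2%N :> nat then 1%N else c) :> nat.
Proof. by rewrite /mg; case: ifP => // _; rewrite inordK. Qed.

Lemma mg_rank_map : rank_map rk rk mg.
Proof.
move=> a b; rewrite !mgE; split; last by move=> e; apply: val_inj; rewrite /= !mgE.
by case: eqP => [->|?]; case: eqP => [->|?] //; lia.
Qed.

(** An inversion is a 1 standing before a 2. Between neighbours the dynamics removes one at rate
    [d1] and creates one at rate [d2]. *)
Definition inv n (w : word n col) : nat :=
  (\sum_(i < n) \sum_(j < n) (i < j) * ((w i == 1 :> nat) * (w j == 2 :> nat)))%N.

Definition n2 n (w : word n col) : nat := (\sum_k (w k == 2 :> nat))%N.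

Definition adjacent n (p : 'I_n * 'I_n) := p.2 == p.1.+1 :> nat.

Lemma inv_swapw n (p : 'I_n * 'I_n) (w : word n col) : adjacent p ->
  (inv (swapw p w) + (w p.1 == 1 :> nat) * (w p.2 == 2 :> nat) =
   inv w + (w p.2 == 1 :> nat) * (w p.1 == 2 :> nat))%N.
Proof.
case: p => a b /eqP /= hab; set t := tperm a b.
have one (u v : 'I_n) (f : 'I_n -> 'I_n -> nat) :
    (f u v = \sum_i \sum_j ((i == u) && (j == v)) * f i j)%N.
  rewrite (bigD1 u) //= (bigD1 v) //= !eqxx mul1n.
  rewrite [X in (_ + X + _)%N]big1 ?addn0; last by move=> j /negbTE ->; rewrite andbF.
  by rewrite [X in (_ + X)%N]big1 ?addn0 // => i /negbTE ->; rewrite big1.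
pose f i j := ((w i == 1 :> nat) * (w j == 2 :> nat))%N.
have -> : inv (swapw (a, b) w) = (\sum_(i < n) \sum_(j < n) (t i < t j) * f i j)%N.
  rewrite /inv (reindex_inj (@perm_inj _ t)) /=; apply: eq_bigr => i _.
  rewrite (reindex_inj (@perm_inj _ t)) /=; apply: eq_bigr => j _.
  by rewrite !ffunE !tpermK.
rewrite /= -/(f a b) -/(f b a) (one a b f) (one b a f) /inv -!big_split /=; apply: eq_bigr => i _.
rewrite -!big_split /=; apply: eq_bigr => j _; rewrite -!mulnDl; congr muln.
have v (u u' : 'I_n) : (u == u') = (u == u' :> nat) by [].
rewrite !v /t; case: tpermP => [->|->|/eqP n1 /eqP n3]; case: tpermP => [->|->|/eqP n4 /eqP n5];
  repeat match goal with H : is_true (_ != _) |- _ => rewrite v in H; move: H end; lia.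
Qed.

Lemma swapw_fibre n (p : 'I_n * 'I_n) (v : word n col) (F : word n col -> R) :
  \sum_(w | mapw mg w == v) F (swapw p w) = \sum_(w | mapw mg w == swapw p v) F w.
Proof.
rewrite [RHS](reindex_inj (inv_inj (@swapwK n _ p))) /=.
by apply: eq_bigl => w; rewrite mapw_swapw (inj_eq (inv_inj (@swapwK n _ p))).
Qed.

(** * Reversibility of the labels given the merged word *)

Section LabelKernel.
Variables (n : nat) (d1 d2 q : R).
Hypothesis d1P : 0 <= d1 <= 1.
Hypothesis d2P : 0 <= d2 <= 1.
Hypothesis q0 : 0 <= q.
Hypothesis dq : d2 = q * d1.

Definition lab (F : word n col -> R) (v : word n col) : R :=
  \sum_(w | mapw mg w == v) q ^+ inv w * F w.

(* [q ^+ inv] is a reversible measure of the exchanges between the colours 1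
   and 2, as in the blocking measures of the asymmetric exclusion process. *)
Lemma lab_mv p (F : word n col -> R) v : adjacent p ->
  lab (mv d1 d2 rk p F) v = mv d1 d2 rk p (lab F) v.
Proof.
move=> hp; rewrite /lab /mv.
have [e|ne] := eqVneq (v p.1) (v p.2).
  (* Equal merged letters: the exchange fixes [v], and detailed balance between a labelling and its
     swap cancels gain against loss. *)
  rewrite (swapw_id e); set X := \sum_(w | _) q ^+ inv w * F w.
  transitivity X; last by ring.
  have -> : \sum_(w | mapw mg w == v) q ^+ inv w *
      ((1 - rate d1 d2 rk p w) * F w + rate d1 d2 rk p w * F (swapw p w)) =
      X + (\sum_(w | mapw mg w == v) q ^+ inv w * rate d1 d2 rk p w * F (swapw p w)
           - \sum_(w | mapw mg w == v) q ^+ inv w * rate d1 d2 rk p w * F w).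
    rewrite /X -sumrB -big_split /=; apply: eq_bigr => w _; ring.
  suff -> : \sum_(w | mapw mg w == v) q ^+ inv w * rate d1 d2 rk p w * F (swapw p w) =
      \sum_(w | mapw mg w == v) q ^+ inv w * rate d1 d2 rk p w * F w.
    by rewrite subrr addr0.
  pose Fr w' := q ^+ inv (swapw p w') * rate d1 d2 rk p (swapw p w') * F w'.
  transitivity (\sum_(w | mapw mg w == v) Fr (swapw p w)).
    by apply: eq_bigr => w _; rewrite /Fr swapwK.
  rewrite (swapw_fibre p v Fr) (swapw_id e); apply: eq_bigr => w /eqP hw; congr (_ * F w).
  have hi := inv_swapw w hp.
  move: e; rewrite -hw !ffunE => /(congr1 val) /=; rewrite !mgE.
  rewrite /rate swapwL swapwR.
  move: hi; case: (w p.1) => a ha; case: (w p.2) => b hb /=.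
  case: (eqVneq a 2%N) => [->|na]; case: (eqVneq b 2%N) => [->|nb] //=.
  - by rewrite !mulr0.
  - move=> hi eb; rewrite -{}eb /= muln0 mul1n addn0 in hi *.
    by rewrite hi addn1 exprS dq; ring.
  - move=> hi ea; rewrite ea /= muln0 mul1n addn0 in hi *.
    by rewrite -hi addn1 exprS dq; ring.
  - by move=> _ ->; rewrite !ltnn !mulr0.
(* Distinct merged letters: at most one of the two is a label, so neither the rate nor [inv] depends
   on the labelling. *)
have hr w : mapw mg w == v -> rate d1 d2 rk p w = rate d1 d2 rk p v.
  by move=> /eqP hw; rewrite -hw (rate_map _ _ mg_rank_map) // hw.
have hi w : mapw mg w == v -> inv (swapw p w) = inv w.
  move=> /eqP hw; have := inv_swapw w hp; move: ne; rewrite -hw !ffunE.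
  rewrite -val_eqE /= !mgE.
  case: (w p.1) => a ha; case: (w p.2) => b hb /=.
  case: (eqVneq a 2%N) => [->|na]; case: (eqVneq b 2%N) => [->|nb] //=.
  - by rewrite eq_sym => /negbTE ->; rewrite !addn0.
  - by move=> /negbTE ->; rewrite !addn0.
  - by rewrite !muln0 !addn0.
under eq_bigr => w hw do rewrite (hr w hw) mulrDr.
rewrite big_split /= !mulr_sumr; congr (_ + _).
  by apply: eq_bigr => w _; ring.
rewrite -(swapw_fibre p v (fun w => rate d1 d2 rk p v * (q ^+ inv w * F w))).
by apply: eq_bigr => w hw; rewrite hi //; ring.
Qed.

Lemma lab_ker ps (F : word n col -> R) v : all (@adjacent n) ps ->
  lab (ker d1 d2 rk ps F) v = ker d1 d2 rk ps (lab F) v.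
Proof.
elim: ps v => [|p ps IH] v //= /andP[hp hps].
rewrite lab_mv // /mv !IH //.
Qed.

(** The point mass at a word without inversions is one term, of weight [q ^+ 0], of the measure
    summed by [lab]. The intertwining [lab_ker] carries this domination through all exchanges. *)
Lemma ker_label ps (F : word n col -> R) w0 : all (@adjacent n) ps ->
  (forall w, 0 <= F w) -> inv w0 = 0%N ->
  ker d1 d2 rk ps F w0 <= ker d1 d2 rk ps (lab F) (mapw mg w0).
Proof.
move=> hps F0 h0; rewrite -lab_ker // /lab (bigD1 w0) //= h0 expr0 mul1r lerDl.
apply: sumr_ge0 => w _; apply: mulr_ge0; first exact: exprn_ge0.
by rewrite -(ker_cst d1 d2 rk ps 0 w); apply: ker_le.
Qed.

End LabelKernel.

(** * Total mass of the label measure *)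

Definition consw n (a : col) (w : word n col) : word n.+1 col :=
  [ffun k => oapp w a (unlift ord0 k)].

Lemma consw0 n a (w : word n col) : consw a w ord0 = a.
Proof. by rewrite ffunE unlift_none. Qed.

Lemma consw1 n a (w : word n col) k : consw a w (lift ord0 k) = w k.
Proof. by rewrite ffunE liftK. Qed.

Lemma sum_consw n (F : word n.+1 col -> R) :
  \sum_w F w = \sum_a \sum_w F (consw a w).
Proof.
rewrite pair_big /= (reindex (fun aw => consw aw.1 aw.2)) //=.
exists (fun w => (w ord0, [ffun k => w (lift ord0 k)])) => [[a w]|w] _ /=.
  by rewrite consw0; congr pair; apply/ffunP => k; rewrite ffunE consw1.
apply/ffunP => k; rewrite ffunE.
by case: unliftP => [j ->|->] //=; rewrite ffunE.
Qed.

Lemma inv_consw n a (w : word n col) :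
  inv (consw a w) = ((a == 1 :> nat) * n2 w + inv w)%N.
Proof.
rewrite /inv big_ord_recl big_ord_recl ltnn mul0n add0n; congr addn.
  rewrite /n2 big_distrr; apply: eq_bigr => k _ /=; rewrite consw0 consw1.
  by rewrite mul1n.
apply: eq_bigr => i _; rewrite big_ord_recl /= add0n; apply: eq_bigr => j _.
by rewrite !consw1.
Qed.

Lemma n2_consw n a (w : word n col) : n2 (consw a w) = ((a == 2 :> nat) + n2 w)%N.
Proof.
by rewrite /n2 big_ord_recl consw0; congr addn; apply: eq_bigr => k _; rewrite consw1.
Qed.

Lemma mg_consw n a (w : word n col) (v : word n.+1 col) :
  (mapw mg (consw a w) == v) =
  (mg a == v ord0) && (mapw mg w == [ffun k => v (lift ord0 k)]).
Proof.
apply/eqP/andP => [<-|[/eqP h1 /eqP /ffunP h2]].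
  by rewrite ffunE consw0 eqxx; split=> //; apply/eqP/ffunP => k; rewrite !ffunE liftK.
apply/ffunP => k; case: (unliftP ord0 k) => [j ->|->]; rewrite ffunE.
  by rewrite consw1; have := h2 j; rewrite !ffunE.
by rewrite consw0.
Qed.

(** Inverse of the q-Pochhammer symbol: the limit of the Gaussian binomial coefficients as the
    number of letters grows, hence a bound free of [n]. *)
Definition poch r k : R := \prod_(i < k) (1 - r ^+ i.+1)^-1.

Lemma poch_ge0 r k : 0 <= r < 1 -> 0 <= poch r k.
Proof.
move=> /andP[r0 r1]; apply: prodr_ge0 => i _; rewrite invr_ge0 subr_ge0.
by apply: exprn_ile1 => //; apply: ltW.
Qed.

Lemma expr_lt1S r k : 0 <= r < 1 -> r ^+ k.+1 < 1.
Proof. by move=> /andP[r0 r1]; rewrite exprn_ilt1. Qed.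

(* The sum is a Gaussian binomial coefficient, bounded by means of Pascal's rule. *)
Lemma inv_sum_le n (v : word n col) k r : 0 <= r < 1 ->
  \sum_(w | (mapw mg w == v) && (n2 w == k)) r ^+ inv w <= poch r k.
Proof.
move=> hr; have /andP[r0 r1] := hr; elim: n v k => [|n IH] v k.
  have e (w : word 0 col) : inv w = 0%N by rewrite /inv big_ord0.
  have e2 (w : word 0 col) : n2 w = 0%N by rewrite /n2 big_ord0.
  under eq_bigr => w _ do rewrite e expr0.
  have z (w : word 0 col) : w = v by apply/ffunP; case.
  rewrite (bigID (pred1 v)) /= [X in _ + X]big_pred0 ?addr0; last first.
    by move=> w; rewrite (z w) eqxx andbF.
  case: (eqVneq k 0%N) => [->|nk].
    rewrite /poch big_ord0 (bigD1 v) /=; last first.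
      by rewrite e2 !eqxx andbT; apply/andP; split=> //; apply/eqP/ffunP; case.
    rewrite big1 ?addr0 // => w.
    by rewrite (z w) eqxx andbF.
  by rewrite big_pred0 ?poch_ge0 // => w; rewrite e2 [(0%N == k)]eq_sym (negbTE nk) andbF.
pose v' : word n col := [ffun k => v (lift ord0 k)].
pose g j := \sum_(w | (mapw mg w == v') && (n2 w == j)) r ^+ inv w.
have g0 j : 0 <= g j by apply: sumr_ge0 => w _; apply: exprn_ge0.
have gle j : g j <= poch r j := IH v' j.
rewrite big_mkcond sum_consw.
have term (a : col) : \sum_(w : word n col)
    (if (mapw mg (consw a w) == v) && (n2 (consw a w) == k) then r ^+ inv (consw a w) else 0)
    = (mg a == v ord0)%:R * (if a == 2 :> nat then (if k is k'.+1 then g k' else 0)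
       else if a == 1 :> nat then r ^+ k * g k else g k).
  have [ha|ha] := boolP (mg a == v ord0); last first.
    by rewrite mul0r big1 // => w _; rewrite mg_consw (negbTE ha).
  rewrite mul1r; under eq_bigr => w _ do rewrite mg_consw ha n2_consw inv_consw /=.
  rewrite -big_mkcond /=; case: ifP => a2.
    rewrite (eqP a2) /=; case: k => [|k'].
      by rewrite big_pred0 // => w; rewrite andbF.
    by apply: eq_bigl => w; rewrite add1n eqSS.
  case: ifP => a1; last by under eq_bigr => w _ do rewrite mul0n add0n.
  rewrite /g mulr_sumr; apply: eq_bigr => w /andP[_ /eqP hk].
  by move: hk; rewrite add0n => ->; rewrite mul1n exprD.
under eq_bigr => a _ do rewrite term.
have bound (b : bool) : (b%:R : R) <= 1 by case: b; rewrite ?lexx ?ler01.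
rewrite !big_ord_recl big_ord0 addr0 /=.
have mgv (a : col) : (mg a == v ord0) = ((if a == 2 :> nat then 1%N else a) == v ord0 :> nat).
  by rewrite -val_eqE /= mgE.
rewrite !mgv /= /bump /=.
(* A leading 2 leaves one 2 fewer and creates no inversion; a leading 1 stands before all [k] twos,
   whence the factor [r ^+ k]. *)
have hk : (if k is k'.+1 then g k' else 0) + r ^+ k * g k <= poch r k.
  clear term; case: k => [|k]; first by rewrite add0r expr0 mul1r.
  have e : poch r k = (1 - r ^+ k.+1) * poch r k.+1.
    rewrite /poch big_ord_recr /= mulrCA mulfV ?mulr1 //.
    by rewrite subr_eq0 eq_sym lt_eqF // expr_lt1S.
  have h1 := gle k; have h2 : r ^+ k.+1 * g k.+1 <= r ^+ k.+1 * poch r k.+1.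
    by apply: ler_wpM2l => //; apply: exprn_ge0.
  rewrite e in h1; lra.
have gk := gle k; have gk0 := g0 k; have pk := poch_ge0 k hr.
by case: (v ord0) => [[|[|[|[|c]]]] hc] //=;
  rewrite ?mul0r ?mul1r ?add0r ?addr0 // addrC.
Qed.

Definition labC r : R := expR (r / (1 - r) ^+ 2).

(** Each factor is at most [1 + r ^+ i.+1 / (1 - r)], and the geometric series of these corrections
    is at most [r / (1 - r) ^+ 2]. *)
Lemma poch_le r k : 0 <= r < 1 -> poch r k <= labC r.
Proof.
move=> hr; have /andP[r0 r1] := hr; have r1' : 0 < 1 - r by rewrite subr_gt0.
have s : (1 - r) * \sum_(i < k) r ^+ i.+1 = r - r ^+ k.+1.
  elim: k => [|k IH]; first by rewrite big_ord0 mulr0 expr1 subrr.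
  rewrite big_ord_recr mulrDr IH /= [in RHS]exprS; ring.
have : poch r k <= \prod_(i < k) expR (r ^+ i.+1 / (1 - r)).
  apply: ler_prod => i _; have h := expr_lt1S i hr; have h0 : 0 <= r ^+ i.+1 by apply: exprn_ge0.
  rewrite invr_ge0 subr_ge0 ltW //=.
  have hle : r ^+ i.+1 <= r by rewrite exprS ler_piMr // exprn_ile1 // ltW.
  apply: le_trans (expR_ge1Dx _); rewrite -[X in X <= _]mul1r ler_pdivrMr ?subr_gt0 //.
  set t := r ^+ i.+1 in h h0 hle *.
  have -> : (1 + t / (1 - r)) * (1 - t) = 1 + t * (r - t) / (1 - r).
    by field; rewrite gt_eqF.
  by rewrite lerDl divr_ge0 ?mulr_ge0 ?subr_ge0 // ltW.
move=> /le_trans; apply; rewrite -expR_sum ler_expR -mulr_suml.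
have -> : \sum_(i < k) r ^+ i.+1 = (r - r ^+ k.+1) / (1 - r).
  by rewrite -s mulrC mulKf // gt_eqF.
rewrite expr2 invfM mulrA; apply: ler_wpM2r; first by rewrite invr_ge0 ltW.
apply: ler_wpM2r; first by rewrite invr_ge0 ltW.
by rewrite gerBl exprn_ge0.
Qed.

(** Exponential concentration of the number of inversions: a weight [gam ^+ inv] is absorbed by
    [q ^+ inv] as long as [q * gam] stays below 1, at a cost independent of the size of the
    system. *)
Lemma label_conc n d1 d2 q gam r ps (F G : word n col -> R) w0 :
  0 <= d1 <= 1 -> 0 <= d2 <= 1 -> d2 = q * d1 -> 0 <= q -> 0 <= gam ->
  q * gam <= r -> 0 <= r < 1 -> all (@adjacent n) ps -> inv w0 = 0%N ->
  (forall v, 0 <= G v) ->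
  (forall w, same_counts w w0 -> F w <= G (mapw mg w) * gam ^+ inv w) ->
  ker d1 d2 rk ps F w0 <= labC r * ker d1 d2 rk ps G (mapw mg w0).
Proof.
move=> d1P d2P dq q0 gam0 qr hr hps h0 G0 hF.
(* The number of twos is conserved; fixing it reduces the sum over labellings to a single Gaussian
   binomial coefficient. *)
pose F' w := if n2 w == n2 w0 then G (mapw mg w) * gam ^+ inv w else 0.
have hle : ker d1 d2 rk ps F w0 <= ker d1 d2 rk ps F' w0.
  apply: ker_le => // w hw; rewrite /F' ifT ?hF //; apply/eqP.
  exact: (same_counts_sum (fun c : col => c == 2 :> nat) hw).
apply: (le_trans hle); apply: (le_trans (@ker_label n d1 d2 q d1P d2P q0 dq ps F' w0 hps _ h0)).
  by move=> w; rewrite /F'; case: ifP => // _; apply: mulr_ge0 => //; apply: exprn_ge0.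
rewrite -kerZ; apply: ker_le => // v _; rewrite /lab.
apply: (@le_trans _ _ (\sum_(w | (mapw mg w == v) && (n2 w == n2 w0)) G v * r ^+ inv w)).
  rewrite big_mkcondr /=; apply: ler_sum => w /eqP hw; rewrite /F' hw; case: ifP => _; last by rewrite mulr0.
  rewrite mulrCA; apply: ler_wpM2l => //; rewrite -exprMn.
  by apply: lerXn2r; rewrite ?nnegrE ?mulr_ge0 //; case/andP: hr.
rewrite -mulr_sumr mulrC; apply: ler_wpM2r => //.
exact: le_trans (inv_sum_le _ _ hr) (poch_le _ hr).
Qed.

End Labels.

(** * Sweeping the quadrant along down-right paths *)

Section Geometry.
Variables (R : realType) (x y' : nat).
Local Notation y := y'.+1.
Local Notation n := (y' + x).+1.
Variables d1 d2 : R.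

(* Words list the states of the edges crossed by a down-right path, from top
   left to bottom right; processing the vertex [(i + 1, j + 1)] acts on the
   positions [vpos i j] of the path. *)
Definition vpos (i j : nat) : 'I_n * 'I_n := (inord (i + (y' - j)), inord (i + (y' - j)).+1).

Definition sweep : seq ('I_n * 'I_n) :=
  flatten [seq [seq vpos i j | j <- iota 0 y] | i <- iota 0 x].

Definition rb (b : bool) : nat := b.

(** The first [y] positions of the initial path are the left edges, the first [x] positions of the
    final path are the top edges. *)
Definition hgt (T : finType) (P : pred T) (w0 w : word n T) : R :=
  \sum_(k < n | (k < y)%N) (P (w0 k))%:R - \sum_(k < n | (k < x)%N) (P (w k))%:R.

Lemma vpos1 i j : (i < x)%N -> (vpos i j).1 = (i + (y' - j))%N :> nat.
Proof. by move=> hi; rewrite /= inordK //; lia. Qed.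

Lemma vpos2 i j : (i < x)%N -> (vpos i j).2 = (i + (y' - j)).+1 :> nat.
Proof. by move=> hi; rewrite /= inordK //; lia. Qed.

Lemma sweep_adjacent : all (@adjacent n) sweep.
Proof.
apply/allP => p /flattenP[s /mapP[i]]; rewrite mem_iota => /andP[_ hi] -> /mapP[j _ ->].
by rewrite /adjacent vpos1 ?vpos2.
Qed.

(* The edge at position [k] when the first [i] columns and the first [j]
   vertices of the next one have been processed; [(true, c, s)] is the edge
   going up from [(c, s)] and [(false, c, s)] the edge going right. *)
Definition edge i j k : bool * nat * nat :=
  if (k < i)%N then (true, k.+1, y)
  else if (k < i + (y - j))%N then (false, i, (i + y - k)%N)
  else if k == (i + (y - j))%N then (true, i.+1, j)
  else if (k <= i + y)%N then (false, i.+1, (i + y.+1 - k)%N)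
  else (true, (k - y).+1, 0%N).

Lemma edge_col i k : edge i y k = edge i.+1 0 k.
Proof.
rewrite /edge.
do ![case: ifP => ?]; solve [by exfalso; lia | by congr (_, _, _); lia].
Qed.

Lemma edge_in i j : (i < x)%N -> (j < y)%N ->
  edge i j (vpos i j).1 = (false, i, j.+1) /\ edge i j (vpos i j).2 = (true, i.+1, j).
Proof.
move=> hi hj; rewrite vpos1 // vpos2 // /edge.
by split; do ![case: ifP => ?]; solve [by exfalso; lia | by congr (_, _, _); lia].
Qed.

Lemma edge_out i j : (i < x)%N -> (j < y)%N ->
  edge i j.+1 (vpos i j).1 = (true, i.+1, j.+1) /\
  edge i j.+1 (vpos i j).2 = (false, i.+1, j.+1).
Proof.
move=> hi hj; rewrite vpos1 // vpos2 // /edge.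
by split; do ![case: ifP => ?]; solve [by exfalso; lia | by congr (_, _, _); lia].
Qed.

Lemma edge_other i j (k : 'I_n) : (i < x)%N -> (j < y)%N ->
  k != (vpos i j).1 -> k != (vpos i j).2 -> edge i j.+1 k = edge i j k.
Proof.
have v (a b : 'I_n) : (a == b) = (a == b :> nat) by [].
move=> hi hj; rewrite !v.
rewrite vpos1 // vpos2 // /edge => h1 h2.
by do ![case: ifP => ?]; solve [by exfalso; lia | by congr (_, _, _); lia].
Qed.

(** Shared by the stationarity of product measures and by the passage from coins to the kernel:
    [Phi i j] is an expectation at stage [(i, j)], and a completed column is the start of the next
    one. *)
Lemma sweep_ind (r : bool -> nat) (Phi : nat -> nat -> (word n bool -> R) -> R) F :
  (forall i j G, (i < x)%N -> (j < y)%N ->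
     Phi i j (mv d1 d2 r (vpos i j) G) = Phi i j.+1 G) ->
  (forall i G, (i < x)%N -> Phi i y G = Phi i.+1 0%N G) ->
  Phi 0%N 0%N (ker d1 d2 r sweep F) = Phi x 0%N F.
Proof.
move=> hstep hcol; rewrite /sweep.
have col i j m G : (i < x)%N -> (j + m <= y)%N ->
    Phi i j (ker d1 d2 r [seq vpos i j | j <- iota j m] G) = Phi i (j + m)%N G.
  elim: m j => [|m IH] j hi hj; first by rewrite addn0.
  by rewrite /= hstep ?IH //; try lia; rewrite addSnnS.
suff rows i m G : (i + m <= x)%N ->
    Phi i 0%N (ker d1 d2 r (flatten [seq [seq vpos i j | j <- iota 0 y] | i <- iota i m]) G)
    = Phi (i + m)%N 0%N G by rewrite rows.
elim: m i => [|m IH] i hi; first by rewrite addn0.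
rewrite -[flatten _]/([seq vpos i j | j <- iota 0 y] ++
  flatten [seq [seq vpos i j | j <- iota 0 y] | i <- iota i.+1 m]) ker_cat.
have hi' : (i < x)%N by lia.
by rewrite col // hcol // IH ?addSnnS //; lia.
Qed.

(** * Product measures along down-right paths *)

Section Stationary.
Variables b1 b2 : R.
Hypothesis balance : b1 * (1 - b2) * (1 - d2) = b2 * (1 - b1) * (1 - d1).

Definition wbern (rho : 'I_n -> R) (w : word n bool) : R := wt (fun k => bern (rho k)) w.

Definition stage_dens i j (k : 'I_n) : R := if (edge i j k).1.1 then b2 else b1.

(** Burke property of one vertex. Under [balance] the outputs are again independent; the densities
    appear exchanged because the pair lists the left input first but the top output first. *)
Lemma wbern_mv (rho : 'I_n -> R) (p : 'I_n * 'I_n) G : p.1 != p.2 ->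
  rho p.1 = b1 -> rho p.2 = b2 ->
  \sum_w wbern rho w * mv d1 d2 rb p G w =
  \sum_w wbern (fun k => rho (tperm p.1 p.2 k)) w * G w.
Proof.
move=> hne h1 h2; rewrite /mv.
under eq_bigr => w _ do rewrite mulrDr !mulrA.
rewrite big_split /= -[X in _ + X](sum_swapw p) -big_split /=.
apply: eq_bigr => w _; rewrite swapwK -mulrDl; congr (_ * G w).
have eswap : wbern rho (swapw p w) = wbern (fun k => rho (tperm p.1 p.2 k)) w.
  rewrite /wbern /wt (reindex_inj (@perm_inj _ (tperm p.1 p.2))) /=.
  by apply: eq_bigr => k _; rewrite ffunE tpermK.
rewrite eswap.
pose rest := \prod_(k | (k != p.1) && (k != p.2)) bern (rho k) (w k).
have e1 : wbern rho w = bern b1 (w p.1) * bern b2 (w p.2) * rest.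
  by rewrite /wbern /wt (bigD1 p.1) //= (bigD1 p.2) 1?eq_sym //= h1 h2 mulrA.
have e2 : wbern (fun k => rho (tperm p.1 p.2 k)) w = bern b2 (w p.1) * bern b1 (w p.2) * rest.
  rewrite /wbern /wt (bigD1 p.1) //= (bigD1 p.2) 1?eq_sym //= tpermL tpermR h1 h2 mulrA.
  by congr (_ * _); apply: eq_bigr => k /andP[n1 n2]; rewrite tpermD // eq_sym.
rewrite e1 e2 /rate swapwL swapwR /rb.
have bal : b1 * (1 - b2) * (1 - d2) * rest = b2 * (1 - b1) * (1 - d1) * rest.
  by rewrite balance.
by case: (w p.1); case: (w p.2) => /=; lra.
Qed.

Lemma stationary F :
  \sum_w wbern (stage_dens 0 0) w * ker d1 d2 rb sweep F w =
  \sum_w wbern (stage_dens x 0) w * F w.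
Proof.
apply: (@sweep_ind _ (fun i j G => \sum_w wbern (stage_dens i j) w * G w)).
  move=> i j G hi hj.
  have [e1 e2] := edge_in hi hj; have [o1 o2] := edge_out hi hj.
  have hne : (vpos i j).1 != (vpos i j).2.
    have v (a b : 'I_n) : (a == b) = (a == b :> nat) by [].
    by rewrite v vpos1 // vpos2 //; lia.
  rewrite wbern_mv //; try by rewrite /stage_dens ?e1 ?e2.
  apply: eq_bigr => w _; congr (_ * _); apply: eq_bigr => k _; congr (bern _ _).
  rewrite /stage_dens; case: tpermP => [->|->|/eqP n1 /eqP n2].
  - by rewrite e2 o1.
  - by rewrite e1 o2.
  - by rewrite edge_other.
by move=> i G hi; apply: eq_bigr => w _; congr (_ * _); apply: eq_bigr => k _;
  rewrite /stage_dens edge_col.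
Qed.

End Stationary.
End Geometry.

(** * From seeds to the exchange kernel *)

Section Coins.
Variables (R : realType) (K : finType).

Definition cexp (p : R) (f : {ffun K -> bool} -> R) : R :=
  \sum_(c : {ffun K -> bool}) (\prod_k bern p (c k)) * f c.

Definition flip (k : K) (c : {ffun K -> bool}) : {ffun K -> bool} :=
  [ffun l => if l == k then ~~ c l else c l].

Lemma flipK k : involutive (flip k).
Proof. by move=> c; apply/ffunP => l; rewrite !ffunE; case: eqP => // _; rewrite negbK. Qed.

(** Flipping coin [k] matches its two values while [f] and [g] stay fixed, so this coin can be
    averaged alone. *)
Lemma cexp_coin p k (f g : {ffun K -> bool} -> R) :
  (forall c, f (flip k c) = f c) -> (forall c, g (flip k c) = g c) ->
  cexp p (fun c => if c k then f c else g c) = cexp p (fun c => p * f c + (1 - p) * g c).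
Proof.
move=> hf hg; rewrite /cexp.
pose rest (c : {ffun K -> bool}) := \prod_(l | l != k) bern p (c l).
have restF c : rest (flip k c) = rest c.
  by apply: eq_bigr => l /negbTE hl; rewrite ffunE hl.
have flips (h : {ffun K -> bool} -> R) : (forall c, h (flip k c) = h c) ->
    \sum_(c : {ffun K -> bool} | ~~ c k) rest c * h c = \sum_(c : {ffun K -> bool} | c k) rest c * h c.
  move=> hh; rewrite (reindex_inj (inv_inj (flipK k))) /=.
  apply: eq_big => [c|c _]; first by rewrite ffunE eqxx negbK.
  by rewrite restF hh.
have e (c : {ffun K -> bool}) : \prod_l bern p (c l) = bern p (c k) * rest c by rewrite (bigD1 k).
under eq_bigr => c _ do rewrite e.
under [RHS]eq_bigr => c _ do rewrite e.
have split (h h' : {ffun K -> bool} -> R) : (forall c, h (flip k c) = h c) ->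
    (forall c, h' (flip k c) = h' c) ->
    \sum_(c : {ffun K -> bool}) bern p (c k) * rest c * (if c k then h c else h' c) =
    \sum_(c : {ffun K -> bool} | c k) (p * (rest c * h c) + (1 - p) * (rest c * h' c)).
  move=> h1 h2; rewrite (bigID (fun c : {ffun K -> bool} => c k)) /= big_split /=; congr (_ + _).
    by apply: eq_bigr => c ->; rewrite mulrA.
  rewrite -!mulr_sumr -(flips h') // mulr_sumr.
  by apply: eq_bigr => c /negbTE ->; rewrite mulrA.
rewrite split //.
have -> : \sum_(c : {ffun K -> bool}) bern p (c k) * rest c * (p * f c + (1 - p) * g c) =
   \sum_(c : {ffun K -> bool}) bern p (c k) * rest c *
      (if c k then p * f c + (1 - p) * g c else p * f c + (1 - p) * g c).
  by apply: eq_bigr => c _; rewrite if_same.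
rewrite split; try by move=> c; rewrite hf hg.
by apply: eq_bigr => c _; ring.
Qed.

Lemma eq_cexp p f g : f =1 g -> cexp p f = cexp p g.
Proof. by move=> h; apply: eq_bigr => c _; rewrite h. Qed.

End Coins.

Lemma s6v_cfg_local Lb Bb c1 c2 c1' c2' i j :
  (forall i' j', (i' <= i)%N -> (j' <= j)%N -> c1 i' j' = c1' i' j' /\ c2 i' j' = c2' i' j') ->
  s6v_cfg Lb Bb c1 c2 i j = s6v_cfg Lb Bb c1' c2' i j.
Proof.
elim: i j => [|i IHi] j h //.
elim: j h => [|j IHj] h //.
have [e1 e2] := h i.+1 j.+1 (leqnn _) (leqnn _).
have ei : s6v_cfg Lb Bb c1 c2 i j.+1 = s6v_cfg Lb Bb c1' c2' i j.+1.
  by apply: IHi => i' j' hi hj; apply: h => //; apply: leqW.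
have ej : s6v_cfg Lb Bb c1 c2 i.+1 j = s6v_cfg Lb Bb c1' c2' i.+1 j.
  by apply: IHj => i' j' hi hj; apply: h => //; apply: leqW.
by move: ei ej; rewrite /= => -> ->; rewrite e1 e2.
Qed.

Section Link.
Variables (R : realType) (x y' : nat).
Local Notation y := y'.+1.
Local Notation n := (y' + x).+1.
Variables d1 d2 : R.

Section Config.
Variables (L : {ffun 'I_y -> bool}) (B : {ffun 'I_x -> bool}).
Local Notation coins := {ffun 'I_x * 'I_y -> bool}.

Definition cfg (C1 C2 : coins) := seed_cfg ((L, B, C1, C2) : seed x y).

Definition edge_state (C1 C2 : coins) (e : bool * nat * nat) : bool :=
  let o := cfg C1 C2 e.1.2 e.2 in if e.1.1 then o.2 else o.1.

Definition stage (C1 C2 : coins) i j : word n bool :=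
  [ffun k : 'I_n => edge_state C1 C2 (edge y' i j k)].

Lemma cfg_rec (C1 C2 : coins) (i : 'I_x) (j : 'I_y) :
  cfg C1 C2 i.+1 j.+1 =
  s6v_step (cfg C1 C2 i j.+1).1 (cfg C1 C2 i.+1 j).2 (C1 (i, j)) (C2 (i, j)).
Proof.
have e (C : coins) : ext2 C i.+1.-1 j.+1.-1 = C (i, j).
  by rewrite /ext2 /= !valK.
by rewrite /cfg /seed_cfg -!e.
Qed.

(** Arrows travel up and right, so the coins at [v] act only weakly above and to the right of it. As
    [v] is 0-based, its vertex is [(v.1.+1, v.2.+1)], whence the large inequalities. *)
Lemma cfg_flip (v : 'I_x * 'I_y) (C1 C2 C1' C2' : coins) i j :
  (forall u, u != v -> C1 u = C1' u /\ C2 u = C2' u) ->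
  (i <= v.1)%N || (j <= v.2)%N -> cfg C1 C2 i j = cfg C1' C2' i j.
Proof.
move=> h hij; rewrite /cfg /seed_cfg.
case: i hij => [|i] hij //; case: j hij => [|j] hij //.
have : (i.+1 <= v.1)%N || (j.+1 <= v.2)%N := hij.
move=> {}hij.
suff gen (i' j' : nat) : (i' <= i.+1)%N -> (j' <= j.+1)%N -> (0 < i')%N -> (0 < j')%N ->
    ext2 C1 i'.-1 j'.-1 = ext2 C1' i'.-1 j'.-1 /\ ext2 C2 i'.-1 j'.-1 = ext2 C2' i'.-1 j'.-1.
  pose lift (C : coins) (i' j' : nat) := if (0 < i')%N && (0 < j')%N then ext2 C i'.-1 j'.-1 else false.
  have triv Lb Bb D1 D2 k l : s6v_cfg Lb Bb (fun i j => ext2 D1 i.-1 j.-1) (fun i j => ext2 D2 i.-1 j.-1) k l =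
      s6v_cfg Lb Bb (lift D1) (lift D2) k l.
    elim: k l => [|k IHk] l //; elim: l => [|l IHl] //.
    by move: (IHk l.+1) IHl => /= -> ->.
  rewrite !triv; apply: s6v_cfg_local => i' j' hi hj; rewrite /lift.
  by case: ifP => // /andP[h1 h2]; apply: gen.
move=> hi hj hi0 hj0; rewrite /ext2.
case: insubP => // a _ ea; case: insubP => // b _ eb.
apply: h; apply: contraTneq hij => e; rewrite -e /= ea eb; lia.
Qed.

Lemma stage_flip (v : 'I_x * 'I_y) (C1 C2 C1' C2' : coins) :
  (forall u, u != v -> C1 u = C1' u /\ C2 u = C2' u) ->
  stage C1 C2 v.1 v.2 = stage C1' C2' v.1 v.2.
Proof.
move=> h; apply/ffunP => k; rewrite !ffunE /edge_state.
rewrite (@cfg_flip v C1 C2 C1' C2') // /edge.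
by do ![case: ifP => ? /=]; have := ltn_ord v.2; lia.
Qed.

Lemma stage_step (C1 C2 : coins) (i : 'I_x) (j : 'I_y) (p := vpos x y' i j) (w := stage C1 C2 i j) :
  stage C1 C2 i j.+1 =
  if (rb (w p.2) < rb (w p.1))%N then (if C2 (i, j) then swapw p w else w)
  else if (rb (w p.1) < rb (w p.2))%N then (if C1 (i, j) then swapw p w else w) else w.
Proof.
have [e1 e2] := edge_in (ltn_ord i) (ltn_ord j).
have [o1 o2] := edge_out (ltn_ord i) (ltn_ord j).
have w1 : w p.1 = (cfg C1 C2 i j.+1).1 by rewrite /w ffunE /edge_state e1.
have w2 : w p.2 = (cfg C1 C2 i.+1 j).2 by rewrite /w ffunE /edge_state e2.
have hne : p.1 != p.2.
  have v (a b : 'I_n) : (a == b) = (a == b :> nat) by [].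
  by rewrite v vpos1 ?vpos2 //; lia.
have key k : stage C1 C2 i j.+1 k =
    if k == p.1 then (cfg C1 C2 i.+1 j.+1).2
    else if k == p.2 then (cfg C1 C2 i.+1 j.+1).1 else w k.
  rewrite ffunE; case: (eqVneq k p.1) => [->|n1]; first by rewrite o1.
  case: (eqVneq k p.2) => [->|n3]; first by rewrite o2.
  by rewrite /w ffunE edge_other.
rewrite cfg_rec -w1 -w2 in key.
have sk k : swapw p w k = if k == p.1 then w p.2 else if k == p.2 then w p.1 else w k.
  by rewrite ffunE; case: tpermP => [->|->|/eqP/negbTE-> /eqP/negbTE->];
    rewrite ?eqxx // eq_sym (negbTE hne).
apply/ffunP => k; rewrite key {key}.
case: (eqVneq k p.1) => [->|n1].
  by move: (sk p.1); rewrite eqxx => sk1; case E1: (w p.1); case E2: (w p.2);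
    case: (C1 (i, j)); case: (C2 (i, j)) => /=; rewrite ?sk1 ?E1 ?E2.
case: (eqVneq k p.2) => [->|n3].
  by move: (sk p.2); rewrite eq_sym (negbTE hne) eqxx => sk1; case E1: (w p.1); case E2: (w p.2);
    case: (C1 (i, j)); case: (C2 (i, j)) => /=; rewrite ?sk1 ?E1 ?E2.
move: (sk k); rewrite (negbTE n1) (negbTE n3) => sk1.
by do ![case: ifP => _]; rewrite ?sk1.
Qed.

Lemma stage_col C1 C2 i : stage C1 C2 i y = stage C1 C2 i.+1 0.
Proof. by apply/ffunP => k; rewrite !ffunE edge_col. Qed.

Lemma stage_cexp F :
  cexp d1 (fun C1 => cexp d2 (fun C2 => F (stage C1 C2 x 0))) =
  cexp d1 (fun C1 => cexp d2 (fun C2 => ker d1 d2 rb (sweep x y') F (stage C1 C2 0 0))).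
Proof.
pose Phi i j (G : word n bool -> R) := cexp d1 (fun C1 => cexp d2 (fun C2 => G (stage C1 C2 i j))).
rewrite -[LHS]/(Phi x 0%N F) -[RHS]/(Phi 0%N 0%N _); symmetry.
apply: sweep_ind => [i j G hi hj|i G _]; last first.
  by apply: eq_cexp => C1; apply: eq_cexp => C2; rewrite stage_col.
pose v : 'I_x * 'I_y := (Ordinal hi, Ordinal hj); pose p := vpos x y' i j.
rewrite /Phi; under [RHS]eq_cexp => C1 do under eq_cexp => C2 do
  rewrite (stage_step C1 C2 (Ordinal hi) (Ordinal hj)) /=.
rewrite -/p -/v.
have f2 C1 C2 : stage C1 (flip v C2) i j = stage C1 C2 i j.
  by apply: (stage_flip (v := v)) => u /negbTE hu; rewrite ffunE hu.
have f1 C1 C2 : stage (flip v C1) C2 i j = stage C1 C2 i j.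
  by apply: (stage_flip (v := v)) => u /negbTE hu; rewrite ffunE hu.
(* The two coins at [v] are averaged one after the other. *)
pose S C1 C2 := stage C1 C2 i j.
pose gt C1 C2 := (rb (S C1 C2 p.2) < rb (S C1 C2 p.1))%N.
pose lt C1 C2 := (rb (S C1 C2 p.1) < rb (S C1 C2 p.2))%N.
pose low b C1 C2 := G (if lt C1 C2 && b then swapw p (S C1 C2) else S C1 C2).
have a2 C1 b : cexp d2 (fun C2 => if gt C1 C2 then (if C2 v then G (swapw p (S C1 C2)) else G (S C1 C2))
      else low b C1 C2) =
    cexp d2 (fun C2 => if gt C1 C2 then mv d1 d2 rb p G (S C1 C2) else low b C1 C2).
  transitivity (cexp d2 (fun C2 => if C2 v then
     (if gt C1 C2 then G (swapw p (S C1 C2)) else low b C1 C2) else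
     (if gt C1 C2 then G (S C1 C2) else low b C1 C2))).
    by apply: eq_cexp => C2; case: ifP => _ //; case: ifP.
  rewrite cexp_coin; try by move=> C2; rewrite /low /gt /lt /S f2.
  apply: eq_cexp => C2; rewrite /mv /rate -/(gt C1 C2) /gt; case: ifP => h; ring.
transitivity (cexp d1 (fun C1 => if C1 v then
   cexp d2 (fun C2 => if gt C1 C2 then mv d1 d2 rb p G (S C1 C2) else low true C1 C2) else
   cexp d2 (fun C2 => if gt C1 C2 then mv d1 d2 rb p G (S C1 C2) else low false C1 C2))); last first.
  apply: eq_cexp => C1; rewrite -!a2; case: ifP => h1; apply: eq_cexp => C2;
    rewrite /low -/(S C1 C2) -/(gt C1 C2) -/(lt C1 C2) ?h1; by case: (gt C1 C2); case: (lt C1 C2); case: (C2 v).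
rewrite cexp_coin; first last.
- by move=> C1; apply: eq_cexp => C2; rewrite /low /gt /lt /S f1.
- by move=> C1; apply: eq_cexp => C2; rewrite /low /gt /lt /S f1.
apply: eq_cexp => C1; rewrite /cexp !mulr_sumr -big_split /=; apply: eq_bigr => C2 _.
rewrite /low -/(S C1 C2) /gt /lt /mv /rate; case: ifP => h1; first by ring.
by case: ifP => h2 /=; ring.
Qed.

End Config.
End Link.

Lemma sum_bern (R : numDomainType) (p : R) : \sum_b bern p b = 1.
Proof. by rewrite big_bool /bern /= addrC subrK. Qed.

Lemma cexp_cst (R : realType) (K : finType) (p a : R) :
  cexp p (fun _ : {ffun K -> bool} => a) = a.
Proof.
rewrite /cexp -mulr_suml -(bigA_distr_bigA (fun (_ : K) b => bern p b)) /= big1 ?mul1r // => k _.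
exact: sum_bern.
Qed.

Lemma sum_pair (R : realType) (A B : finType) (F : A * B -> R) :
  \sum_p F p = \sum_a \sum_b F (a, b).
Proof. by rewrite pair_bigA; apply: eq_bigr => -[]. Qed.

(** * The law of the height as an expectation over words *)

Section SeedLaw.
Variables (R : realType) (x y' : nat).
Local Notation y := y'.+1.
Local Notation n := (y' + x).+1.
Variables d1 d2 : R.

(** The left boundary is read downwards, so position [k] is height [y - k], of 0-based index
    [(y - k).-1]; the bottom boundary follows from left to right. *)
Definition init_word (L : {ffun 'I_y -> bool}) (B : {ffun 'I_x -> bool}) : word n bool :=
  [ffun k : 'I_n => if (k < y)%N then ext1 L (y - k).-1 else ext1 B (k - y)].

Lemma stage_init L B C1 C2 : stage (x := x) (y' := y') L B C1 C2 0 0 = init_word L B.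
Proof.
apply/ffunP => k; rewrite !ffunE /edge_state /edge ltn0 subn0 add0n.
case: (ltnP k y) => h1 //=; case: eqP => [e|h2] /=; first by rewrite e subnn.
by have -> : (k <= y)%N = false by lia.
Qed.

Lemma sum_narrow m (h : nat -> R) : (m <= n)%N ->
  \sum_(k < n | (k < m)%N) h k = \sum_(k < m) h k.
Proof. by move=> hm; rewrite (big_ord_narrow hm). Qed.

Lemma ext1E m (f : {ffun 'I_m -> bool}) (i : 'I_m) : ext1 f i = f i.
Proof. by rewrite /ext1 valK. Qed.

Lemma hgt_seed L B C1 C2 :
  hgt R id (init_word L B) (stage L B C1 C2 x 0) = Hr ((L, B, C1, C2) : seed x y).
Proof.
rewrite /hgt /Hr /s6v_height rmorphB /= -[RHS]/(_%:R - _%:R) !natr_sum; congr (_ - _).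
  transitivity (\sum_(k < n | (k < y)%N) ((ext1 L (y - k).-1)%:R : R)).
    by apply: eq_bigr => k hk; rewrite ffunE hk.
  have hy : (y <= n)%N by lia.
  rewrite (sum_narrow (fun k => (ext1 L (y - k).-1)%:R) hy).
  rewrite big_add1 big_mkord (reindex_inj rev_ord_inj) /=; apply: eq_bigr => j _.
  by congr (ext1 L _)%:R; have := ltn_ord j; lia.
transitivity (\sum_(k < n | (k < x)%N) ((cfg L B C1 C2 k.+1 y).2%:R : R)).
  by apply: eq_bigr => k hk; rewrite ffunE /edge_state /edge hk.
have hx : (x <= n)%N by lia.
rewrite (sum_narrow (fun k => (cfg L B C1 C2 k.+1 y).2%:R) hx).
by rewrite big_add1 big_mkord; apply: eq_bigr => j _.
Qed.

Definition dens (b1 b2 : R) (k : 'I_n) : R := if (k < y)%N then b1 else b2.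

Definition bexp (b1 b2 : R) (g : R -> R) : R :=
  EX d1 d2 (sweep x y') rb (fun k => bern (dens b1 b2 k)) (fun w0 w => g (hgt R id w0 w)).

Lemma init_word_bij : bijective (fun LB => init_word LB.1 LB.2).
Proof.
exists (fun w : word n bool => ([ffun j : 'I_y => w (inord (y - j).-1)], [ffun i : 'I_x => w (inord (y + i))])).
  case=> L B; congr pair; apply/ffunP => k; rewrite !ffunE inordK /=; try by have := ltn_ord k; lia.
    rewrite ifT; last by lia.
    rewrite -[in RHS](ext1E L); congr ext1; have := ltn_ord k; lia.
  rewrite ifF; last by lia.
  by rewrite -[in RHS](ext1E B); congr ext1; lia.
move=> w; apply/ffunP => k; rewrite !ffunE /ext1; case: ifP => hk.
  case: insubP => [a _ ea|]; last by lia.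
  by rewrite ffunE ea; congr (w _); apply: val_inj; rewrite /= inordK; lia.
case: insubP => [a _ ea|]; last by have := ltn_ord k; lia.
by rewrite ffunE ea; congr (w _); apply: val_inj; rewrite /= inordK; have := ltn_ord k; lia.
Qed.

Lemma wt_init_word b1 b2 L B :
  wt (fun k => bern (dens b1 b2 k)) (init_word L B) =
  (\prod_j bern b1 (L j)) * (\prod_i bern b2 (B i)).
Proof.
rewrite /wt (@big_split_ord _ _ _ y x); congr (_ * _).
  rewrite [RHS](reindex_inj rev_ord_inj) /=; apply: eq_bigr => k _.
  rewrite /dens ffunE /= ltn_ord; congr bern; rewrite -[in RHS](ext1E L) /=.
  by congr ext1; have := ltn_ord k; lia.
apply: eq_bigr => k _; rewrite /dens ffunE /= ifF; last by lia.
by congr bern; rewrite ifF ?addKn ?ext1E //; lia.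
Qed.

Lemma seed_law b1 b2 g :
  \sum_(s : seed x y) seed_weight d1 d2 b1 b2 s * g (Hr s) = bexp b1 b2 g.
Proof.
transitivity (\sum_(LB : {ffun 'I_y -> bool} * {ffun 'I_x -> bool})
    (\prod_j bern b1 (LB.1 j)) * (\prod_i bern b2 (LB.2 i)) *
    cexp d1 (fun C1 => cexp d2 (fun C2 => g (Hr ((LB, C1, C2) : seed x y))))).
  rewrite [LHS]sum_pair [LHS]sum_pair.
  apply: eq_bigr => -[L B] _ /=; rewrite /cexp mulr_sumr; apply: eq_bigr => C1 _.
  by rewrite !mulr_sumr; apply: eq_bigr => C2 _; rewrite /seed_weight; ring.
rewrite /bexp /EX (reindex _ (onW_bij _ init_word_bij)) /=; apply: eq_bigr => -[L B] _ /=.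
rewrite wt_init_word; congr (_ * _).
transitivity (cexp d1 (fun C1 => cexp d2 (fun C2 =>
    g (hgt R id (init_word L B) (stage L B C1 C2 x 0))))).
  by apply: eq_cexp => C1; apply: eq_cexp => C2; rewrite hgt_seed.
rewrite (stage_cexp d1 d2 L B (fun w => g (hgt R id (init_word L B) w))).
under eq_cexp => C1 do under eq_cexp => C2 do rewrite stage_init.
by under eq_cexp => C1 do rewrite cexp_cst; rewrite cexp_cst.
Qed.

End SeedLaw.

(** * Couplings of several boundary conditions *)

Section Colours.
Variables (R : realType) (x y' : nat).
Local Notation y := y'.+1.
Local Notation n := (y' + x).+1.
Variables d1 d2 : R.
Local Notation col := 'I_4.
Local Notation rk := (@nat_of_ord 4).
Local Notation ps := (sweep x y').
Local Notation hgt := (@hgt R x y').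
Local Notation E := (EX d1 d2 ps).

(** Declaring the colours at least [j] occupied, for [j] from 1 to 3, reads three nested six vertex
    models off one coloured word. *)
Definition thr (j : nat) (c : col) : bool := (j <= c)%N.

Lemma thr_rank_map j : rank_map rk rb (thr j).
Proof.
move=> a b; rewrite /thr /rb; split; last by case: (_ <= _)%N; case: (_ <= _)%N.
by move=> h; case: (leqP j a) => //= h'; rewrite (leq_trans h' h).
Qed.

(** The site weights need not have mass one, so a product function of the initial word can be moved
    into them. *)
Lemma EX_tilt (T : finType) (r : T -> nat) (nu : 'I_n -> T -> R) (f : 'I_n -> T -> R) F :
  E r nu (fun w0 w => (\prod_k f k (w0 k)) * F w0 w) = E r (fun k c => nu k c * f k c) F.
Proof.
apply: eq_bigr => w0 _; rewrite kerZ mulrA; congr (_ * _).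
by rewrite /wt -big_split.
Qed.

Definition cw (a0 a1 a2 a3 : R) (c : col) : R := nth 0 [:: a0; a1; a2; a3] c.

Lemma sum_cw (P : pred col) a0 a1 a2 a3 :
  \sum_(c | P c) cw a0 a1 a2 a3 c =
  (if P (inord 0) then a0 else 0) + (if P (inord 1) then a1 else 0) +
  (if P (inord 2) then a2 else 0) + (if P (inord 3) then a3 else 0).
Proof.
rewrite big_mkcond !big_ord_recl big_ord0 /= addr0 !addrA.
have e (i : nat) (c : col) : c = i :> nat -> c = inord i.
  by move=> h; apply: val_inj; rewrite /= -h inordK.
by rewrite -(e 0%N ord0) // -(e 1%N (lift ord0 ord0)) // -(e 2%N (lift ord0 (lift ord0 ord0)))
  // -(e 3%N (lift ord0 (lift ord0 (lift ord0 ord0)))).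
Qed.

Lemma cw_ge0 a0 a1 a2 a3 c : 0 <= a0 -> 0 <= a1 -> 0 <= a2 -> 0 <= a3 -> 0 <= cw a0 a1 a2 a3 c.
Proof. by rewrite /cw; case: c => [[|[|[|[|]]]]]. Qed.

Definition ordered (cut : nat) (w0 : word n col) : Prop := forall k : 'I_n,
  ((k < cut)%N -> w0 k <> 1%N :> nat) /\ ((cut <= k)%N -> w0 k <> 2%N :> nat).

Definition right2 (w : word n col) : nat := (\sum_(k < n | ~~ (k < x)) (w k == 2%N :> nat))%N.
Definition top1 (w : word n col) : nat := (\sum_(k < n | k < x) (w k == 1%N :> nat))%N.
Definition left1 (w : word n col) : nat := (\sum_(k < n | k < y) (w k == 1%N :> nat))%N.

Lemma hgt_split (P Q S : pred col) w0 w : (forall c, P c = Q c + S c :> nat)%N ->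
  hgt P w0 w = hgt Q w0 w + hgt S w0 w.
Proof.
move=> h; have e c : (P c)%:R = (Q c)%:R + (S c)%:R :> R by rewrite h natrD.
by rewrite /hgt; under eq_bigr => k _ do rewrite e; under [X in _ - X]eq_bigr => k _ do rewrite e;
  rewrite !big_split /= opprD addrACA.
Qed.

(** All twos enter from the left; by conservation those that do not leave through the top leave to
    the right. *)
Lemma hgt2E cut w0 w : (cut <= y)%N -> ordered cut w0 -> same_counts w w0 ->
  hgt (thr 2) w0 w = hgt (thr 3) w0 w + (right2 w)%:R.
Proof.
move=> hcut h0 hw; rewrite (@hgt_split _ (thr 3) (fun c => c == 2%N :> nat)); last first.
  by move=> [[|[|[|[|]]]] hc].
congr (_ + _); rewrite /hgt -!natr_sum.
have h := same_counts_sum (fun c : col => c == 2%N :> nat) hw.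
rewrite (bigID (fun k : 'I_n => (k < x)%N)) [in RHS](bigID (fun k : 'I_n => (k < y)%N)) /= in h.
rewrite [X in _ = (_ + X)%N]big1 ?addn0 in h; last first.
  move=> k hk; apply/eqP; rewrite eqb0; apply/eqP; apply: (h0 k).2; lia.
by rewrite -h natrD addrC addKr.
Qed.

Lemma hgt1E w0 w : same_counts w w0 ->
  hgt (thr 1) w0 w = hgt (thr 2) w0 w + (left1 w0)%:R - (top1 w)%:R.
Proof.
move=> hw; rewrite (@hgt_split _ (thr 2) (fun c => c == 1%N :> nat)); last first.
  by move=> [[|[|[|[|]]]] hc].
by rewrite /hgt -!natr_sum addrA.
Qed.

Lemma inv_ordered cut w0 : ordered cut w0 -> inv w0 = 0%N.
Proof.
move=> h; rewrite /inv big1 // => i _; rewrite big1 // => j _.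
case: ltnP => // hij; case: eqP => // e1; case: eqP => // e2.
have [h1 _] := h i; have [_ h2] := h j.
case: (ltnP i cut) => hi; first by case: (h1 hi).
by case: h2 => //; lia.
Qed.

(** On the final path every top edge precedes every right edge, so a 1 at the top and a 2 on the
    right form an inversion. *)
Lemma inv_ge w : (top1 w * right2 w <= inv w)%N.
Proof.
rewrite /inv [X in (_ <= X)%N](bigID (fun i : 'I_n => (i < x)%N)) /=; apply: leq_trans (leq_addr _ _).
rewrite /top1 big_distrl /=; apply: leq_sum => i hi.
rewrite [X in (_ <= X)%N](bigID (fun i : 'I_n => (i < x)%N)) /=; apply: leq_trans (leq_addl _ _).
rewrite /right2 big_distrr /=; apply: leq_sum => j hj.
by rewrite (_ : (i < j)%N = true) ?mul1n //; lia.
Qed.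

Hypothesis d1P : 0 <= d1 <= 1.
Hypothesis d2P : 0 <= d2 <= 1.

Lemma eq_EX (T : finType) (r : T -> nat) (nu nu' : 'I_n -> T -> R) F G :
  (forall k c, nu k c = nu' k c) -> (forall w0 w, F w0 w = G w0 w) ->
  E r nu F = E r nu' G.
Proof.
move=> h1 h2; apply: eq_bigr => w0 _; congr (_ * _).
  by apply: eq_bigr => k _.
by apply: ker_eq => // w _.
Qed.

Lemma EX_thr j (nu : 'I_n -> col -> R) (g : R -> R) :
  E rk nu (fun w0 w => g (hgt (thr j) w0 w)) =
  E rb (fun k b => \sum_(c | thr j c == b) nu k c) (fun w0 w => g (hgt id w0 w)).
Proof.
rewrite -(EX_map _ _ _ _ _ (thr_rank_map j)); apply: eq_EX => // w0 w.
by congr g; rewrite /hgt; congr (_ - _); apply: eq_bigr => k _; rewrite ffunE.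
Qed.

Lemma EX_conc cut (nu : 'I_n -> col -> R) q gam r F G :
  d2 = q * d1 -> 0 <= q -> 0 <= gam -> q * gam <= r -> 0 <= r < 1 ->
  (forall k c, 0 <= nu k c) ->
  (forall (k : 'I_n) (c : col), (k < cut)%N -> c = 1%N :> nat -> nu k c = 0) ->
  (forall (k : 'I_n) (c : col), (cut <= k)%N -> c = 2%N :> nat -> nu k c = 0) ->
  (forall w0 w, 0 <= G w0 w) -> (forall w0 w, G w0 (mapw mg w) = G w0 w) ->
  (forall w0 w, ordered cut w0 -> same_counts w w0 -> F w0 w <= G w0 w * gam ^+ inv w) ->
  E rk nu F <= labC r * E rk nu G.
Proof.
move=> dq q0 gam0 qr hr nu0 nu1 nu2 G0 Gm hF.
rewrite /EX mulr_sumr; apply: ler_sum => w0 _.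
have [->|ne] := eqVneq (wt nu w0) 0; first by rewrite !mul0r mulr0.
have h0 : ordered cut w0.
  move=> k; have := wt_supp k ne; move=> /eqP hk; split=> hc e; apply: hk; first exact: nu1.
  exact: nu2.
rewrite mulrCA; apply: ler_wpM2l; first exact: wt_ge0.
have -> : ker d1 d2 rk ps (G w0) w0 = ker d1 d2 rk ps (G w0) (mapw mg w0).
  by rewrite -(ker_map _ _ _ _ _ mg_rank_map); apply: ker_eq => // w _.
apply: (label_conc (q := q) (gam := gam)) => //.
- exact: sweep_adjacent.
- exact: inv_ordered h0.
by move=> w hw; rewrite Gm; apply: hF.
Qed.

Lemma thr_mg j c : j != 2%N -> thr j (mg c) = thr j c.
Proof.
rewrite /thr mgE; case: (eqVneq (val c) 2%N) => [->|] //=.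
by case: j => [|[|[|j]]].
Qed.

Lemma hgt_mg j w0 w : j != 2%N -> hgt (thr j) w0 (mapw mg w) = hgt (thr j) w0 w.
Proof.
by move=> hj; rewrite /hgt; congr (_ - _); apply: eq_bigr => k _; rewrite ffunE thr_mg.
Qed.

(* Extra left arrows and fewer bottom arrows both raise the height; once the
   two families of discrepancies are ordered, at most one of them matters. *)
Lemma two_sided_bound b1 b1' b2 b2' q lam r :
  d2 = q * d1 -> 0 <= q -> 0 <= lam -> q * expR lam <= r -> 0 <= r < 1 ->
  0 <= b1' -> b1' <= b1 -> b1 <= 1 -> 0 <= b2 -> b2 <= b2' -> b2' <= 1 ->
  bexp x y' d1 d2 b1 b2 (fun h => expR (lam * h)) <=
  labC r * (bexp x y' d1 d2 b1' b2 (fun h => expR (lam * h)) +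
            bexp x y' d1 d2 b1 b2' (fun h => expR (lam * h))).
Proof.
move=> dq q0 lam0 qr hr h1 h2 h3 h4 h5 h6.
(* The thresholds 3, 2 and 1 of these weights have densities [(b1', b2)], [(b1, b2)] and
   [(b1, b2')]. *)
pose nu (k : 'I_n) : col -> R := if (k < y)%N then cw (1 - b1) 0 (b1 - b1') b1'
  else cw (1 - b2') (b2' - b2) 0 b2.
have push j b1'' b2'' :
    (j = 1%N /\ (b1'', b2'') = (b1, b2')) \/ (j = 2%N /\ (b1'', b2'') = (b1, b2)) \/
    (j = 3%N /\ (b1'', b2'') = (b1', b2)) ->
    bexp x y' d1 d2 b1'' b2'' (fun h => expR (lam * h)) =
    E rk nu (fun w0 w => expR (lam * hgt (thr j) w0 w)).
  move=> hj; rewrite (EX_thr j nu (fun h => expR (lam * h))) /bexp; apply: eq_EX => // k b.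
  rewrite /nu /dens.
  by case: hj => [[-> [-> ->]]|[[-> [-> ->]]|[-> [-> ->]]]]; case: ifP => _;
    rewrite sum_cw /thr !inordK // /bern; case: b => /=; ring.
rewrite (push 2%N) ?(push 3%N b1') ?(push 1%N b1 b2'); try by [left|right; left|right; right].
rewrite -EXD.
apply: (EX_conc (cut := y) (q := q) (gam := expR lam)) => //.
- exact: expR_ge0.
- by move=> k c; rewrite /nu; case: ifP => _; apply: cw_ge0; lra.
- by move=> k [[|[|[|[|]]]] hc] hk //; rewrite /nu hk.
- by move=> k [[|[|[|[|]]]] hc] hk //; rewrite /nu ltnNge hk.
- by move=> w0 w; apply: addr_ge0; apply: expR_ge0.
- by move=> w0 w; rewrite !hgt_mg.
move=> w0 w h0 hw; have hi := inv_ge w.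
have e2 := hgt2E (leqnn y) h0 hw; have e1 := hgt1E hw.
have l0 : left1 w0 = 0%N.
  by rewrite /left1 big1 // => k hk; apply/eqP; rewrite eqb0; apply/eqP; apply: (h0 k).1.
rewrite l0 addr0 in e1.
rewrite -expRM_natl mulrDl -!expRD.
set K1 := right2 w in hi e2; set K2 := top1 w in hi e1; clearbody K1 K2.
(* The smaller of [K1] and [K2] is at most their product, hence at most [inv w]; the factor
   [expR lam ^+ inv w] pays for it. *)
case: (leqP K1 K2) => hK.
  have hk : (K1 <= inv w)%N.
    by apply: leq_trans hi; case: (posnP K1) => [->|p1] //; rewrite leq_pmull // (leq_trans p1 hK).
  apply: ler_wpDr; first exact: expR_ge0.
  have hkR : K1%:R <= (inv w)%:R :> R by rewrite ler_nat.
  by have := ler_wpM2l lam0 hkR; rewrite ler_expR e2; lra.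
have hk : (K2 <= inv w)%N.
  by apply: leq_trans hi; rewrite leq_pmulr // (leq_ltn_trans (leq0n _) hK).
apply: ler_wpDl; first exact: expR_ge0.
have hkR : K2%:R <= (inv w)%:R :> R by rewrite ler_nat.
by have := ler_wpM2l lam0 hkR; rewrite ler_expR e1; lra.
Qed.

(** The extra left arrows form a second class family entering from the left, which can only raise
    the height. The masses need only agree site by site, which admits tilted weights. *)
Lemma left_mono (nu nu' : 'I_n -> bool -> R) (g : R -> R) :
  (forall h h', h <= h' -> g h <= g h') ->
  (forall k b, 0 <= nu k b) -> (forall k b, 0 <= nu' k b) ->
  (forall k, nu k true + nu k false = nu' k true + nu' k false) ->
  (forall k, nu k true <= nu' k true) ->
  (forall k : 'I_n, (y <= k)%N -> nu k true = nu' k true) ->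
  E rb nu (fun w0 w => g (hgt id w0 w)) <= E rb nu' (fun w0 w => g (hgt id w0 w)).
Proof.
move=> gm nu0 nu0' nus nul nur.
pose mu (k : 'I_n) := cw (nu' k false) 0 (nu' k true - nu k true) (nu k true).
have -> : E rb nu (fun w0 w => g (hgt id w0 w)) = E rk mu (fun w0 w => g (hgt (thr 3) w0 w)).
  rewrite EX_thr; apply: eq_EX => // k b.
  rewrite /mu sum_cw /thr !inordK //; have := nus k.
  by case: b => /= h; lra.
have -> : E rb nu' (fun w0 w => g (hgt id w0 w)) = E rk mu (fun w0 w => g (hgt (thr 2) w0 w)).
  rewrite EX_thr; apply: eq_EX => // k b.
  by rewrite /mu sum_cw /thr !inordK //; case: b => /=; lra.
apply: EX_le => //.
  by move=> k c; apply: cw_ge0 => //; rewrite subr_ge0.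
move=> w0 w hs hw; apply: gm.
have h0 : ordered y w0.
  move=> k; have := hs k; rewrite /mu /cw => /eqP hk; split=> hc e; apply: hk; rewrite e //=.
  by rewrite nur // subrr.
by rewrite (hgt2E (leqnn y) h0 hw) lerDl ler0n.
Qed.

End Colours.

(** * The exponential identity *)

Section Stationarity.
Variables (R : realType) (x y' : nat).
Local Notation y := y'.+1.
Local Notation n := (y' + x).+1.
Variables d1 d2 : R.
Local Notation ps := (sweep x y').
Local Notation hgt := (@hgt R x y').
Local Notation E := (EX d1 d2 ps).
Local Notation bexp := (bexp x y' d1 d2).

Definition balanced (b1 b2 : R) : Prop := b1 * (1 - b2) * (1 - d2) = b2 * (1 - b1) * (1 - d1).

Lemma prod_prefix m (Z : R) : (m <= n)%N -> \prod_(k < n) (if (k < m)%N then Z else 1) = Z ^+ m.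
Proof.
by move=> hm; rewrite -big_mkcond /= (big_ord_narrow hm) prodr_const card_ord.
Qed.

Lemma sum_prefix m (Z : R) : (m <= n)%N -> \sum_(k < n | (k < m)%N) Z = m%:R * Z.
Proof. by move=> hm; rewrite (big_ord_narrow hm) sumr_const card_ord mulr_natl. Qed.

Lemma y_le_n : (y <= n)%N. Proof. by lia. Qed.
Lemma x_le_n : (x <= n)%N. Proof. by lia. Qed.

Lemma stage_dens0 (b1 b2 : R) (k : 'I_n) : stage_dens b1 b2 0 0 k = dens b1 b2 k :> R.
Proof.
rewrite /stage_dens /dens /edge ltn0 subn0 add0n; case: (ltnP k y) => h //=.
by case: eqP => //= ?; case: leqP => //=; lia.
Qed.

Lemma stage_dens_last (b1 b2 : R) (k : 'I_n) : (k < x)%N -> stage_dens b1 b2 x 0 k = b2 :> R.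
Proof. by move=> h; rewrite /stage_dens /edge h. Qed.

Lemma EX_stationary b1 b2 (G : word n bool -> R) : balanced b1 b2 ->
  E rb (fun k => bern (dens b1 b2 k)) (fun _ w => G w) =
  \sum_w wt (fun k => bern (stage_dens b1 b2 x 0 k)) w * G w.
Proof.
move=> hb; rewrite -(stationary hb) /EX; apply: eq_bigr => w _; congr (_ * _).
by apply: eq_bigr => k _; rewrite stage_dens0.
Qed.

Lemma exp_prefix m (lam : R) (w : word n bool) :
  expR (lam * \sum_(k < n | (k < m)%N) (w k)%:R) =
  \prod_(k < n) (if (k < m)%N then expR (lam * (w k)%:R) else 1).
Proof. by rewrite mulr_sumr expR_sum big_mkcond. Qed.

(** The density with odds [be * expR z]. Multiplying both odds by one factor preserves stationarity,
    so [z] runs through a family of stationary models. *)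
Definition bz (be z : R) : R := be * expR z / (1 + be * expR z).

Lemma bz_den (be z : R) : 0 < be -> 0 < 1 + be * expR z.
Proof. by move=> h; rewrite addr_gt0 // mulr_gt0 // expR_gt0. Qed.

Lemma bz_balanced be1 be2 z : 0 < be1 -> 0 < be2 -> be1 * (1 - d2) = be2 * (1 - d1) ->
  balanced (bz be1 z) (bz be2 z).
Proof.
move=> h1 h2 e; rewrite /balanced /bz; have D1 := bz_den z h1; have D2 := bz_den z h2.
have -> : be1 * expR z / (1 + be1 * expR z) * (1 - be2 * expR z / (1 + be2 * expR z)) * (1 - d2) =
   (be1 * (1 - d2)) * expR z / ((1 + be1 * expR z) * (1 + be2 * expR z)).
  by field; rewrite !gt_eqF.
by rewrite e; field; rewrite !gt_eqF.
Qed.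

(* Tilting the left boundary turns the parameters [(v, u)] into the stationary
   ones [(u, u)], for which the law of the outgoing arrows is known. *)
Lemma rains be1 be2 u v : 0 < be1 -> 0 < be2 -> be1 * (1 - d2) = be2 * (1 - d1) ->
  bexp (bz be1 v) (bz be2 u) (fun h => expR ((u - v) * h)) =
  ((1 + be1 * expR u) / (1 + be1 * expR v)) ^+ y *
  ((1 + be2 * expR v) / (1 + be2 * expR u)) ^+ x.
Proof.
move=> h1 h2 e.
have D1v := bz_den v h1; have D1u := bz_den u h1; have D2u := bz_den u h2.
set Z := (1 + be1 * expR u) / (1 + be1 * expR v).
pose G (w : word n bool) := \prod_(k < n) (if (k < x)%N then expR ((v - u) * (w k)%:R) else 1).
pose f (k : 'I_n) (b : bool) : R := if (k < y)%N then expR ((u - v) * b%:R) else 1.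
have -> : bexp (bz be1 v) (bz be2 u) (fun h => expR ((u - v) * h)) =
    E rb (fun k => bern (dens (bz be1 v) (bz be2 u) k)) (fun w0 w => (\prod_k f k (w0 k)) * G w).
  apply: eq_bigr => w0 _; congr (_ * ker _ _ _ _ _ _); apply: funext => w.
  rewrite /G -!exp_prefix -expRD /hgt; congr expR.
  by rewrite mulrBr -[v - u]opprB mulNr.
rewrite EX_tilt.
have -> : E rb (fun k c => bern (dens (bz be1 v) (bz be2 u) k) c * f k c) (fun=> G) =
    Z ^+ y * E rb (fun k => bern (dens (bz be1 u) (bz be2 u) k)) (fun _ w => G w).
  rewrite /EX mulr_sumr; apply: eq_bigr => w0 _; rewrite mulrA; congr (_ * _).
  rewrite -(prod_prefix Z y_le_n) /wt -big_split; apply: eq_bigr => k _ /=.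
  rewrite /f /dens; case: ifP => _; last by rewrite mulr1 mul1r.
  rewrite /bern /bz /Z; have eu : expR u = expR v * expR (u - v) by rewrite -expRD addrC subrK.
  rewrite {}eu in D1u *.
  by case: (w0 k); rewrite ?mulr1 ?mulr0 ?expR0; field; rewrite !gt_eqF.
rewrite (EX_stationary _ (bz_balanced u h1 h2 e)) /G.
rewrite (wt_init _ (fun (k : 'I_n) (b : bool) => if (k < x)%N then expR ((v - u) * b%:R) else 1)); congr (_ * _).
rewrite -(prod_prefix _ x_le_n); apply: eq_bigr => k _; rewrite big_bool /=.
case: ifP => hk; last first.
  by rewrite !mulr1 /bern addrC subrK.
rewrite stage_dens_last // mulr1 mulr0 expR0 mulr1 /bern /bz.
have ev : expR v = expR u * expR (v - u) by rewrite -expRD addrC subrK.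
by rewrite ev; field; rewrite gt_eqF.
Qed.

Lemma wt_site (rho : 'I_n -> R) k :
  \sum_(w : word n bool) wt (fun l => bern (rho l)) w * (w k)%:R = rho k.
Proof.
have e (w : word n bool) : (w k)%:R = \prod_l (if l == k then (w l)%:R else 1) :> R.
  by rewrite (bigD1 k) //= eqxx big1 ?mulr1 // => l /negbTE ->.
under eq_bigr => w _ do rewrite e.
rewrite (wt_init _ (fun l (b : bool) => if l == k then b%:R else 1)) (bigD1 k) //= eqxx.
rewrite big_bool /= mulr1 mulr0 addr0 big1 ?mulr1 // => l /negbTE ->.
by rewrite big_bool /= !mulr1 /bern addrC subrK.
Qed.

Lemma bexp_mean b1 b2 : balanced b1 b2 -> bexp b1 b2 id = y%:R * b1 - x%:R * b2.
Proof.
move=> hb.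
transitivity (E rb (fun k => bern (dens b1 b2 k)) (fun w0 _ => \sum_(k < n | (k < y)%N) (w0 k)%:R)
  + (-1) * E rb (fun k => bern (dens b1 b2 k)) (fun _ w => \sum_(k < n | (k < x)%N) (w k)%:R)).
  rewrite -EXZ -EXD; apply: eq_bigr => w0 _; congr (_ * ker _ _ _ _ _ _).
  by apply: funext => w; rewrite mulN1r.
rewrite mulN1r EX_stationary //; congr (_ - _).
  rewrite /EX; under eq_bigr => w _ do rewrite ker_cst mulr_sumr.
  rewrite exchange_big /= -sum_prefix ?y_le_n //; apply: eq_bigr => k hk.
  by rewrite wt_site /dens hk.
under eq_bigr => w _ do rewrite mulr_sumr.
rewrite exchange_big /= -sum_prefix ?x_le_n //; apply: eq_bigr => k hk.
by rewrite wt_site stage_dens_last.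
Qed.

End Stationarity.

(** * Cubic expansion of the cumulant generating function *)

Section Cumulants.
Variable R : realType.
Implicit Types b z : R.

Definition psi b z : R := ln (1 - b + b * expR z).

Lemma psi_den b z : 0 < b < 1 -> 0 < 1 - b + b * expR z.
Proof. by move=> /andP[h0 h1]; rewrite addr_gt0 ?subr_gt0 ?mulr_gt0 ?expR_gt0. Qed.

Lemma expR_ub z : z <= 2^-1 -> expR z <= 1 + z + 2 * z ^+ 2.
Proof.
move=> hz; have h := expR_ge1Dx (- z); have p := expR_gt0 z.
have e : expR z * expR (- z) = 1 by rewrite -expRD subrr expR0.
have h1 := ler_wpM2l (ltW p) h; rewrite {}e in h1.
have h2 : 1 <= (1 + z + 2 * z ^+ 2) * (1 - z).
  have : 0 <= z ^+ 2 * (1 - 2 * z) by apply: mulr_ge0; [exact: sqr_ge0|lra].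
  by rewrite !expr2; lra.
rewrite -(@ler_pM2r _ (1 - z)); last by lra.
exact: le_trans h1 h2.
Qed.

Lemma psi_bound b z : 0 < b < 1 -> z <= 2^-1 -> 0 <= psi b z - b * z <= 2 * z ^+ 2.
Proof.
move=> hb hz; have := hb => /andP[h0 h1]; have D := psi_den z hb.
rewrite subr_ge0; apply/andP; split.
  rewrite /psi -(ler_expR) lnK ?posrE //.
  have e1 := expR_ge1Dx (- (b * z)); have e2 := expR_ge1Dx ((1 - b) * z).
  have p := expR_gt0 (b * z).
  (* Jensen's inequality: with [expR (b * z)] factored out, the tangent bounds of the two
     exponentials average to 1. *)
  have -> : 1 - b + b * expR z =
     expR (b * z) * ((1 - b) * expR (- (b * z)) + b * expR ((1 - b) * z)).
    rewrite mulrDr mulrCA -expRD subrr expR0 mulr1; congr (_ + _).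
    by rewrite mulrCA -expRD; congr (_ * expR _); ring.
  apply: ler_peMr; first exact: ltW.
  move: e1 e2; set A := expR (- _); set B := expR (_ * z) => e1 e2.
  have f1 : 0 <= (1 - b) * (A - (1 - b * z)) by apply: mulr_ge0; lra.
  have f2 : 0 <= b * (B - (1 + (1 - b) * z)) by apply: mulr_ge0; lra.
  lra.
have h : psi b z <= b * (expR z - 1).
  rewrite /psi; have -> : 1 - b + b * expR z = 1 + b * (expR z - 1) by ring.
  apply: le_ln1Dx; rewrite -(ltrD2l 1) subrr; have -> : 1 + b * (expR z - 1) = 1 - b + b * expR z by ring.
  exact: D.
have e := expR_ub hz.
have f : 0 <= b * (1 + z + 2 * z ^+ 2 - expR z) by apply: mulr_ge0; lra.
have g : 0 <= (1 - b) * (2 * z ^+ 2) by apply: mulr_ge0; [lra|apply: mulr_ge0; [lra|exact: sqr_ge0]].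
lra.
Qed.

Lemma is_derive_psi b z : 0 < b < 1 ->
  is_derive z 1 (psi b) (b * expR z / (1 - b + b * expR z)).
Proof.
move=> hb; have D := psi_den z hb.
have h1 : is_derive z 1 (fun t => 1 - b + b * expR t) (b * expR z).
  rewrite -[b * expR z]add0r.
  exact: (@is_deriveD _ _ _ (fun=> 1 - b) (b \*: (expR : R -> R^o)) z 1 0 (b * expR z)).
have h2 := is_derive1_ln D.
have := @is_derive1_comp R (@ln R) (fun t => 1 - b + b * expR t) z _ _ h2 h1.
by rewrite mulrC.
Qed.

Section Combination.
Variables (X Y b1 b2 : R).
Hypotheses (hb1 : 0 < b1 < 1) (hb2 : 0 < b2 < 1).
Hypotheses (Y0 : 0 <= Y) (hb : b1 <= b2).
Hypothesis second : X * (b2 * (1 - b2)) = Y * (b1 * (1 - b1)).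

Definition third z : R := X * (psi b2 z - b2 * z) - Y * (psi b1 z - b1 * z).

(** Under [second] the two derivatives combine into one fraction, whose factor [(expR z - 1) ^+ 2]
    exhibits the double zero at 0. One mean value step then gives cubic bounds without higher
    derivatives. *)
Definition dthird z : R :=
  - (Y * (b1 * (1 - b1)) * (b2 - b1) * (expR z - 1) ^+ 2 /
     ((1 - b1 + b1 * expR z) * (1 - b2 + b2 * expR z))).

Lemma is_derive_third z : is_derive z 1 third (dthird z).
Proof.
have D1 := psi_den z hb1; have D2 := psi_den z hb2.
have h1 := is_derive_psi z hb1; have h2 := is_derive_psi z hb2.
have e1 : b2 * expR z / (1 - b2 + b2 * expR z) - b2 =
  b2 * (1 - b2) * (expR z - 1) / (1 - b2 + b2 * expR z) by field; rewrite gt_eqF.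
have e2 : b1 * expR z / (1 - b1 + b1 * expR z) - b1 =
  b1 * (1 - b1) * (expR z - 1) / (1 - b1 + b1 * expR z) by field; rewrite gt_eqF.
have -> : dthird z = X * (b2 * expR z / (1 - b2 + b2 * expR z) - b2) -
    Y * (b1 * expR z / (1 - b1 + b1 * expR z) - b1).
  rewrite e1 e2.
  have -> : X * (b2 * (1 - b2) * (expR z - 1) / (1 - b2 + b2 * expR z)) =
     X * (b2 * (1 - b2)) * ((expR z - 1) / (1 - b2 + b2 * expR z)) by ring.
  by rewrite second /dthird; field; rewrite !gt_eqF.
have hl b : is_derive z 1 (fun t : R => b * t) b.
  by rewrite -[X in is_derive _ _ _ X]mulr1; exact: (@is_deriveZ _ _ _ (id : R -> R^o) b z 1 1).
have hd b db : is_derive z 1 (psi b) db -> is_derive z 1 (fun t => psi b t - b * t) (db - b).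
  by move=> h; exact: (@is_deriveB _ _ _ (psi b) (fun t : R => b * t) z 1 db b).
have hZ (c : R) (f : R -> R) df : is_derive z 1 f df -> is_derive z 1 (fun t => c * f t) (c * df).
  by move=> h; exact: (@is_deriveZ _ _ _ (f : R -> R^o) c z 1 df).
exact: (@is_deriveB _ _ _ (fun t => X * (psi b2 t - b2 * t)) (fun t => Y * (psi b1 t - b1 * t)) z 1
  _ _ (hZ _ _ _ (hd _ _ h2)) (hZ _ _ _ (hd _ _ h1))).
Qed.

Definition third_coef : R := Y * (b1 * (1 - b1)) * (b2 - b1).

Lemma third_coef_ge0 : 0 <= third_coef.
Proof.
have := hb1 => /andP[h0 h1].
by rewrite /third_coef !mulr_ge0 ?subr_ge0 // ltW.
Qed.

Lemma psi_den_bounds b z : 0 < b < 1 -> - 2^-1 <= z <= 2^-1 ->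
  2^-1 <= 1 - b + b * expR z <= 2.
Proof.
move=> /andP[h0 h1] /andP[z0 z1].
have e1 := expR_ub z1; have e2 := expR_ge1Dx z.
have z2 : z ^+ 2 <= 4^-1.
  have : 0 <= (2^-1 - z) * (2^-1 + z) by apply: mulr_ge0; lra.
  by rewrite expr2; lra.
have f1 : 0 <= b * (expR z - 2^-1) by apply: mulr_ge0; lra.
have f2 : 0 <= b * (2 - expR z) by apply: mulr_ge0; lra.
by apply/andP; split; lra.
Qed.

Lemma expR_sub1_sqr z : - 2^-1 <= z <= 2^-1 ->
  4 / 9 * z ^+ 2 <= (expR z - 1) ^+ 2 <= 4 * z ^+ 2.
Proof.
move=> /andP[z0 z1].
have e1 := expR_ub z1; have e2 := expR_ge1Dx z.
have e3 : expR z * (1 - z) <= 1.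
  have h := expR_ge1Dx (- z); have p := expR_gt0 z.
  have e : expR z * expR (- z) = 1 by rewrite -expRD subrr expR0.
  by have := ler_wpM2l (ltW p) h; rewrite e.
have p := expR_gt0 z; rewrite !expr2 in e1 *.
case: (lerP 0 z) => hz.
  have f1 : expR z - 1 <= 2 * z.
    have : 0 <= z * (1 - 2 * z) by apply: mulr_ge0; lra.
    lra.
  have f2 : 0 <= (expR z - 1 - z) * (expR z - 1 + z) by apply: mulr_ge0; lra.
  have f3 : 0 <= (2 * z - (expR z - 1)) * (2 * z + (expR z - 1)) by apply: mulr_ge0; lra.
  have f4 : 0 <= z * z by apply: mulr_ge0.
  by apply/andP; split; lra.
have f0 : expR z <= 1.
  by rewrite -expR0 ler_expR ltW.
have f1 : 1 - expR z <= - z by lra.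
have f2 : 2 / 3 * (- z) <= 1 - expR z.
  have : 0 <= (1 - expR z) * (2^-1 + z) by apply: mulr_ge0; lra.
  lra.
have f3 : 0 <= ((1 - expR z) - 2 / 3 * (- z)) * ((1 - expR z) + 2 / 3 * (- z)) by apply: mulr_ge0; lra.
have f4 : 0 <= (- z - (1 - expR z)) * (- z + (1 - expR z)) by apply: mulr_ge0; lra.
have f5 : 0 <= z * z by rewrite -expr2 sqr_ge0.
by apply/andP; split; lra.
Qed.

Lemma dthird_bounds z : - 2^-1 <= z <= 2^-1 ->
  third_coef * z ^+ 2 / 9 <= - dthird z <= 16 * third_coef * z ^+ 2.
Proof.
move=> hz; rewrite /dthird opprK -/third_coef; have M0 := third_coef_ge0.
have /andP[e1 e2] := expR_sub1_sqr hz.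
have /andP[p1 q1] := psi_den_bounds hb1 hz; have /andP[p2 q2] := psi_den_bounds hb2 hz.
move: e1 e2 p1 q1 p2 q2; set s := (expR z - 1) ^+ 2; set D1 := 1 - b1 + _; set D2 := 1 - b2 + _.
move=> e1 e2 p1 q1 p2 q2.
have D0 : 0 < D1 * D2 by apply: mulr_gt0; lra.
have l : 4^-1 <= D1 * D2.
  have : 0 <= (D1 - 2^-1) * D2 by apply: mulr_ge0; lra.
  lra.
have u : D1 * D2 <= 4.
  have : 0 <= (2 - D1) * D2 by apply: mulr_ge0; lra.
  lra.
have z2 := sqr_ge0 z; have M : third_coef * z ^+ 2 >= 0 by apply: mulr_ge0.
rewrite ler_pdivlMr // ler_pdivrMr //; apply/andP; split.
  have g1 : 0 <= third_coef * (s - 4 / 9 * z ^+ 2) by apply: mulr_ge0; lra.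
  have g2 : 0 <= (third_coef * z ^+ 2) * (4 - D1 * D2) by apply: mulr_ge0; lra.
  lra.
have g1 : 0 <= third_coef * (4 * z ^+ 2 - s) by apply: mulr_ge0; lra.
have g2 : 0 <= (third_coef * z ^+ 2) * (D1 * D2 - 4^-1) by apply: mulr_ge0; lra.
lra.
Qed.

Lemma third_mvt u v : u <= v ->
  exists2 c, u <= c <= v & third v - third u = dthird c * (v - u).
Proof.
move=> huv.
have [c hc e] := @MVT_segment R third dthird u v huv (fun z _ => is_derive_third z)
  (@derivable_within_continuous _ _ third _ (fun z _ => @ex_derive _ _ _ _ _ _ _ (is_derive_third z))).
by exists c; rewrite // -in_itv.
Qed.

Lemma third0 : third 0 = 0.
Proof.
by rewrite /third /psi expR0 !mulr1 !subrK ln1 !mulr0 subrr !mulr0 subrr.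
Qed.

Lemma third_abs z : - 2^-1 <= z <= 2^-1 -> `|third z| <= 16 * third_coef * `|z| ^+ 3.
Proof.
move=> /andP[z0 z1]; have M0 := third_coef_ge0.
have [c [hc e]] : exists c, `|c| <= `|z| /\ third z = dthird c * z.
  case: (lerP 0 z) => hz.
    have [c /andP[c0 c1]] := third_mvt hz; rewrite third0 !subr0 => e.
    by exists c; split; rewrite ?e // (ger0_norm c0) // (le_trans c1) // ler_norm.
  have [c /andP[c0 c1]] := third_mvt (ltW hz); rewrite third0 !sub0r => e.
  exists c; rewrite (ler0_norm c1); split; last by rewrite -[LHS]opprK e mulrN opprK.
  by have := ler_norm (- z); rewrite normrN; lra.
have hz : `|z| <= 2^-1 by rewrite ler_norml z0.
have hc' : - 2^-1 <= c <= 2^-1 by rewrite -ler_norml (le_trans hc).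
have /andP[_ h] := dthird_bounds hc'; have /andP[h0 _] := dthird_bounds hc'.
have d0 : 0 <= - dthird c.
  by apply: le_trans h0; rewrite divr_ge0 // mulr_ge0 // sqr_ge0.
rewrite e normrM -normrN (ger0_norm d0) exprSr mulrA; apply: ler_wpM2r => //.
apply: le_trans h _; apply: ler_wpM2l; first by rewrite mulr_ge0.
by rewrite -[c ^+ 2]real_normK ?num_real // lerXn2r ?nnegrE.
Qed.

Lemma third_low l : 0 <= l <= 2^-1 -> third_coef * l ^+ 3 / 72 <= third (- l).
Proof.
move=> /andP[l0 l1]; have M0 := third_coef_ge0.
have h1 : - l <= - (l / 2) by lra.
have h2 : - (l / 2) <= 0 by lra.
(* On the outer half, from [- l] to [- (l / 2)], the intermediate point satisfies
   [c ^+ 2 >= l ^+ 2 / 4]; on the inner half the sign suffices. The constant is 72 = 9 * 4 * 2. *)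
have [c /andP[c0 c1] e] := third_mvt h1; have [c' /andP[c0' c1'] e'] := third_mvt h2.
have hc : - 2^-1 <= c <= 2^-1 by apply/andP; split; lra.
have hc' : - 2^-1 <= c' <= 2^-1 by apply/andP; split; lra.
have /andP[b _] := dthird_bounds hc; have /andP[b' _] := dthird_bounds hc'.
have n0 : 0 <= - dthird c' * (l / 2).
  apply: mulr_ge0; last by lra.
  by apply: le_trans b'; rewrite divr_ge0 // mulr_ge0 // sqr_ge0.
rewrite third0 in e'.
have l2 : 0 <= l / 2 by lra.
have c2 : l ^+ 2 / 4 <= c ^+ 2.
  have : 0 <= (- c - l / 2) * (- c + l / 2) by apply: mulr_ge0; lra.
  by rewrite !expr2; lra.
have g1 : 0 <= third_coef * (c ^+ 2 - l ^+ 2 / 4) by apply: mulr_ge0; lra.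
have g2 : third_coef * l ^+ 2 / 36 <= - dthird c by lra.
by have := ler_wpM2r l2 g2; lra.
Qed.

End Combination.
End Cumulants.

Lemma beta_frac (R : realType) (b z : R) : b < 1 ->
  bz (beta b) z = b * expR z / (1 - b + b * expR z).
Proof.
move=> h; rewrite /bz /beta; have h1 : 0 < 1 - b by lra.
have [e|ne] := eqVneq (1 - b + b * expR z) 0.
  have -> : 1 + b / (1 - b) * expR z = 0.
    have -> : 1 + b / (1 - b) * expR z = (1 - b + b * expR z) / (1 - b) by field; rewrite gt_eqF.
    by rewrite e mul0r.
  by rewrite e !invr0 !mulr0.
field; rewrite ne gt_eqF // andbT /=.
Qed.

(** * Tail bounds at a general scale *)

Section Tails.
Variables (R : realType) (x y' : nat) (d1 d2 q a b1 b2 N x0v : R).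
Local Notation y := y'.+1.
Local Notation n := (y' + x).+1.
(** [N] is the scale and [x0v] the characteristic abscissa: [set_sec] states that the variances of
    the left input and of the top output agree there. The last two fields make the cubic coefficient
    comparable to [N]. *)
Record setting : Prop := Setting {
  set_d1P : 0 <= d1 <= 1;
  set_d2P : 0 <= d2 <= 1;
  set_dq : d2 = q * d1;
  set_q0 : 0 <= q;
  set_qa : q <= 1 - a;
  set_ab1 : a <= b1 <= 1 - a;
  set_ab2 : a <= b2 <= 1 - a;
  set_b12 : b1 <= b2;
  set_bal : beta b1 * (1 - d2) = beta b2 * (1 - d1);
  set_sec : x0v * (b2 * (1 - b2)) = y%:R * (b1 * (1 - b1));
  set_coefL : a ^+ 4 * N <= third_coef (y%:R) b1 b2;
  set_coefU : third_coef (y%:R) b1 b2 <= N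
}.

Hypothesis S : setting.
Hypothesis a0 : 0 < a.
Hypothesis a1 : a <= 2^-1.
Local Ltac slra := have := a0; have := a1; lra.

Local Notation bexp := (bexp x y' d1 d2).
Local Notation E := (EX d1 d2 (sweep x y')).
Local Notation hgt := (@hgt R x y').
Local Notation rk := (@nat_of_ord 4).

Definition ind (b : bool) : R := b%:R.

Definition delta : R := `|x%:R - x0v|.
Definition mean : R := y%:R * b1 - x%:R * b2.
Definition p1 z := bz (beta b1) z.
Definition p2 z := bz (beta b2) z.
Definition Phi z := x%:R * psi b2 z - y%:R * psi b1 z.

Lemma b1_01 : 0 < b1 < 1. Proof. by have /andP[] := set_ab1 S; slra. Qed.
Lemma b2_01 : 0 < b2 < 1. Proof. by have /andP[] := set_ab2 S; slra. Qed.

Lemma beta_gt0 b : 0 < b < 1 -> 0 < beta b :> R.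
Proof. by move=> /andP[h0 h1]; rewrite divr_gt0 // subr_gt0. Qed.

Lemma p1E z : p1 z = b1 * expR z / (1 - b1 + b1 * expR z).
Proof. by apply: beta_frac; case/andP: b1_01. Qed.

Lemma p2E z : p2 z = b2 * expR z / (1 - b2 + b2 * expR z).
Proof. by apply: beta_frac; case/andP: b2_01. Qed.

Lemma p10 : p1 0 = b1. Proof. by rewrite p1E expR0 !mulr1 subrK divr1. Qed.
Lemma p20 : p2 0 = b2. Proof. by rewrite p2E expR0 !mulr1 subrK divr1. Qed.

Lemma frac_diff (b u v : R) : 0 < b < 1 ->
  b * expR v / (1 - b + b * expR v) - b * expR u / (1 - b + b * expR u) =
  b * (1 - b) * (expR v - expR u) / ((1 - b + b * expR v) * (1 - b + b * expR u)).
Proof. by move=> h; field; rewrite !gt_eqF ?psi_den. Qed.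

Lemma frac_le (b u v : R) : 0 < b < 1 -> u <= v ->
  b * expR u / (1 - b + b * expR u) <= b * expR v / (1 - b + b * expR v).
Proof.
move=> h uv; rewrite -subr_ge0 frac_diff //; have /andP[h0 h1] := h.
apply: divr_ge0; last by apply: mulr_ge0; apply: ltW; apply: psi_den.
by apply: mulr_ge0; [apply: mulr_ge0; slra | rewrite subr_ge0 ler_expR].
Qed.

Lemma p1_le u v : u <= v -> p1 u <= p1 v.
Proof. by move=> h; rewrite !p1E frac_le ?b1_01. Qed.

Lemma p2_le u v : u <= v -> p2 u <= p2 v.
Proof. by move=> h; rewrite !p2E frac_le ?b2_01. Qed.

Lemma frac_01 (b z : R) : 0 < b < 1 -> 0 <= b * expR z / (1 - b + b * expR z) <= 1.
Proof.
move=> h; have D := psi_den z h; have /andP[h0 h1] := h; have e := expR_gt0 z.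
apply/andP; split; last by rewrite ler_pdivrMr // mul1r; slra.
by apply: divr_ge0; [apply: mulr_ge0; apply: ltW | apply: ltW].
Qed.

Lemma p1_01 z : 0 <= p1 z <= 1. Proof. by rewrite p1E frac_01 ?b1_01. Qed.
Lemma p2_01 z : 0 <= p2 z <= 1. Proof. by rewrite p2E frac_01 ?b2_01. Qed.

Lemma Phi0 : Phi 0 = 0.
Proof. by rewrite /Phi /psi expR0 !mulr1 !subrK ln1 !mulr0 subrr. Qed.

Lemma rainsPhi u v :
  bexp (p1 v) (p2 u) (fun h => expR ((u - v) * h)) = expR (Phi v - Phi u).
Proof.
rewrite rains ?beta_gt0 ?b1_01 ?b2_01 //; last exact: set_bal S.
have e (b : R) z w : 0 < b < 1 -> (1 + beta b * expR z) / (1 + beta b * expR w) =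
    expR (psi b z - psi b w).
  move=> hb; have /andP[h0 h1] := hb; have D := psi_den z hb; have D' := psi_den w hb.
  rewrite expRB /psi !lnK ?posrE // /beta.
  have f t : 1 + b / (1 - b) * expR t = (1 - b + b * expR t) / (1 - b).
    by field; rewrite gt_eqF; slra.
  have h2 : 0 < 1 - b by slra.
  by rewrite !f; field; rewrite !gt_eqF.
rewrite (e _ u v b1_01) (e _ v u b2_01) -!expRM_natl -expRD.
by congr expR; rewrite /Phi; ring.
Qed.

(** Splitting [x] at [x0v]: there the quadratic terms cancel and [third] remains, so a distance
    [delta] from the characteristic direction costs order [delta * z ^+ 2]. *)
Lemma Phi_third z : Phi z + z * mean =
  (x%:R - x0v) * (psi b2 z - b2 * z) + third x0v (y%:R) b1 b2 z.
Proof. rewrite /Phi /mean /third; ring. Qed.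

Lemma Phi_bound z : - 2^-1 <= z <= 2^-1 ->
  `|Phi z + z * mean| <= 16 * (N * `|z| ^+ 3 + delta * z ^+ 2).
Proof.
move=> hz; rewrite Phi_third; apply: le_trans (ler_normD _ _) _.
have /andP[z0 z1] := hz; have /andP[s0 s1] := psi_bound b2_01 z1.
have h1 := third_abs b1_01 b2_01 (ler0n _ _) (set_b12 S) (set_sec S) hz.
rewrite normrM (ger0_norm s0) -/delta.
have f1 : delta * (psi b2 z - b2 * z) <= delta * (2 * z ^+ 2) by apply: ler_wpM2l; rewrite ?normr_ge0.
have f2 : third_coef y%:R b1 b2 * `|z| ^+ 3 <= N * `|z| ^+ 3.
  by apply: ler_wpM2r; [apply: exprn_ge0 | exact: set_coefU S].
have f3 : 0 <= delta * z ^+ 2 by apply: mulr_ge0; rewrite ?normr_ge0 ?sqr_ge0.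
slra.
Qed.

Lemma Phi_low l : 0 <= l <= 2^-1 ->
  l * mean + a ^+ 4 / 72 * (N * l ^+ 3) - 2 * (delta * l ^+ 2) <= Phi (- l).
Proof.
move=> hl; have := Phi_third (- l); have /andP[l0 l1] := hl.
have h1 := third_low b1_01 b2_01 (ler0n _ y) (set_b12 S) (set_sec S) hl.
have hm : - l <= 2^-1 by slra.
have /andP[s0 s1] := psi_bound b2_01 hm.
have f1 : - delta * (psi b2 (- l) - b2 * - l) <= (x%:R - x0v) * (psi b2 (- l) - b2 * - l).
  by apply: ler_wpM2r => //; rewrite /delta; have := ler_norm (- (x%:R - x0v)); rewrite normrN; slra.
have f2 : delta * (psi b2 (- l) - b2 * - l) <= delta * (2 * (- l) ^+ 2) by apply: ler_wpM2l; rewrite ?normr_ge0.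
have f3 : a ^+ 4 * N * l ^+ 3 <= third_coef y%:R b1 b2 * l ^+ 3.
  by apply: ler_wpM2r; [apply: exprn_ge0 | exact: set_coefL S].
rewrite sqrrN in f2; slra.
Qed.

Lemma bern_ge0 (p : R) b : 0 <= p <= 1 -> 0 <= bern p b.
Proof. by move=> /andP[h0 h1]; case: b => //=; rewrite subr_ge0. Qed.

Lemma dens_01 (u v : R) (k : 'I_n) : 0 <= u <= 1 -> 0 <= v <= 1 -> 0 <= dens u v k <= 1.
Proof. by rewrite /dens; case: ifP. Qed.

Lemma bexp_le u v (f g : R -> R) : 0 <= u <= 1 -> 0 <= v <= 1 ->
  (forall h, f h <= g h) -> bexp u v f <= bexp u v g.
Proof.
move=> hu hv h; apply: EX_le => //; [exact: set_d1P S | exact: set_d2P S|].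
by move=> k b; apply: bern_ge0; exact: dens_01.
Qed.

Lemma bexpZ u v c (f : R -> R) : bexp u v (fun h => c * f h) = c * bexp u v f.
Proof. exact: EXZ. Qed.

Lemma bexpD u v (f g : R -> R) : bexp u v (fun h => f h + g h) = bexp u v f + bexp u v g.
Proof. exact: EXD. Qed.

Lemma bexp_cst u v c : bexp u v (fun _ => c) = c.
Proof. by rewrite /bexp EX_cst big1 ?mulr1 // => k _; apply: sum_bern. Qed.

Lemma bexp_ge0 u v (f : R -> R) : 0 <= u <= 1 -> 0 <= v <= 1 ->
  (forall h, 0 <= f h) -> 0 <= bexp u v f.
Proof. by move=> hu hv h; rewrite -(bexp_cst u v 0); apply: bexp_le. Qed.

Local Notation K := (labC (1 - a / 2)).

Lemma labC_ge1 (r : R) : 0 <= r < 1 -> 1 <= labC r.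
Proof.
move=> /andP[r0 r1]; rewrite /labC -[X in X <= _]expR0 ler_expR divr_ge0 //.
by apply: exprn_ge0; rewrite subr_ge0 ltW.
Qed.

Lemma K_ge1 : 1 <= K.
Proof. by apply: labC_ge1; apply/andP; split; slra. Qed.

(** Half of the gap between [q] and 1 is spent on the exponential; the other half keeps the constant
    [K] finite. *)
Lemma q_expR (lam : R) : 0 <= lam <= a / 2 -> q * expR lam <= 1 - a / 2.
Proof.
move=> /andP[l0 l1]; have e := expR_ge1Dx (- lam); have p := expR_gt0 lam.
have ee : expR lam * expR (- lam) = 1 by rewrite -expRD subrr expR0.
have f1 : 0 <= expR lam * (expR (- lam) - (1 - lam)) by apply: mulr_ge0; slra.
have f2 : 0 <= expR lam * (a / 2 - lam) by apply: mulr_ge0; slra.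
have f3 : expR lam * (1 - a / 2) <= 1 by slra.
have f4 : 0 <= (1 - a - q) * expR lam by apply: mulr_ge0; have := set_qa S; slra.
have f5 : 0 <= (1 - expR lam * (1 - a / 2)) * (1 - a / 2) by apply: mulr_ge0; slra.
have f6 : 0 <= expR lam * (a ^+ 2 / 4) by apply: mulr_ge0; [slra|rewrite divr_ge0 ?sqr_ge0].
slra.
Qed.

(** The moment of order [lam] is explicit once the bottom parameter exceeds the left one by [lam].
    Lowering the left one or raising the bottom one gives the two terms. *)
Lemma stationary_mgf z lam : 0 <= lam <= a / 2 ->
  bexp (p1 z) (p2 z) (fun h => expR (lam * h)) <=
  K * (expR (Phi (z - lam) - Phi z) + expR (Phi z - Phi (z + lam))).
Proof.
move=> hl; have /andP[l0 l1] := hl; have r01 : 0 <= 1 - a / 2 < 1 by apply/andP; split; slra.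
have m1 : p1 (z - lam) <= p1 z by apply: p1_le; slra.
have m2 : p2 z <= p2 (z + lam) by apply: p2_le; slra.
have /andP[P0 _] := p1_01 (z - lam); have /andP[_ P1] := p1_01 z.
have /andP[Q0 _] := p2_01 z; have /andP[_ Q1] := p2_01 (z + lam).
have s1 : z - (z - lam) = lam by ring.
have s2 : z + lam - z = lam by ring.
rewrite -(rainsPhi z (z - lam)) -(rainsPhi (z + lam) z) s1 s2.
exact: (two_sided_bound x y' (set_d1P S) (set_d2P S) (set_dq S) (set_q0 S) l0 (q_expR hl)
  r01 P0 m1 P1 Q0 m2 Q1).
Qed.

Lemma p1_strict z : 0 < p1 z < 1.
Proof.
have /andP[h0 h1] := b1_01; have D := psi_den z b1_01; have e := expR_gt0 z.
rewrite p1E; apply/andP; split; first by rewrite divr_gt0 // mulr_gt0.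
by rewrite ltr_pdivrMr // mul1r; slra.
Qed.

Lemma p1_diff v : 0 <= v <= 2^-1 -> a ^+ 2 * v / 2 <= p1 v - b1 <= v.
Proof.
move=> /andP[v0 v1]; have hb := b1_01; have /andP[A1 A2] := set_ab1 S.
have h2 : - 2^-1 <= v <= 2^-1 by apply/andP; split; slra.
have /andP[_ D2] := psi_den_bounds hb h2.
have e2 := expR_ub v1; have e1 := expR_ge1Dx v.
have D1 : 1 <= 1 - b1 + b1 * expR v.
  have : 0 <= b1 * (expR v - 1) by apply: mulr_ge0; slra.
  lra.
have -> : p1 v - b1 = b1 * (1 - b1) * (expR v - 1) / (1 - b1 + b1 * expR v).
  by rewrite p1E; field; rewrite gt_eqF // psi_den.
move: D1 D2; set D := 1 - b1 + _ => D1 D2.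
have ev : expR v - 1 <= 2 * v.
  have : 0 <= v * (1 - 2 * v) by apply: mulr_ge0; lra.
  by rewrite expr2 in e2; lra.
have bb : a ^+ 2 <= b1 * (1 - b1) <= 4^-1.
  have h : 0 <= (b1 - a) * (1 - b1) by apply: mulr_ge0; slra.
  have h' : 0 <= a * (1 - b1 - a) by apply: mulr_ge0; slra.
  have h'' := sqr_ge0 (b1 - 2^-1); rewrite !expr2 in h'' *.
  by apply/andP; split; lra.
move: bb; set B := b1 * (1 - b1) => /andP[B1 B2].
have B0 : 0 <= B by apply: le_trans B1; apply: sqr_ge0.
have D0 : 0 < D by lra.
rewrite ler_pdivlMr // ler_pdivrMr //; apply/andP; split.
  have g1 : 0 <= a ^+ 2 * v * (2 - D) by apply: mulr_ge0; [apply: mulr_ge0 => //; apply: sqr_ge0|lra].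
  have g2 : 0 <= (B - a ^+ 2) * v by apply: mulr_ge0; lra.
  have g3 : 0 <= B * (expR v - 1 - v) by apply: mulr_ge0; lra.
  lra.
have g1 : 0 <= B * (2 * v - (expR v - 1)) by apply: mulr_ge0; lra.
have g2 : 0 <= (4^-1 - B) * v by apply: mulr_ge0; lra.
have g3 : 0 <= v * (D - 1) by apply: mulr_ge0; lra.
lra.
Qed.

Lemma prod_range cut (Z : R) : 0 < Z -> (cut <= y)%N ->
  \prod_(k < n) (if (cut <= k)%N && (k < y)%N then Z else 1) = Z ^+ (y - cut).
Proof.
move=> Z0 hc; apply: (@mulfI _ (Z ^+ cut)); first by rewrite expf_neq0 // gt_eqF.
rewrite -exprD subnKC // -{1}(@prod_prefix _ x y' cut Z) ?(leq_trans hc) ?y_le_n //.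
rewrite -(@prod_prefix _ x y' y Z) ?y_le_n // -big_split /=; apply: eq_bigr => k _.
by case: (ltnP k cut) => hk /=; rewrite ?mulr1 ?mul1r // (leq_trans hk hc).
Qed.

Definition dens_cut cut t (k : 'I_n) : R :=
  if (k < cut)%N then p1 (2 * t) else if (k < y)%N then b1 else b2.

(** The second moment of the likelihood ratio is one plus the chi-square divergence of the two
    Bernoulli laws. *)
Lemma site_cost t : 0 <= t <= 4^-1 ->
  \sum_b bern (p1 (2 * t)) b * (bern b1 b / bern (p1 (2 * t)) b) ^+ 2 <= expR (8 * t ^+ 2 / a ^+ 2).
Proof.
move=> /andP[t0 t1]; have h2 : 0 <= 2 * t <= 2^-1 by apply/andP; split; lra.
have /andP[l u] := p1_diff h2; have /andP[P0 P1] := p1_strict (2 * t).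
have /andP[A1 A2] := set_ab1 S.
have q1 : a / 2 <= 1 - p1 (2 * t).
  have h3 : - 2^-1 <= 2 * t <= 2^-1 by apply/andP; split; lra.
  have /andP[_ D2] := psi_den_bounds b1_01 h3; have D0 := psi_den (2 * t) b1_01.
  have -> : 1 - p1 (2 * t) = (1 - b1) / (1 - b1 + b1 * expR (2 * t)).
    by rewrite p1E; field; rewrite gt_eqF.
  rewrite ler_pdivlMr //.
  have : 0 <= a * (2 - (1 - b1 + b1 * expR (2 * t))) by apply: mulr_ge0; slra.
  lra.
have p1a : a <= p1 (2 * t).
  have : 0 <= a ^+ 2 * (2 * t) / 2 by apply: divr_ge0 => //; apply: mulr_ge0; [exact: sqr_ge0|lra].
  lra.
rewrite big_bool /=; move: l u P0 P1 q1 p1a; set p := p1 _ => l u P0 P1 q1 p1a.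
have -> : p * (b1 / p) ^+ 2 + (1 - p) * ((1 - b1) / (1 - p)) ^+ 2 =
   1 + (p - b1) ^+ 2 / (p * (1 - p)).
  by field; rewrite !gt_eqF // subr_gt0.
apply: le_trans (expR_ge1Dx _); rewrite lerD2l.
have pp : a ^+ 2 / 2 <= p * (1 - p).
  have g1 : 0 <= (p - a) * (1 - p) by apply: mulr_ge0; lra.
  have g2 : 0 <= a * (1 - p - a / 2) by apply: mulr_ge0; slra.
  by rewrite expr2; lra.
have aa : 0 < a ^+ 2 by apply: exprn_gt0.
have db : 0 <= p - b1.
  by apply: le_trans l; apply: divr_ge0 => //; apply: mulr_ge0; [exact: sqr_ge0|lra].
rewrite ler_pdivrMr; last by lra.
have dd : (p - b1) ^+ 2 <= 4 * t ^+ 2.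
  have : 0 <= (2 * t - (p - b1)) * (2 * t + (p - b1)) by apply: mulr_ge0; lra.
  by rewrite !expr2; lra.
apply: le_trans dd _; rewrite -[X in X <= _](@divfK _ (a ^+ 2)) ?gt_eqF //.
have T : 0 <= t ^+ 2 / a ^+ 2 by apply: divr_ge0; apply: sqr_ge0.
have := ler_wpM2l T pp; lra.
Qed.

(** With the left parameter [2 * t] everywhere, the moment of order [- 2 * t] is explicit. The
    likelihood ratio [F] restores [b1] from [cut] on, and the inequality
    [2 * F * Y <= F ^+ 2 + Y ^+ 2] separates it from the exponential [Y]. *)
Lemma lower_change cut t s' : 0 <= t <= 4^-1 -> (cut <= y)%N ->
  E rb (fun k => bern (dens_cut cut t k)) (fun w0 w => ind (hgt id w0 w - mean < - s')) <=
  2^-1 * expR (- (t * s')) *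
  (expR (8 * t ^+ 2 / a ^+ 2 * (y - cut)%:R) + expR (2 * t * mean + Phi (2 * t))).
Proof.
move=> ht hc; have /andP[t0 t1] := ht; have /andP[P0 P1] := p1_strict (2 * t).
pose mid (k : 'I_n) := (cut <= k)%N && (k < y)%N.
pose f (k : 'I_n) (b : bool) : R := if mid k then bern b1 b / bern (p1 (2 * t)) b else 1.
have bne b : bern (p1 (2 * t)) b != 0 by case: b; rewrite /= gt_eqF // subr_gt0.
have f0 k b : 0 <= f k b.
  have /andP[h0 h1] := b1_01.
  by rewrite /f; case: ifP => // _; apply: divr_ge0; apply: bern_ge0; apply/andP; split; apply: ltW.
pose rho : 'I_n -> R := dens (p1 (2 * t)) b2.
have rho0 k b : 0 <= bern (rho k) b.
  by apply: bern_ge0; apply: dens_01; [exact: p1_01|rewrite -p20; exact: p2_01].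
have -> : E rb (fun k => bern (dens_cut cut t k)) (fun w0 w => ind (hgt id w0 w - mean < - s')) =
    E rb (fun k => bern (rho k)) (fun w0 w => (\prod_k f k (w0 k)) * ind (hgt id w0 w - mean < - s')).
  rewrite EX_tilt; apply: eq_EX => // [||k b]; [exact: set_d1P S|exact: set_d2P S|].
  rewrite /f /mid /rho /dens_cut /dens; case: (ltnP k cut) => hk /=.
    by rewrite (leq_trans hk hc) mulr1.
  by case: ifP => _; rewrite ?mulr1 // mulrCA mulfV ?mulr1.
apply: (@le_trans _ _ (E rb (fun k => bern (rho k)) (fun w0 w => 2^-1 * expR (- (t * s')) *
   ((\prod_k f k (w0 k) ^+ 2) * 1 + expR (2 * t * mean) * expR ((0 - 2 * t) * hgt id w0 w))))).
  apply: EX_le => [|||w0 w _ _]; rewrite ?(set_d1P S) ?(set_d2P S) //.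
  rewrite mulr1 prodrXl; set F := \prod_k f k (w0 k).
  have F0 : 0 <= F by apply: prodr_ge0 => k _.
  set h := hgt id w0 w; pose Y := expR (- t * (h - mean)).
  have eY : expR (2 * t * mean) * expR ((0 - 2 * t) * h) = Y ^+ 2.
    by rewrite -expRD expr2 -expRD; congr expR; ring.
  have hi : ind (h - mean < - s') <= expR (- (t * s')) * Y.
    rewrite -expRD /ind; case: ltP => hs; last exact: expR_ge0.
    by rewrite -[X in X <= _]expR0 ler_expR; have := ler_wpM2l t0 (ltW hs); lra.
  rewrite eY; have sq := sqr_ge0 (F - Y); have e0 := expR_ge0 (- (t * s')).
  apply: le_trans (ler_wpM2l F0 hi) _.
  have := ler_wpM2l e0 sq; rewrite !expr2; lra.
rewrite EXZ EXD EXZ; apply: ler_wpM2l; first by rewrite mulr_ge0 ?expR_ge0 ?invr_ge0 ?ler0n.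
apply: lerD; last first.
  have := rainsPhi 0 (2 * t); rewrite p20 Phi0 subr0 => e.
  by rewrite -[E _ _ _]/(bexp (p1 (2 * t)) b2 (fun h => expR ((0 - 2 * t) * h))) e -expRD.
rewrite (EX_tilt _ _ _ _ (fun k b => f k b ^+ 2) (fun _ _ => 1)) EX_cst mul1r.
rewrite mulrC expRM_natl -prod_range ?expR_gt0 //.
apply: ler_prod => k _; rewrite /= sumr_ge0 /=; last by move=> b _; rewrite mulr_ge0 ?exprn_ge0.
rewrite -/(mid k) /f; case: ifP => hk.
  rewrite /rho /dens; case/andP: hk => _ ->; exact: site_cost.
by under eq_bigr => b _ do rewrite expr1n mulr1; rewrite sum_bern.
Qed.

(** The value 1024 makes the cost [8 * drift ^+ 2 / a ^+ 2] per site, over a segment with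
    [ell * eps = 32 / a ^+ 2 * s], equal to [eta * eps * s / 4]. *)
Definition eta : R := a ^+ 4 / 1024.
Lemma a4_bound : 0 < a ^+ 4 <= 2^-1.
Proof.
rewrite exprn_gt0 //=; have h : a ^+ 4 <= a ^+ 1.
  by apply: ler_wiXn2l => //; slra.
by rewrite expr1 in h; slra.
Qed.

Lemma eta_bound : 0 < eta <= 2^-1.
Proof. by have /andP[h1 h2] := a4_bound; rewrite /eta; apply/andP; split; lra. Qed.

(** * Chernoff bounds at tilt [eps] and level [s] *)

Section Scale.
Variables (eps s : R).
Hypothesis eps0 : 0 < eps.
Hypothesis eps1 : eps <= a / 600.
Hypothesis epsN : N * eps ^+ 2 <= a / 600 * s.
Hypothesis epsD : eps * delta <= a / 600 * s.

Local Ltac elra := have := eps0; have := eps1; have := epsN; have := epsD; slra.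

(** What the conditions on [eps] and [s] are for: the error of the expansion of [Phi] at tilt [eps]
    is a small fraction of the Chernoff gain [eps * s]. *)
Lemma scale_error : 600 * (N * eps ^+ 3 + delta * eps ^+ 2) <= 2 * a * (eps * s).
Proof.
have h1 := ler_wpM2l (ltW eps0) epsN; have h2 := ler_wpM2l (ltW eps0) epsD.
elra.
Qed.

Lemma upper_tail : 0 <= s ->
  bexp b1 b2 (fun h => ind (s < h - mean)) <= 2 * K * expR (- (eps * s / 2)).
Proof.
move=> s0.
have hle h : ind (s < h - mean) <= expR (- (eps * (mean + s))) * expR (eps * h).
  rewrite -expRD /ind; case: ltP => hs; last exact: expR_ge0.
  rewrite -[X in X <= _]expR0 ler_expR; have := ler_wpM2l (ltW eps0) (ltW hs); elra.
have i1 := p1_01 0; have i2 := p2_01 0; rewrite p10 in i1; rewrite p20 in i2.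
apply: le_trans (bexp_le i1 i2 hle) _; rewrite bexpZ.
have hl : 0 <= eps <= a / 2 by apply/andP; split; elra.
have := stationary_mgf 0 hl; rewrite p10 p20 Phi0 !sub0r add0r subr0 => h.
apply: (@le_trans _ _ (expR (- (eps * (mean + s))) * (K * (expR (eps * mean + eps * s / 2) +
   expR (eps * mean + eps * s / 2))))).
  apply: ler_wpM2l; first exact: expR_ge0.
  apply: le_trans h _; apply: ler_wpM2l; first by have := K_ge1; elra.
  have er := scale_error; have es : 0 <= eps * s by apply: mulr_ge0; elra.
  have ae : a * (eps * s) <= 2^-1 * (eps * s) by apply: ler_wpM2r.
  have r1 : - 2^-1 <= - eps <= 2^-1 by apply/andP; split; elra.
  have r2 : - 2^-1 <= eps <= 2^-1 by apply/andP; split; elra.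
  have := Phi_bound r1; have := Phi_bound r2.
  rewrite normrN (gtr0_norm eps0) sqrrN !ler_norml => /andP[g1 g2] /andP[g3 g4].
  by apply: lerD; rewrite ler_expR; elra.
have -> : forall A B : R, A * (K * (B + B)) = 2 * K * (A * B) by move=> A B; ring.
rewrite -expRD; have -> : - (eps * (mean + s)) + (eps * mean + eps * s / 2) = - (eps * s / 2) by field.
by [].
Qed.

Definition drift : R := eta * eps.

Lemma drift_bound : 0 < drift /\ 2 * drift <= eps /\ drift <= 4^-1.
Proof.
have /andP[h1 h2] := eta_bound; rewrite /drift.
have g : 0 <= (2^-1 - eta) * eps by apply: mulr_ge0; elra.
split; first by rewrite mulr_gt0.
by split; elra.
Qed.

Lemma N_ge0 : 0 <= N.
Proof.
exact: le_trans (third_coef_ge0 b1_01 (ler0n _ y) (set_b12 S)) (set_coefU S).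
Qed.

Lemma scale_terms : [/\ 0 <= N * eps ^+ 3, 0 <= delta * eps ^+ 2 &
  N * eps ^+ 3 + delta * eps ^+ 2 <= a * (eps * s) / 300].
Proof.
have h := scale_error; split; last by lra.
  by apply: mulr_ge0; [exact: N_ge0 | apply: exprn_ge0; elra].
by apply: mulr_ge0; [exact: normr_ge0 | exact: sqr_ge0].
Qed.

(** * One step of the lower tail recursion *)

Section Recursion.
Hypothesis s1 : 1 <= s.
Local Ltac rlra := have := s1; elra.

Lemma eps_s : 0 < eps * s. Proof. by apply: mulr_gt0; rlra. Qed.

Lemma a_eps_s : a * (eps * s) <= 2^-1 * (eps * s).
Proof. by apply: ler_wpM2r => //; apply: ltW; exact: eps_s. Qed.

(** The Chernoff gain is [drift * s / 2], and each of the two terms of [lower_change] spends at most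
    half of it. *)
Lemma change_bound cut (ell : R) : (cut <= y)%N -> (y - cut)%:R <= ell ->
  ell * eps <= 32 / a ^+ 2 * s ->
  E rb (fun k => bern (dens_cut cut drift k)) (fun w0 w => ind (hgt id w0 w - mean < - (s / 2))) <=
  expR (- (eta * eps * s / 4)).
Proof.
move=> hc hl hell; have [t0 [t1 t2]] := drift_bound; have /andP[e0 e1] := eta_bound.
have es := eps_s; have aes := a_eps_s; have [T1 T2 T3] := scale_terms.
have ht : 0 <= drift <= 4^-1 by apply/andP; split; lra.
apply: le_trans (lower_change (s / 2) ht hc) _.
have c1 : 8 * drift ^+ 2 / a ^+ 2 * (y - cut)%:R <= eta * eps * s / 4.
  have a2 : 0 < a ^+ 2 by apply: exprn_gt0.
  apply: (@le_trans _ _ (8 * drift ^+ 2 / a ^+ 2 * ell)).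
    apply: ler_wpM2l => //; apply: divr_ge0; last exact: ltW.
    by apply: mulr_ge0 => //; exact: sqr_ge0.
  have -> : 8 * drift ^+ 2 / a ^+ 2 * ell = 8 * eta ^+ 2 * eps / a ^+ 2 * (ell * eps).
    by rewrite /drift; field; rewrite gt_eqF.
  have p : 0 <= 8 * eta ^+ 2 * eps / a ^+ 2.
    by apply: divr_ge0; [apply: mulr_ge0; [apply: mulr_ge0 => //; exact: sqr_ge0|elra]|exact: ltW].
  apply: le_trans (ler_wpM2l p hell) _; rewrite le_eqVlt; apply/orP; left; apply/eqP.
  by rewrite /eta; field; rewrite gt_eqF.
have c2 : 2 * drift * mean + Phi (2 * drift) <= eta * eps * s / 4.
  have r : - 2^-1 <= 2 * drift <= 2^-1 by apply/andP; split; lra.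
  have := Phi_bound r; rewrite (ger0_norm (_ : 0 <= 2 * drift)); last by lra.
  rewrite ler_norml => /andP[_ h].
  have ee : eta ^+ 3 <= eta ^+ 2.
    by apply: ler_wiXn2l => //; lra.
  have g1 : 0 <= (eta ^+ 2 - eta ^+ 3) * (N * eps ^+ 3) by apply: mulr_ge0; lra.
  have g2 : 0 <= eta ^+ 2 * (a * (eps * s) / 300 - (N * eps ^+ 3 + delta * eps ^+ 2)).
    by apply: mulr_ge0; [exact: sqr_ge0 | lra].
  have g3 : 0 <= eta ^+ 2 * (2^-1 * (eps * s) - a * (eps * s)).
    by apply: mulr_ge0; [exact: sqr_ge0 | lra].
  have g4 : 0 <= eta * (2^-1 - eta) * (eps * s) by apply: mulr_ge0; [apply: mulr_ge0; lra|lra].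
  have g5 : 0 <= eta ^+ 2 * (delta * eps ^+ 2) by apply: mulr_ge0 => //; exact: sqr_ge0.
  have g6 : 0 <= eta * (eps * s) by apply: mulr_ge0; lra.
  by rewrite /drift in h *; lra.
have h1 : expR (8 * drift ^+ 2 / a ^+ 2 * (y - cut)%:R) <= expR (eta * eps * s / 4) by rewrite ler_expR.
have h2 : expR (2 * drift * mean + Phi (2 * drift)) <= expR (eta * eps * s / 4) by rewrite ler_expR.
have -> : expR (- (eta * eps * s / 4)) = expR (- (drift * (s / 2))) * expR (eta * eps * s / 4).
  by rewrite -expRD; congr expR; rewrite /drift; field.
have e := expR_ge0 (- (drift * (s / 2))).
have := ler_wpM2l e (lerD h1 h2); lra.
Qed.

(** A site of the lower left segment carries a 1 with probability [p1 eps - b1]; this is the mean of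
    a factor [expR (- eps)] per 1. *)
Definition thin : R := 1 - (p1 eps - b1) * (1 - expR (- eps)).

Lemma thin_bound : 0 < thin <= expR (- (a ^+ 2 * eps ^+ 2 / 4)).
Proof.
have hv : 0 <= eps <= 2^-1 by apply/andP; split; elra.
have /andP[l u] := p1_diff hv.
have n1 : - eps <= 2^-1 by elra.
have e1 := expR_ub n1; have e2 := expR_gt0 (- eps).
have c : eps / 2 <= 1 - expR (- eps).
  have : 0 <= eps * (1 - 4 * eps) by apply: mulr_ge0; elra.
  by rewrite !expr2 in e1 *; lra.
have l0 : 0 <= a ^+ 2 * eps / 2.
  by apply: divr_ge0 => //; apply: mulr_ge0; [exact: sqr_ge0|elra].
rewrite /thin; apply/andP; split.
  have : 0 <= (p1 eps - b1) * expR (- eps) by apply: mulr_ge0; lra.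
  elra.
apply: le_trans (expR_ge1Dx _); rewrite lerD2l lerN2.
have g1 : 0 <= (p1 eps - b1 - a ^+ 2 * eps / 2) * (1 - expR (- eps)) by apply: mulr_ge0; elra.
have g2 : 0 <= a ^+ 2 * eps / 2 * (1 - expR (- eps) - eps / 2) by apply: mulr_ge0; lra.
by rewrite expr2; lra.
Qed.

(* Colour 2 raises the left density above the height [y - cut], colour 1 raises
   the densities on the rest of the boundary up to the stationary ones at [eps]. *)
Definition nu3 cut (k : 'I_n) : 'I_4 -> R :=
  if (k < cut)%N then cw (1 - p1 (2 * drift)) 0 (p1 (2 * drift) - b1) b1
  else if (k < y)%N then cw (1 - p1 eps) (p1 eps - b1) 0 b1
  else cw (1 - p2 eps) (p2 eps - b2) 0 b2.

Lemma nu3_ge0 cut k c : 0 <= nu3 cut k c.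
Proof.
have [t0 [t1 t2]] := drift_bound; have /andP[h1 _] := b1_01; have /andP[h2 _] := b2_01.
have /andP[P0 P1] := p1_01 eps; have /andP[Q0 Q1] := p2_01 eps.
have /andP[P0' P1'] := p1_01 (2 * drift).
have m1 : b1 <= p1 eps by rewrite -p10 p1_le //; elra.
have m2 : b2 <= p2 eps by rewrite -p20 p2_le //; elra.
have m3 : b1 <= p1 (2 * drift) by rewrite -p10 p1_le //; lra.
by rewrite /nu3; case: ifP => _; [|case: ifP => _]; apply: cw_ge0; lra.
Qed.

(** After the tilt a segment site has total mass [thin]. The measure [thin] times Bernoulli of
    density [p1 eps] has the same mass and puts more of it on occupied, so [left_mono] leads back to
    a stationary model. *)
Lemma left_chernoff cut : (cut <= y)%N ->
  E rk (nu3 cut) (fun w0 w => expR (- (eps * (left1 w0)%:R)) * expR (eps * hgt (thr 1) w0 w)) <=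
  thin ^+ (y - cut) * bexp (p1 eps) (p2 eps) (fun h => expR (eps * h)).
Proof.
move=> hc; have [t0 [t1 t2]] := drift_bound; have /andP[th0 _] := thin_bound.
have D1 := set_d1P S; have D2 := set_d2P S.
have /andP[P0 P1] := p1_01 eps; have /andP[Q0 Q1] := p2_01 eps.
have ex := expR_gt0 (- eps); have ex1 : expR (- eps) <= 1.
  by rewrite -expR0 ler_expR; elra.
have m1 : b1 <= p1 eps by rewrite -p10 p1_le //; elra.
pose f (k : 'I_n) (c : 'I_4) : R := if (k < y)%N && (c == 1%N :> nat) then expR (- eps) else 1.
have -> : E rk (nu3 cut) (fun w0 w => expR (- (eps * (left1 w0)%:R)) * expR (eps * hgt (thr 1) w0 w)) =
    E rk (nu3 cut) (fun w0 w => (\prod_k f k (w0 k)) * expR (eps * hgt (thr 1) w0 w)).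
  apply: eq_EX => // w0 w; congr (_ * _).
  rewrite /left1 natr_sum mulr_sumr -sumrN expR_sum big_mkcond; apply: eq_bigr => k _.
  by rewrite /f; case: ifP => //= _; case: eqP => _; rewrite ?mulr1 ?mulr0 ?oppr0 ?expR0.
rewrite EX_tilt (EX_thr D1 D2 1 _ (fun h => expR (eps * h))).
pose mid (k : 'I_n) := (cut <= k)%N && (k < y)%N.
pose zk (k : 'I_n) (b : bool) : R := if mid k then thin else 1.
have -> : thin ^+ (y - cut) * bexp (p1 eps) (p2 eps) (fun h => expR (eps * h)) =
    E rb (fun k b => bern (dens (p1 eps) (p2 eps) k) b * zk k b) (fun w0 w => expR (eps * hgt id w0 w)).
  rewrite -EX_tilt -EXZ; apply: eq_EX => // w0 w; congr (_ * _).
  by rewrite -prod_range.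
have push k b : \sum_(c | thr 1 c == b) nu3 cut k c * f k c =
    if (k < cut)%N then bern (p1 (2 * drift)) b
    else if (k < y)%N then (if b then (p1 eps - b1) * expR (- eps) + b1 else 1 - p1 eps)
    else bern (p2 eps) b.
  rewrite (eq_bigr (if (k < cut)%N then cw (1 - p1 (2 * drift)) 0 (p1 (2 * drift) - b1) b1
     else if (k < y)%N then cw (1 - p1 eps) ((p1 eps - b1) * expR (- eps)) 0 b1
     else cw (1 - p2 eps) (p2 eps - b2) 0 b2)); last first.
    move=> c _; rewrite /nu3 /f; case: (ltnP k cut) => hk.
      rewrite (leq_trans hk hc) /=; case: c => [[|[|[|[|]]]] hcc] //=; rewrite /cw /= ?mulr1 ?mul0r //.
    case: ifP => _ /=; last by rewrite mulr1.
    by case: c => [[|[|[|[|]]]] hcc] //=; rewrite /cw /= ?mulr1 ?mul0r.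
  case: ifP => _; [|case: ifP => _]; rewrite sum_cw /thr !inordK //; case: b => /=; ring.
apply: (left_mono D1 D2 (g := fun h => expR (eps * h))) => //.
- by move=> h h' hh; rewrite ler_expR; apply: ler_wpM2l => //; elra.
- move=> k b; apply: sumr_ge0 => c _; apply: mulr_ge0; first exact: nu3_ge0.
  by rewrite /f; case: ifP => _ //; apply: ltW.
- move=> k b; apply: mulr_ge0; first by apply: bern_ge0; apply: dens_01; [exact: p1_01|exact: p2_01].
  by rewrite /zk; case: ifP => _ //; apply: ltW.
- move=> k; rewrite !push /zk /mid /dens; case: (ltnP k cut) => hk /=.
    by rewrite (leq_trans hk hc); ring.
  by case: ifP => _; rewrite /thin /=; ring.
- move=> k; rewrite !push /zk /mid /dens; case: (ltnP k cut) => hk /=.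
    by rewrite (leq_trans hk hc) mulr1; apply: p1_le.
  case: ifP => _ /=; last by rewrite mulr1.
  have : 0 <= (p1 eps - b1) * (1 - expR (- eps)) * (1 - p1 eps).
    by apply: mulr_ge0; [apply: mulr_ge0|]; lra.
  by rewrite /thin; lra.
move=> k hk; have h1 : (k < cut)%N = false by rewrite ltnNge (leq_trans hc hk).
have h2 : (k < y)%N = false by rewrite ltnNge hk.
by rewrite !push /zk /mid /dens h1 h2 andbF mulr1.
Qed.

Lemma left_chernoff_bound cut : (cut <= y)%N -> 16 / a ^+ 2 * s <= (y - cut)%:R * eps ->
  expR (eps * (2 * s - mean)) *
  E rk (nu3 cut) (fun w0 w => expR (- (eps * (left1 w0)%:R)) * expR (eps * hgt (thr 1) w0 w)) <=
  2 * K * expR (- (eps * s)).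
Proof.
move=> hc hl; have es := eps_s; have aes := a_eps_s; have [T1 T2 T3] := scale_terms.
have K1 := K_ge1.
have a2 : 0 < a ^+ 2 by apply: exprn_gt0.
have bound : bexp (p1 eps) (p2 eps) (fun h => expR (eps * h)) <= K * (2 * expR (eps * mean + eps * s)).
  have hl' : 0 <= eps <= a / 2 by apply/andP; split; elra.
  apply: le_trans (stationary_mgf eps hl') _; apply: ler_wpM2l; first by lra.
  rewrite subrr Phi0 sub0r.
  have r1 : - 2^-1 <= eps <= 2^-1 by apply/andP; split; elra.
  have r2 : - 2^-1 <= eps + eps <= 2^-1 by apply/andP; split; elra.
  have := Phi_bound r1; have := Phi_bound r2.
  have -> : `|eps + eps| = 2 * eps by rewrite ger0_norm; elra.
  rewrite (gtr0_norm eps0) !ler_norml => /andP[g1 g2] /andP[g3 g4].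
  have f1 : - Phi eps <= eps * mean + eps * s by lra.
  have f2 : Phi eps - Phi (eps + eps) <= eps * mean + eps * s by lra.
  have := f1; have := f2; rewrite -ler_expR => h1; rewrite -ler_expR => h2; lra.
(* The lower bound on the segment length gives the exponent 4, which beats the 2 of the floor
   [- 2 * s] and the 1 allowed for the moment. *)
have th : thin ^+ (y - cut) <= expR (- (4 * (eps * s))).
  have /andP[t0 t1] := thin_bound.
  apply: (@le_trans _ _ (expR (- (a ^+ 2 * eps ^+ 2 / 4)) ^+ (y - cut))).
    by apply: lerXn2r; rewrite ?nnegrE ?expR_ge0 // ltW.
  rewrite -expRM_natl ler_expR mulrN lerN2.
  have p : 0 <= a ^+ 2 * eps / 4 by apply: divr_ge0 => //; apply: mulr_ge0; [exact: ltW|elra].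
  have := ler_wpM2l p hl.
  have -> : a ^+ 2 * eps / 4 * (16 / a ^+ 2 * s) = 4 * (eps * s) by field; rewrite gt_eqF.
  by move=> h; apply: le_trans h _; rewrite le_eqVlt; apply/orP; left; apply/eqP; field.
have tn : 0 <= thin ^+ (y - cut) by have /andP[t0 _] := thin_bound; apply: exprn_ge0; apply: ltW.
apply: le_trans (ler_wpM2l (expR_ge0 _) (left_chernoff hc)) _.
apply: le_trans (ler_wpM2l (expR_ge0 _) (ler_wpM2l tn bound)) _.
apply: (@le_trans _ _ (expR (eps * (2 * s - mean)) *
   (expR (- (4 * (eps * s))) * (K * (2 * expR (eps * mean + eps * s)))))).
  apply: ler_wpM2l; first exact: expR_ge0.
  by apply: ler_wpM2r => //; rewrite !mulr_ge0 ?expR_ge0 //; lra.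
have -> : expR (- (eps * s)) = expR (eps * (2 * s - mean)) * expR (- (4 * (eps * s))) *
   expR (eps * mean + eps * s).
  by rewrite -!expRD; congr expR; ring.
by rewrite le_eqVlt; apply/orP; left; apply/eqP; ring.
Qed.

Definition low (r : R) : R := bexp b1 b2 (fun h => ind (h - mean < - r)).

Lemma nu3_thr3 cut (g : R -> R) : (cut <= y)%N ->
  E rk (nu3 cut) (fun w0 w => g (hgt (thr 3) w0 w)) = bexp b1 b2 g.
Proof.
move=> hc; have D1 := set_d1P S; have D2 := set_d2P S.
rewrite (EX_thr D1 D2 3 _ g); apply: eq_EX => // k b.
rewrite /nu3 /dens; case: (ltnP k cut) => hk; first rewrite (leq_trans hk hc).
  by rewrite sum_cw /thr !inordK //; case: b => /=; ring.
by case: ifP => _; rewrite sum_cw /thr !inordK //; case: b => /=; ring.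
Qed.

Lemma nu3_thr2 cut (g : R -> R) : (cut <= y)%N ->
  E rk (nu3 cut) (fun w0 w => g (hgt (thr 2) w0 w)) =
  E rb (fun k => bern (dens_cut cut drift k)) (fun w0 w => g (hgt id w0 w)).
Proof.
move=> hc; have D1 := set_d1P S; have D2 := set_d2P S.
rewrite (EX_thr D1 D2 2 _ g); apply: eq_EX => // k b.
by rewrite /nu3 /dens_cut; case: ifP => _; [|case: ifP => _];
  rewrite sum_cw /thr !inordK //; case: b => /=; ring.
Qed.

Lemma nu3_total cut c : E rk (nu3 cut) (fun _ _ => c) = c.
Proof.
rewrite EX_cst big1 ?mulr1 // => k _; rewrite /nu3.
by case: ifP => _; [|case: ifP => _]; rewrite (sum_cw xpredT) /=; ring.
Qed.

Lemma nu3_ordered cut (w0 : word n 'I_4) : (forall k : 'I_n, nu3 cut k (w0 k) != 0) -> ordered cut w0.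
Proof.
move=> h k; have := h k; rewrite /nu3.
case: (w0 k) => [[|[|[|[|c]]]] hcc] // hk; split=> hc // _; move: hk.
  by rewrite hc /cw eqxx.
by rewrite ltnNge hc /cw /=; case: ifP => _ /=; rewrite eqxx.
Qed.

(** A single 1 at the top already turns every 2 on the right into an inversion, so the event forces
    more than [s / 2] inversions. *)
Lemma crossing_bound cut : (cut <= y)%N ->
  E rk (nu3 cut) (fun _ w => ind ((s / 2 < (right2 w)%:R) && (s / 2 < (top1 w)%:R))) <=
  K * expR (- (eps * s / 2)).
Proof.
move=> hc; have K1 := K_ge1.
have hl : 0 <= eps <= a / 2 by apply/andP; split; elra.
have r01 : 0 <= 1 - a / 2 < 1 by apply/andP; split; elra.
rewrite -[expR (- (eps * s / 2))](nu3_total cut).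
apply: (EX_conc (cut := cut) (set_d1P S) (set_d2P S) (set_dq S) (set_q0 S) (expR_ge0 eps) (q_expR hl) r01
  (nu3_ge0 cut)).
- by move=> k [[|[|[|[|]]]] hcc] hk //; rewrite /nu3 hk.
- by move=> k [[|[|[|[|]]]] hcc] hk //; rewrite /nu3 ltnNge hk /=; case: ifP.
- by move=> w0 w; apply: expR_ge0.
- by [].
move=> w0 w h0 hw; rewrite -expRM_natl -expRD /ind.
case: andP => [[h1 h2]|_]; last exact: expR_ge0.
rewrite -[X in X <= _]expR0 ler_expR.
have h3 : s / 2 < (inv w)%:R.
  apply: lt_le_trans h1 _; rewrite ler_nat; apply: leq_trans (inv_ge w).
  rewrite leq_pmull // -(ltr_nat R); apply: le_lt_trans h2; rlra.
have := ler_wpM2l (ltW eps0) (ltW h3); lra.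
Qed.

Lemma low_step_cut cut : (cut <= y)%N -> 16 / a ^+ 2 * s <= (y - cut)%:R * eps ->
  (y - cut)%:R * eps <= 32 / a ^+ 2 * s ->
  low s <= (1 + 3 * K) * expR (- (eta * eps * s / 4)) + low (2 * s).
Proof.
move=> hc hl hu; have D1 := set_d1P S; have D2 := set_d2P S.
have cA := change_bound hc (lexx _) hu; have cB := crossing_bound hc.
have cD := left_chernoff_bound hc hl.
rewrite -(nu3_thr2 (fun h => ind (h - mean < - (s / 2))) hc) in cA.
rewrite /low -(nu3_thr3 (fun h => ind (h - mean < - s)) hc) -(nu3_thr3 (fun h => ind (h - mean < - (2 * s))) hc).
set A := fun w0 w => ind (hgt (thr 2) w0 w - mean < - (s / 2)) in cA.
set B := fun (_ w : word n 'I_4) => ind (_ && _) in cB.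
set C := fun w0 w => ind (hgt (thr 3) w0 w - mean < - (2 * s)).
set D := fun w0 w => expR (- _) * _ in cD.
(* Below level [- s]: if at most [s / 2] twos leave to the right, [A] holds; if both families exceed
   [s / 2], [B]; below [- 2 * s], [C]. Otherwise the height of [thr 1] is at least [mean - 2 * s]
   plus [left1], and the exponential in [D] is at least 1. *)
have le : E rk (nu3 cut) (fun w0 w => ind (hgt (thr 3) w0 w - mean < - s)) <=
   E rk (nu3 cut) (fun w0 w => A w0 w + B w0 w + C w0 w + expR (eps * (2 * s - mean)) * D w0 w).
  apply: EX_le => //; first exact: nu3_ge0.
  move=> w0 w hs hw; have h0 := nu3_ordered hs.
  have e2 := hgt2E R hc h0 hw; have e1 := hgt1E R hw.
  have i0 b : 0 <= ind b by rewrite /ind ler0n.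
  have d0 : 0 <= expR (eps * (2 * s - mean)) * D w0 w.
    by apply: mulr_ge0; [|apply: mulr_ge0]; apply: expR_ge0.
  have a0' := i0 (hgt (thr 2) w0 w - mean < - (s / 2)); rewrite -/(A w0 w) in a0'.
  have b0' : 0 <= B w0 w := i0 _; have c0' : 0 <= C w0 w := i0 _.
  rewrite {1}/ind; case: ltP => h3 /=; last by lra.
  have one (Q : bool) : Q -> ind Q = 1 by move=> ->.
  case: (ltP (s / 2) (right2 w)%:R) => k1; last first.
    have -> : A w0 w = 1 by apply: one; rewrite e2; rlra.
    lra.
  case: (ltP (s / 2) (top1 w)%:R) => k2.
    have -> : B w0 w = 1 by apply: one; rewrite k1 k2.
    lra.
  case: (ltP (hgt (thr 3) w0 w - mean) (- (2 * s))) => h4.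
    have -> : C w0 w = 1 by apply: one.
    lra.
  suff : 1 <= expR (eps * (2 * s - mean)) * D w0 w by lra.
  rewrite /D -!expRD -[X in X <= _]expR0 ler_expR e1 e2.
  have : 0 <= eps * (hgt (thr 3) w0 w - mean + 2 * s + ((right2 w)%:R - (top1 w)%:R)).
    by apply: mulr_ge0; elra.
  lra.
apply: (le_trans le); rewrite !EXD EXZ.
have es := eps_s; have /andP[e0 e1] := eta_bound; have K1 := K_ge1.
have f1 : expR (- (eps * s / 2)) <= expR (- (eta * eps * s / 4)).
  rewrite ler_expR; have : 0 <= (2^-1 - eta) * (eps * s) by apply: mulr_ge0; lra.
  lra.
have f2 : expR (- (eps * s)) <= expR (- (eta * eps * s / 4)).
  rewrite ler_expR; have : 0 <= (2^-1 - eta) * (eps * s) by apply: mulr_ge0; lra.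
  lra.
have K0 : 0 <= K by lra.
have := ler_wpM2l K0 f1; have := ler_wpM2l K0 f2.
rewrite -/C; lra.
Qed.

Lemma low_step : low s <= (1 + 3 * K) * expR (- (eta * eps * s / 4)) + low (2 * s).
Proof.
have a2 : 0 < a ^+ 2 by apply: exprn_gt0.
have i2 : 1 <= (a ^+ 2)^-1.
  by rewrite invf_ge1 //; apply: exprn_ile1; rlra.
(* The segment length must lie between [r] and [2 * r]; [1 <= r] leaves room for rounding up. *)
pose r := 16 / a ^+ 2 * s / eps.
have r1 : 1 <= r.
  rewrite /r ler_pdivlMr // mul1r.
  have : 0 <= ((a ^+ 2)^-1 - 1) * s by apply: mulr_ge0; rlra.
  rlra.
have r0 : 0 <= r by lra.
have er : r * eps = 16 / a ^+ 2 * s by rewrite /r divfK // gt_eqF.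
have /andP[t1 t2] := truncn_itv r0.
set ell := (Num.truncn r).+1 in t2.
have t3 : ell%:R <= 2 * r by rewrite /ell -natr1; lra.
have hu : ell%:R * eps <= 32 / a ^+ 2 * s.
  have := ler_wpM2r (ltW eps0) t3; lra.
have hl : 16 / a ^+ 2 * s <= ell%:R * eps.
  by rewrite -er; apply: ler_wpM2r; rewrite ltW.
case: (leqP ell y) => hy.
  have e : (y - (y - ell) = ell)%N by rewrite subKn.
  by apply: (low_step_cut (cut := (y - ell)%N)); rewrite ?e // leq_subr.
(* The left boundary is shorter than the segment: with [cut] equal to 0 the weights are the
   stationary ones and the change of measure alone suffices. *)
have h := change_bound (cut := 0%N) (leq0n _) _ hu.
have l2 : 0 <= low (2 * s).
  by apply: bexp_ge0 => [||u]; rewrite -?p10 -?p20 ?p1_01 ?p2_01 // /ind ler0n.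
have K1 := K_ge1; have ex := expR_gt0 (- (eta * eps * s / 4)).
suff : low s <= expR (- (eta * eps * s / 4)).
  have : 0 <= K * expR (- (eta * eps * s / 4)) by apply: mulr_ge0; lra.
  lra.
apply: le_trans (h _); last by rewrite subn0 ler_nat ltnW.
rewrite /low /bexp.
have -> : E rb (fun k => bern (dens b1 b2 k)) (fun w0 w => ind (hgt id w0 w - mean < - s)) =
   E rb (fun k => bern (dens_cut 0 drift k)) (fun w0 w => ind (hgt id w0 w - mean < - s)).
  by apply: (eq_EX (set_d1P S) (set_d2P S)).
apply: EX_le => [|||w0 w _ _]; rewrite ?(set_d1P S) ?(set_d2P S) //.
  move=> k c; apply: bern_ge0; rewrite /dens_cut ltn0.
  by case: ifP => _; rewrite -?p10 -?p20 ?p1_01 ?p2_01.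
rewrite /ind; case: ltP => h1; case: ltP => h2 //=; rewrite ?ler01 //.
exfalso; rlra.
Qed.

End Recursion.

End Scale.

(** * Two-sided tails and the lower bound on the upper tail *)

Lemma hgt_ge w0 w : - x%:R <= hgt id w0 w.
Proof.
have h1 : 0 <= \sum_(k < n | (k < y)%N) (w0 k)%:R :> R by apply: sumr_ge0 => k _; rewrite ler0n.
have h2 : \sum_(k < n | (k < x)%N) (w k)%:R <= x%:R :> R.
  rewrite -[x%:R]mulr1 -(sum_prefix _ (x_le_n x y')); apply: ler_sum => k _.
  by rewrite lern1 leq_b1.
by rewrite /hgt /=; lra.
Qed.

Lemma low_eq0 r : `|mean| + x%:R <= r -> low r <= 0.
Proof.
move=> h; rewrite -(bexp_cst b1 b2 0) /low.
apply: EX_le => [|||w0 w _ _]; rewrite ?(set_d1P S) ?(set_d2P S) //.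
  by move=> k b; apply: bern_ge0; apply: dens_01; rewrite -?p10 -?p20 ?p1_01 ?p2_01.
rewrite /ind; case: ltP => // h1.
have h2 := hgt_ge w0 w; have h3 := ler_norm mean; exfalso; lra.
Qed.

Lemma low_le1 r : low r <= 1.
Proof.
rewrite -(bexp_cst b1 b2 1); apply: bexp_le => [||h]; rewrite -?p10 -?p20 ?p1_01 ?p2_01 //.
by rewrite /ind lern1 leq_b1.
Qed.

Lemma lower_tail eps s : 0 < eps -> eps <= a / 600 -> N * eps ^+ 2 <= a / 600 * s ->
  eps * delta <= a / 600 * s -> 1 <= s ->
  low s <= 2 * (1 + 3 * K) * expR (- (eta * eps * s / 4)).
Proof.
move=> e0 e1 eN eD s1; have K1 := K_ge1; have /andP[eta0 _] := eta_bound.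
(* The doubling stops because the height is at least [- x]. The tilt [eps] stays fixed, as its
   conditions only weaken when [s] grows. *)
have [m hm] : exists m, `|mean| + x%:R <= 2 ^+ m * s.
  exists (Num.truncn (`|mean| + x%:R)).+1.
  have h := truncnS_gt (`|mean| + x%:R); set k := _.+1 in h *.
  have h2 : k%:R <= 2 ^+ k :> R by rewrite -natrX ler_nat ltnW // ltn_expl.
  have : 0 <= 2 ^+ k * (s - 1) :> R by apply: mulr_ge0; [exact: exprn_ge0|lra].
  lra.
elim: m s s1 eN eD hm => [|m IH] s s1 eN eD hm.
  rewrite expr0 mul1r in hm; apply: le_trans (low_eq0 hm) _.
  by apply: mulr_ge0; [lra|exact: expR_ge0].
have hs : 0 <= a / 600 * s by apply: mulr_ge0; [apply: divr_ge0 => //; exact: ltW|lra].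
have st := low_step e0 e1 eN eD s1.
have hm' : `|mean| + x%:R <= 2 ^+ m * (2 * s) by rewrite mulrA -exprSr.
have IH' : low (2 * s) <= 2 * (1 + 3 * K) * expR (- (eta * eps * (2 * s) / 4)).
  by apply: IH => //; lra.
set X := expR (- (eta * eps * s / 4)) in st *.
have e2 : expR (- (eta * eps * (2 * s) / 4)) = X ^+ 2.
  by rewrite expr2 -expRD; congr expR; field.
rewrite e2 in IH'; have X0 : 0 < X := expR_gt0 _.
(* Doubling the level squares [X], so the constant reproduces itself when [2 * X <= 1]; otherwise
   the claimed bound exceeds 1. *)
case: (lerP X 2^-1) => hX.
  have : 0 <= (1 + 3 * K) * (X * (1 - 2 * X)) by apply: mulr_ge0; [|apply: mulr_ge0]; lra.
  rewrite expr2 in IH'; lra.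
apply: le_trans (low_le1 s) _.
have : 0 <= 3 * K * X by apply: mulr_ge0; lra.
lra.
Qed.

Lemma two_sided_tail eps s : 0 < eps -> eps <= a / 600 -> N * eps ^+ 2 <= a / 600 * s ->
  eps * delta <= a / 600 * s -> 1 <= s ->
  bexp b1 b2 (fun h => ind (s < `|h - mean|)) <= (2 + 8 * K) * expR (- (eta * eps * s / 4)).
Proof.
move=> e0 e1 eN eD s1; have K1 := K_ge1; have /andP[eta0 eta1] := eta_bound.
have hs : 0 <= s by lra.
have u := upper_tail e0 e1 eN eD hs; have l := lower_tail e0 e1 eN eD s1.
apply: (@le_trans _ _ (bexp b1 b2 (fun h => ind (s < h - mean) + ind (h - mean < - s)))).
  apply: bexp_le => [||h]; rewrite -?p10 -?p20 ?p1_01 ?p2_01 //.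
  rewrite /ind lter_normr; case: (ltP s (h - mean)) => h1 /=; first by rewrite lerDl ler0n.
  by rewrite ltrNr add0r.
rewrite bexpD -/(low s).
have f : expR (- (eps * s / 2)) <= expR (- (eta * eps * s / 4)).
  rewrite ler_expR; have : 0 <= (2^-1 - eta) * (eps * s).
    by apply: mulr_ge0; [lra|apply: mulr_ge0; lra].
  have : 0 <= eps * s by apply: mulr_ge0; lra.
  lra.
have K0 : 0 <= K by lra.
have := ler_wpM2l K0 f; lra.
Qed.

(** Lowering the left parameter to [- l] lowers the height but makes its moment of order [l]
    explicit. The last hypothesis ensures that heights below level [s] carry at most half of this
    moment. *)
Lemma upper_tail_lower_bound l s : 0 <= l -> l <= a / 4 -> 0 <= s ->
  2 * expR (l * s) <= expR (Phi (- l) - l * mean) ->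
  expR (- (16 * (N * (2 * l) ^+ 3 + delta * (2 * l) ^+ 2))) / (8 * K) <=
  bexp b1 b2 (fun h => ind (s < h - mean)).
Proof.
move=> l0 l1 s0 hm; have K1 := K_ge1.
pose B := 2 * K * expR (16 * (N * (2 * l) ^+ 3 + delta * (2 * l) ^+ 2)).
set m := expR (Phi (- l) - l * mean) in hm.
have D1 := set_d1P S; have D2 := set_d2P S.
have i1 := p1_01 (- l); have i2 := p2_01 0; have i1' := p1_01 0.
rewrite p10 in i1'; rewrite p20 in i2.
have mono (g : R -> R) : (forall h h', h <= h' -> g h <= g h') ->
    bexp (p1 (- l)) b2 g <= bexp b1 b2 g.
  move=> gm; apply: left_mono => //.
  - by move=> k b; apply: bern_ge0; apply: dens_01.
  - by move=> k b; apply: bern_ge0; apply: dens_01.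
  - by move=> k; rewrite /= !subrKC.
  - by move=> k; rewrite /= /dens; case: ifP => // _; rewrite -p10 p1_le //; lra.
  - by move=> k hk; rewrite /= /dens ltnNge hk.
set P := bexp b1 b2 _.
have P1 : bexp (p1 (- l)) b2 (fun h => ind (s < h - mean)) <= P.
  apply: mono => h h' hh; rewrite /ind; case: ltP => h1; last exact: ler0n.
  have h2 : s < h' - mean by lra.
  by rewrite h2.
have em : bexp (p1 (- l)) b2 (fun h => expR (l * (h - mean))) = m.
  have := rainsPhi 0 (- l); rewrite p20 Phi0 subr0 sub0r opprK => e.
  rewrite /m expRD -e mulrC -bexpZ; congr (bexp _ _ _); apply: funext => h.
  by rewrite -expRD; congr expR; ring.
(* The second moment is that of an increasing function of the height, so the stationary model
   dominates it. *)
have eB : bexp (p1 (- l)) b2 (fun h => expR (l * (h - mean)) ^+ 2) <= B.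
  apply: (@le_trans _ _ (bexp b1 b2 (fun h => expR (- (2 * l * mean)) * expR (2 * l * h)))).
    apply: le_trans (mono _ _).
      apply: bexp_le => // h; rewrite -expRD expr2 -expRD ler_expR; lra.
    move=> h h' hh; apply: ler_wpM2l; first exact: expR_ge0.
    by rewrite ler_expR; apply: ler_wpM2l => //; lra.
  rewrite bexpZ.
  have hl : 0 <= 2 * l <= a / 2 by apply/andP; split; lra.
  have := stationary_mgf 0 hl; rewrite p10 p20 Phi0 !sub0r add0r subr0 => h.
  apply: le_trans (ler_wpM2l (expR_ge0 _) h) _.
  have r1 : - 2^-1 <= - (2 * l) <= 2^-1 by apply/andP; split; slra.
  have r2 : - 2^-1 <= 2 * l <= 2^-1 by apply/andP; split; slra.
  have := Phi_bound r1; have := Phi_bound r2.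
  rewrite normrN (ger0_norm (_ : 0 <= 2 * l)) ?sqrrN ?ler_norml; last by lra.
  set w := 16 * _ => /andP[g1 g2] /andP[g3 g4].
  have f1 : expR (- (2 * l * mean)) * expR (Phi (- (2 * l))) <= expR w.
    by rewrite -expRD ler_expR; lra.
  have f2 : expR (- (2 * l * mean)) * expR (- Phi (2 * l)) <= expR w.
    by rewrite -expRD ler_expR; lra.
  have K0 : 0 <= K by lra.
  have := ler_wpM2l K0 (lerD f1 f2); rewrite /B -/w; lra.
have B0 : 0 < B by rewrite /B !mulr_gt0 ?expR_gt0 //; lra.
have m0 : 0 < m := expR_gt0 _.
(* Paley-Zygmund *)
have key : m <= m / 2 + m / (4 * B) * B + B / m * P.
  rewrite -{1}em.
  apply: (@le_trans _ _ (bexp (p1 (- l)) b2 (fun h => (m / 2 + m / (4 * B) * expR (l * (h - mean)) ^+ 2)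
     + B / m * ind (s < h - mean)))).
    apply: bexp_le => // h; set Y := expR _; have Y0 : 0 < Y := expR_gt0 _.
    have sq := sqr_ge0 (m / (2 * B) * Y - 1).
    have e : m / (4 * B) * Y ^+ 2 + B / m - Y = B / m * (m / (2 * B) * Y - 1) ^+ 2.
      by field; rewrite !gt_eqF.
    have bm : 0 < B / m by apply: divr_gt0.
    have p2 : 0 <= m / (4 * B) * Y ^+ 2.
      by apply: mulr_ge0; [apply: divr_ge0; lra|exact: sqr_ge0].
    rewrite /ind; case: ltP => hs /=.
      have : 0 <= B / m * (m / (2 * B) * Y - 1) ^+ 2 by apply: mulr_ge0 => //; exact: ltW.
      rewrite mulr1; lra.
    have : Y <= expR (l * s) by rewrite ler_expR; apply: ler_wpM2l.
    rewrite mulr0; lra.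
  rewrite !bexpD !bexpZ bexp_cst; apply: lerD; last first.
    by apply: ler_wpM2l => //; apply: divr_ge0; exact: ltW.
  by rewrite lerD2l; apply: ler_wpM2l => //; apply: divr_ge0; lra.
have e1 : m / (4 * B) * B = m / 4 by field; rewrite gt_eqF.
rewrite e1 in key.
have k2 : m ^+ 2 / 4 <= B * P.
  have : (m / 4) * m <= (B / m * P) * m by apply: ler_wpM2r; lra.
  have -> : B / m * P * m = B * P by field; rewrite gt_eqF.
  by rewrite expr2; lra.
have ex : expR (- (16 * (N * (2 * l) ^+ 3 + delta * (2 * l) ^+ 2))) / (8 * K) = 4^-1 / B.
  by rewrite /B expRN; field; rewrite !gt_eqF ?expR_gt0 //; lra.
rewrite ex ler_pdivrMr // mulrC.
have P0 : 0 <= P.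
  by apply: bexp_ge0 => // h; rewrite /ind ler0n.
have m1 : 1 <= m.
  have : 1 <= expR (l * s) by rewrite -[X in X <= _]expR0 ler_expR mulr_ge0.
  lra.
have : 1 <= m ^+ 2 by rewrite exprn_ege1.
lra.
Qed.

End Tails.

(** * The three regimes *)

Section Model.
Variable R : realType.

Lemma std_setting (a d1 d2 b1 b2 : R) (y' : nat) : std_hyp a d1 d2 b1 b2 y'.+1 ->
  [/\ setting y' d1 d2 (d2 / d1) a b1 b2 (Nsc d1 d2 y'.+1) (x0 d1 d2 b1 y'.+1),
      0 < a, a <= 2^-1 & 1 <= Nsc d1 d2 y'.+1].
Proof.
case=> [[d20 [d21 d11]] [a0 [ath ad]] [[b10 b11] [[b20 b21] bk]] [[ab1 ab1'] [ab2 ab2']] [_ N1]].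
have k0 : 0 < kappa d1 d2 by rewrite /kappa divr_gt0; lra.
have d10 : 0 < d1 by lra.
have d2n : 0 < 1 - d2 by lra.
have k1 : kappa d1 d2 < 1 by rewrite /kappa ltr_pdivrMr //; lra.
have B1 : 0 < 1 - b1 by lra.
have B2 : 0 < 1 - b2 by lra.
have kb : b1 * (1 - b2) = kappa d1 d2 * (b2 * (1 - b1)).
  have -> : b1 * (1 - b2) = beta b1 * ((1 - b1) * (1 - b2)) by rewrite /beta; field; rewrite gt_eqF.
  by rewrite bk /beta; field; rewrite gt_eqF.
(* The factor [1 - kappa] carried by [b2 - b1] turns the cubic coefficient into the scale [Nsc]. *)
have diff : b2 - b1 = (1 - kappa d1 d2) * (b2 * (1 - b1)) by lra.
have coef : third_coef y'.+1%:R b1 b2 = Nsc d1 d2 y'.+1 * (b1 * (1 - b1) * (b2 * (1 - b1))).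
  by rewrite /third_coef diff /Nsc; ring.
(* The bound on [theta] reads [(1 + a) * d2 <= (1 - a) * m] with [m] the minimum of [d1] and
   [2^-1]. *)
have qle : d2 / d1 <= 1 - a.
  rewrite ler_pdivrMr //; move: ath; rewrite /theta ler_pdivlMr; last first.
    by rewrite addr_gt0 // lt_min d10 invr_gt0 ltr0n.
  have : Num.min d1 2^-1 <= d1 by rewrite ge_min lexx.
  move: (Num.min _ _) => m hm hh.
  have : 0 <= a * d2 by apply: mulr_ge0; lra.
  have : 0 <= (1 - a) * (d1 - m) by apply: mulr_ge0; lra.
  lra.
have b1i : 0 <= b1 * (1 - b1) <= 1.
  by rewrite mulr_ge0 ?(ltW b10) ?(ltW B1) //= mulr_ile1; lra.
have aa : a ^+ 2 <= b1 * (1 - b1) by rewrite expr2; apply: ler_pM; lra.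
have ab : a ^+ 2 <= b2 * (1 - b1) by rewrite expr2; apply: ler_pM; lra.
have a2 := sqr_ge0 a.
split=> //; last by lra.
split; rewrite ?coef //; try by apply/andP; split; lra.
- by field; rewrite gt_eqF.
- by apply: divr_ge0; lra.
- have : 0 <= (1 - kappa d1 d2) * (b2 * (1 - b1)) by apply: mulr_ge0; [lra|apply: mulr_ge0; lra].
  lra.
- by rewrite bk /kappa; field; rewrite gt_eqF.
- rewrite /x0; have e : (kappa d1 d2)^-1 * beta b1 = beta b2 by rewrite bk mulKf // gt_eqF.
  have s1 : 1 + beta b1 = (1 - b1)^-1 by rewrite /beta; field; rewrite gt_eqF.
  have s2 : 1 + beta b2 = (1 - b2)^-1 by rewrite /beta; field; rewrite gt_eqF.
  rewrite e s1 s2.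
  have -> : y'.+1%:R * kappa d1 d2 * ((1 - b2)^-1 / (1 - b1)^-1) ^+ 2 * (b2 * (1 - b2)) =
     y'.+1%:R * (kappa d1 d2 * (b2 * (1 - b1))) * (1 - b1) / (1 - b2).
    by field; rewrite !gt_eqF.
  by rewrite -kb; field; rewrite gt_eqF.
- rewrite mulrC; apply: ler_wpM2l; first by lra.
  have -> : a ^+ 4 = a ^+ 2 * a ^+ 2 by rewrite -exprD.
  exact: ler_pM.
- rewrite -[X in _ <= X]mulr1; apply: ler_wpM2l; first by lra.
  have /andP[h1 h2] := b1i; apply: mulr_ile1 => //; first by apply: mulr_ge0; lra.
  by apply: mulr_ile1; lra.
Qed.

Lemma prob_bexp (d1 d2 b1 b2 : R) x y' (P : R -> bool) :
  s6v_prob d1 d2 b1 b2 (fun s : seed x y'.+1 => P (Hr s)) =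
  bexp x y' d1 d2 b1 b2 (fun h => ind R (P h)).
Proof.
rewrite -seed_law /s6v_prob big_mkcond; apply: eq_bigr => s _.
by rewrite /ind; case: (P _); rewrite ?mulr1 ?mulr0.
Qed.

Lemma EH_mean (a d1 d2 b1 b2 q N x0v : R) x y' : setting y' d1 d2 q a b1 b2 N x0v -> 0 < a -> a <= 2^-1 ->
  s6v_EH d1 d2 b1 b2 x y'.+1 = mean x y' b1 b2.
Proof.
move=> S a0 a1; rewrite /s6v_EH (seed_law x y' d1 d2 b1 b2 id) bexp_mean //.
have h1 := b1_01 S a0 a1; have h2 := b2_01 S a0 a1.
have := bz_balanced 0 (beta_gt0 h1) (beta_gt0 h2) (set_bal S).
by rewrite !beta_frac ?expR0 ?mulr1 ?subrK ?divr1 //; [case/andP: h2|case/andP: h1].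
Qed.

(** With [N] a cube and [u] a square, all fractional powers become polynomial identities. *)
Lemma cube_root (N : R) : 1 <= N -> exists2 r, 1 <= r &
  [/\ N `^ (1 / 3) = r, N `^ (2 / 3) = r ^+ 2 & N = r ^+ 3].
Proof.
move=> N1; exists (N `^ (1 / 3)).
  by rewrite -[X in X <= _](powRr0 N); apply: ler_powR => //; lra.
have N0 : 0 <= N by lra.
split=> //.
  by rewrite -powR_mulrn ?powR_ge0 // -powRrM; congr (_ `^ _); field.
have e : 1 / 3 * 3%:R = 1 :> R by field.
by rewrite -powR_mulrn ?powR_ge0 // -powRrM e powRr1.
Qed.

Lemma square_root (u : R) : 1 <= u -> exists2 v, 1 <= v & u = v ^+ 2 /\ u `^ (3 / 2) = v ^+ 3.
Proof.
move=> u1; exists (u `^ (1 / 2)).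
  by rewrite -[X in X <= _](powRr0 u); apply: ler_powR => //; lra.
have u0 : 0 <= u by lra.
split.
  have e : 1 / 2 * 2%:R = 1 :> R by field.
  by rewrite -powR_mulrn ?powR_ge0 // -powRrM e powRr1.
by rewrite -powR_mulrn ?powR_ge0 // -powRrM; congr (_ `^ _); field.
Qed.

End Model.

(** * Choice of tilts in the three regimes *)

Section Constants.
Variable R : realType.

Lemma moderate_tail (a : R) : 0 < a ->
  exists c C : R, 0 < c /\ 0 < C /\
    forall (d1 d2 b1 b2 : R) (y x : nat) (u : R),
      std_hyp a d1 d2 b1 b2 y -> (0 < x)%N ->
      1 <= u -> u <= (Nsc d1 d2 y) `^ (2 / 3) ->
      s6v_prob d1 d2 b1 b2
        (fun s : seed x y =>
           `|(Hr s - s6v_EH d1 d2 b1 b2 x y) / (Nsc d1 d2 y) `^ (1 / 3)| > u)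
      <= C * expR (- (c * u `^ (3 / 2))) + tail2 C c u d1 d2 b1 x y.
Proof.
move=> a0.
have [a1|a1] := lerP a 2^-1; last first.
  exists 1, 1; split=> //; split=> // d1 d2 b1 b2 y x u [_ _ _ [[h1 h2] _] _]; exfalso; lra.
pose c0 := a / 600; pose c := eta a * c0 / 4; pose C := 2 + 8 * labC (1 - a / 2).
have c00 : 0 < c0 by rewrite /c0; lra.
have /andP[et0 et1] := eta_bound a0 a1; have K1 := K_ge1 a0 a1.
have c0' : 0 < c by rewrite /c divr_gt0 // mulr_gt0.
have C0 : 0 < C by rewrite /C; lra.
exists c, C; split=> //; split=> // d1 d2 b1 b2 [|y'] x u hs _ u1 u2.
  by case: hs => _ _ _ _ [].
have [S _ _ N1] := std_setting hs.
have [n3 n1 [e1 e2 e3]] := cube_root N1; have [v v1 [eu ev]] := square_root u1.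
rewrite e2 eu in u2; rewrite /tail2 e1 e2 ev.
have vn : v <= n3 by rewrite -(@ler_pXn2r _ 2) // nnegrE; lra.
set xx := x0 _ _ _ _ in S *; set N := Nsc _ _ _ in S N1 e3 *.
rewrite (EH_mean x S a0 a1) (prob_bexp d1 d2 b1 b2 x y' (fun h => u < `|(h - mean x y' b1 b2) / n3|)).
pose s := v ^+ 2 * n3; have n0 : 0 < n3 := lt_le_trans ltr01 n1.
have v0 : 0 < v := lt_le_trans ltr01 v1.
have s1 : 1 <= s by rewrite /s; apply: (le_trans n1); rewrite ler_peMl ?exprn_ege1 //; lra.
have s0 : 0 < s by lra.
have ee h : (u < `|(h - mean x y' b1 b2) / n3|) = (s < `|h - mean x y' b1 b2|).
  by rewrite normrM normfV (gtr0_norm n0) ltr_pdivlMr // eu.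
have -> : (fun h => ind R (u < `|(h - mean x y' b1 b2) / n3|)) =
    (fun h => ind R (s < `|h - mean x y' b1 b2|)) by apply: funext => h; rewrite ee.
set Dl := delta x xx.
have Dl0 : 0 <= Dl := normr_ge0 _.
have bound eps : 0 < eps -> eps <= c0 -> N * eps ^+ 2 <= c0 * s -> eps * Dl <= c0 * s ->
    bexp x y' d1 d2 b1 b2 (fun h => ind R (s < `|h - mean x y' b1 b2|)) <=
    C * expR (- (eta a * eps * s / 4)).
  by move=> h1 h2 h3 h4; apply: (two_sided_tail S a0 a1 h1 h2 h3 h4 s1).
have r1 : v / n3 <= 1 by rewrite ler_pdivrMr // mul1r.
have r0 : 0 < v / n3 by rewrite divr_gt0.
have Nr : N * (v / n3) ^+ 2 = s.
  by rewrite e3 /s; field; rewrite gt_eqF.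
have sc : 0 <= 1 - c0 by rewrite /c0; lra.
have cs : 0 < c0 * s by rewrite mulr_gt0.
(* The cubic error allows a tilt of order [v / n3], the distance from the characteristic direction
   one of order [s / Dl]. The smaller is used: they yield the exponents [v ^+ 3] and [s ^+ 2 / Dl]
   respectively. *)
case: (lerP (v / n3 * Dl) s) => hD.
  apply: (@le_trans _ _ (C * expR (- (c * v ^+ 3)))); last first.
    rewrite lerDl; case: ifP => // _; apply: mulr_ge0; [exact: ltW|exact: expR_ge0].
  have -> : c * v ^+ 3 = eta a * (c0 * (v / n3)) * s / 4.
    by rewrite /c /s; field; rewrite gt_eqF.
  apply: bound; first by rewrite mulr_gt0.
  - by rewrite ger_pMr.
  - rewrite exprMn mulrCA Nr expr2 -mulrA.
    have := mulr_ge0 sc (ltW cs); lra.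
  - by rewrite -mulrA; apply: ler_wpM2l; first exact: ltW.
have D0 : 0 < Dl.
  by rewrite lt_neqAle Dl0 andbT eq_sym; apply/eqP => e; rewrite e mulr0 in hD; lra.
rewrite ifF; last first.
  by apply/eqP => e; move: D0; rewrite /Dl /delta e subrr normr0 ltxx.
apply: (@le_trans _ _ (C * expR (- (c * u ^+ 2 * n3 ^+ 2 / Dl)))); last first.
  by apply: ler_wpDl; [apply: mulr_ge0; [exact: ltW|exact: expR_ge0]|exact: lexx].
have -> : c * u ^+ 2 * n3 ^+ 2 / Dl = eta a * (c0 * (s / Dl)) * s / 4.
  by rewrite /c /s eu; field; rewrite gt_eqF.
have sD : s / Dl <= v / n3 by rewrite ler_pdivrMr // ltW.
have sD0 : 0 < s / Dl by rewrite divr_gt0.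
apply: bound; first by rewrite mulr_gt0.
- by rewrite ger_pMr // (le_trans sD).
- rewrite exprMn mulrCA.
  have h1 : (s / Dl) ^+ 2 <= (v / n3) ^+ 2 by rewrite ler_pXn2r // nnegrE; exact: ltW.
  have h2 : N * (s / Dl) ^+ 2 <= s by rewrite -[X in _ <= X]Nr; apply: ler_wpM2l => //; lra.
  have h3 := ler_wpM2l (sqr_ge0 c0) h2.
  apply: (le_trans h3); rewrite expr2; have := mulr_ge0 sc (ltW cs); lra.
by rewrite -mulrA divfK // gt_eqF.
Qed.

Lemma large_tail (a C1 : R) : 0 < a -> 0 < C1 ->
    exists C2 C c : R, 0 < C2 /\ 0 < C /\ 0 < c /\
    forall (d1 d2 b1 b2 : R) (y x : nat) (u : R),
      std_hyp a d1 d2 b1 b2 y -> (0 < x)%N ->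
      a * d1 <= 1 - kappa d1 d2 -> 1 - kappa d1 d2 <= a^-1 * d1 ->
      `|x%:R - x0 d1 d2 b1 y| <= C1 * Nsc d1 d2 y ->
      u > C2 * (Nsc d1 d2 y) `^ (2 / 3) ->
      s6v_prob d1 d2 b1 b2
        (fun s : seed x y =>
           `|Hr s - s6v_EH d1 d2 b1 b2 x y| > u * (Nsc d1 d2 y) `^ (1 / 3))
      <= C * expR (- (c * u * (Nsc d1 d2 y) `^ (1 / 3))).
Proof.
move=> a0 C10.
have [a1|a1] := lerP a 2^-1; last first.
  exists 1, 1, 1; do 3![split=> //] => d1 d2 b1 b2 y x u [_ _ _ [[h1 h2] _] _]; exfalso; lra.
(* At levels beyond [N] a constant tilt is admissible, whence the exponential tail; [1 + C1] absorbs
   the distance, at most [C1 * N]. *)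
pose c0 := a / 600; pose eps := c0 / (1 + C1).
pose c := eta a * eps / 4; pose C := 2 + 8 * labC (1 - a / 2).
have c00 : 0 < c0 by rewrite /c0; lra.
have c01 : c0 <= 1 by rewrite /c0; lra.
have /andP[et0 et1] := eta_bound a0 a1; have K1 := K_ge1 a0 a1.
have D0 : 0 < 1 + C1 by lra.
have eps0 : 0 < eps by rewrite /eps divr_gt0.
have epsD : eps * C1 <= c0.
  rewrite /eps mulrAC ler_pdivrMr //; have : 0 < c0 by [].
  lra.
have epsc : eps <= c0.
  rewrite /eps ler_pdivrMr //; have := mulr_gt0 c00 C10; lra.
have c0' : 0 < c by rewrite /c divr_gt0 // mulr_gt0.
have C0 : 0 < C by rewrite /C; lra.
exists 1, C, c; do 3![split=> //] => d1 d2 b1 b2 [|y'] x u hs _ _ _ hx hu.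
  by case: hs => _ _ _ _ [].
have [S _ _ N1] := std_setting hs.
have [n3 n1 [e1 e2 e3]] := cube_root N1.
rewrite e2 mul1r in hu; rewrite e1.
set xx := x0 _ _ _ _ in S hx *; set N := Nsc _ _ _ in S N1 e3 hx *.
rewrite (EH_mean x S a0 a1) (prob_bexp d1 d2 b1 b2 x y' (fun h => u * n3 < `|h - mean x y' b1 b2|)).
have n0 : 0 < n3 := lt_le_trans ltr01 n1.
have Ns : N <= u * n3.
  by rewrite e3 exprSr; apply: ler_wpM2r; apply: ltW.
have s1 : 1 <= u * n3 by lra.
have cs : 0 < c0 * (u * n3) by rewrite mulr_gt0 //; lra.
have -> : c * u * n3 = eta a * eps * (u * n3) / 4 by rewrite /c; ring.
apply: (two_sided_tail S a0 a1 eps0 epsc _ _ s1).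
  have e1' : eps ^+ 2 <= c0.
    rewrite expr2; apply: (@le_trans _ _ (c0 * 1)); last by rewrite mulr1.
    by apply: ler_pM; [exact: ltW eps0|exact: ltW eps0|exact: epsc|exact: le_trans epsc c01].
  by rewrite mulrC; apply: ler_pM => //; [exact: sqr_ge0|lra].
have h1 := ler_wpM2l (ltW eps0) hx.
apply: (le_trans h1); rewrite [X in X <= _]mulrA.
apply: ler_pM; [by apply: mulr_ge0; [exact: ltW eps0|exact: ltW C10]|lra|exact: epsD|exact: Ns].
Qed.

Lemma stationary_upper_tail (a A : R) : 0 < a -> 0 < A ->
    exists c C : R, 0 < c /\ 0 < C /\
    forall (d1 d2 b1 b2 : R) (y x : nat) (u : R),
      std_hyp a d1 d2 b1 b2 y -> (0 < x)%N ->
      a * d1 <= 1 - kappa d1 d2 -> 1 - kappa d1 d2 <= a^-1 * d1 ->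
      `|x%:R - x0 d1 d2 b1 y| <= A * (Nsc d1 d2 y) `^ (2 / 3) ->
      1 <= u -> u <= c * (Nsc d1 d2 y) `^ (2 / 3) ->
      let p := s6v_prob d1 d2 b1 b2
        (fun s : seed x y =>
           (Hr s - s6v_EH d1 d2 b1 b2 x y) / (Nsc d1 d2 y) `^ (1 / 3) > u) in
      c * expR (- (C * u `^ (3 / 2))) <= p /\
      p <= C * expR (- (c * u `^ (3 / 2))).
Proof.
move=> a0 A0.
have [a1|a1] := lerP a 2^-1; last first.
  exists 1, 1; split=> //; split=> // d1 d2 b1 b2 y x u [_ _ _ [[h1 h2] _] _]; exfalso; lra.
pose K := labC (1 - a / 2); have K1 : 1 <= K := K_ge1 a0 a1.
pose c0 := a / 600; have c00 : 0 < c0 by rewrite /c0; lra.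
have c01 : c0 <= 1 by rewrite /c0; lra.
have a42 : a / 4 <= 2^-1 by lra.
have K20 : 0 <= 2 * K by lra.
have exp1 : 2 <= expR 1 :> R by have := @expR_ge1Dx R 1; lra.
pose e := c0 / (1 + A).
have D0 : 0 < 1 + A by lra.
have e0 : 0 < e by rewrite /e divr_gt0.
have ec : e <= c0 by rewrite /e ler_pdivrMr //; have := mulr_gt0 c00 A0; lra.
have eA : e * A <= c0 by rewrite /e mulrAC ler_pdivrMr //; lra.
have a4 : 0 < a ^+ 4 by apply: exprn_gt0.
have a41 : a ^+ 4 <= 1 by apply: exprn_ile1; lra.
(* Large enough that the cubic gain [a ^+ 4 / 72 * k ^+ 3] equals [2 * A * k ^+ 2 + 2 * k ^+ 2]: the
   first term covers the distance from the characteristic direction, the second the level [s] and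
   the factor 2. *)
pose k := 72 * (2 * A + 2) / a ^+ 4.
have k1 : 1 <= k by rewrite /k ler_pdivlMr // mul1r; lra.
have kE : a ^+ 4 / 72 * k = 2 * A + 2 by rewrite /k; field; rewrite gt_eqF.
have k0 : 0 < k by lra.
have k2 : k <= k ^+ 2 by rewrite expr2 ler_peMl // ltW.
have kpos : 0 <= 2 * k ^+ 2 - k - 1 by lra.
(* In order: the prefactor of the second moment bound, [l <= a / 4], [v <= n3], and the rate of the
   upper bound. *)
pose c := Num.min ((8 * K)^-1) (Num.min ((a / (4 * k)) ^+ 2) (Num.min 1 (e / 2))).
pose Cl := 128 * k ^+ 3 + 64 * A * k ^+ 2.
pose C := Num.max (2 * K) Cl.
have ak0 : 0 < a / (4 * k) by rewrite divr_gt0 // mulr_gt0.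
have c_gt0 : 0 < c.
  rewrite /c !lt_min ltr01 invr_gt0 exprn_gt0 // divr_gt0 // andbT andbT.
  by rewrite mulr_gt0 //; lra.
have cle1 : c <= (8 * K)^-1 by rewrite /c ge_min lexx.
have cle2 : c <= (a / (4 * k)) ^+ 2 by rewrite /c !ge_min lexx orbT.
have cle3 : c <= 1 by rewrite /c !ge_min lexx !orbT.
have cle4 : c <= e / 2 by rewrite /c !ge_min lexx !orbT.
have Cle1 : 2 * K <= C by rewrite /C le_max lexx.
have Cle2 : Cl <= C by rewrite /C le_max lexx orbT.
have C_gt0 : 0 < C by apply: lt_le_trans Cle1; lra.
exists c, C; split=> //; split=> // d1 d2 b1 b2 [|y'] x u hs _ _ _ hx u1 u2.
  by case: hs => _ _ _ _ [].
have [S _ _ N1] := std_setting hs.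
have [n3 n1 [e1 e2 e3]] := cube_root N1; have [v v1 [eu ev]] := square_root u1.
rewrite e2 in hx; rewrite e2 eu in u2; rewrite e1 ev.
set xx := x0 _ _ _ _ in S hx *; set N := Nsc _ _ _ in S N1 e3 *.
rewrite (EH_mean x S a0 a1) (prob_bexp d1 d2 b1 b2 x y' (fun h => u < (h - mean x y' b1 b2) / n3)).
pose s := v ^+ 2 * n3; have n0 : 0 < n3 := lt_le_trans ltr01 n1.
have v0 : 0 < v := lt_le_trans ltr01 v1.
have -> : (fun h => ind R (u < (h - mean x y' b1 b2) / n3)) =
    (fun h => ind R (s < h - mean x y' b1 b2)).
  by apply: funext => h; rewrite ltr_pdivlMr // eu.
have s1 : 1 <= s by rewrite /s; apply: (le_trans n1); rewrite ler_peMl ?exprn_ege1 // ltW.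
have s0 : 0 <= s := le_trans ler01 s1.
have v3 : 0 < v ^+ 3 by apply: exprn_gt0.
have n2 : 0 < n3 ^+ 2 by apply: exprn_gt0.
set Dl := delta x xx; have Dl0 : 0 <= Dl := normr_ge0 _.
have hD : Dl <= A * n3 ^+ 2 := hx.
have vn : v <= n3.
  rewrite -(@ler_pXn2r _ 2) ?nnegrE ?(ltW v0) ?(ltW n0) //.
  by apply: (le_trans u2); rewrite ger_pMl.
have r0 : 0 < v / n3 by rewrite divr_gt0.
have r1 : v / n3 <= 1 by rewrite ler_pdivrMr // mul1r.
have Nr : N * (v / n3) ^+ 2 = s by rewrite e3 /s; field; rewrite gt_eqF.
have rs : v / n3 * n3 ^+ 2 <= s.
  have -> : v / n3 * n3 ^+ 2 = v * n3 by field; rewrite gt_eqF.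
  by rewrite /s; apply: ler_wpM2r; [exact: ltW|rewrite expr2 ler_peMl // ltW].
split; last first.
  have eps0 : 0 < e * (v / n3) by rewrite mulr_gt0.
  have eps1 : e * (v / n3) <= a / 600 by apply: le_trans ec; rewrite ger_pMr.
  have epsN : N * (e * (v / n3)) ^+ 2 <= a / 600 * s.
    rewrite exprMn mulrCA Nr; apply: ler_wpM2r => //.
    rewrite expr2; apply: (@le_trans _ _ (c0 * 1)); last by rewrite mulr1.
    by apply: ler_pM; [exact: ltW e0|exact: ltW e0|exact: ec|exact: le_trans ec c01].
  have epsD : e * (v / n3) * delta x xx <= a / 600 * s.
    have h1 : v / n3 * Dl <= v / n3 * (A * n3 ^+ 2) by apply: ler_wpM2l => //; exact: ltW.
    have h2 := ler_wpM2l (ltW A0) rs.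
    have h3 : v / n3 * Dl <= A * s by apply: le_trans h1 _; rewrite mulrCA.
    have h4 := ler_wpM2l (ltW e0) h3; have h5 := ler_wpM2r s0 eA.
    rewrite -/Dl -/c0; move: h4 h5; rewrite !mulrA => h4 h5; exact: le_trans h4 h5.
  have := upper_tail S a0 a1 eps0 eps1 epsN epsD s0.
  move=> /le_trans; apply.
  have -> : e * (v / n3) * s / 2 = e / 2 * v ^+ 3 by rewrite /s; field; rewrite gt_eqF.
  apply: ler_pM => //; first exact: expR_ge0.
  by rewrite ler_expR lerN2; apply: ler_wpM2r => //; exact: ltW.
pose l := k * (v / n3).
have l0 : 0 <= l by rewrite /l mulr_ge0 // ltW.
have la : l <= a / 4.
  have vk : v <= a / (4 * k) * n3.
    have vk0 : 0 <= a / (4 * k) * n3 by apply: mulr_ge0; [exact: ltW ak0|exact: ltW n0].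
    rewrite -(@ler_pXn2r _ 2) ?nnegrE ?(ltW v0) ?vk0 //.
    by apply: (le_trans u2); rewrite exprMn; apply: ler_wpM2r => //; exact: ltW.
  have := ler_wpM2l (ltW k0) vk; have -> : k * (a / (4 * k) * n3) = a / 4 * n3.
    by field; rewrite gt_eqF.
  by move=> h; rewrite /l mulrA ler_pdivrMr.
have lN : N * l ^+ 3 = k ^+ 3 * v ^+ 3 by rewrite e3 /l; field; rewrite gt_eqF.
have lD : Dl * l ^+ 2 <= A * k ^+ 2 * v ^+ 3.
  apply: (@le_trans _ _ (A * n3 ^+ 2 * l ^+ 2)); first by apply: ler_wpM2r => //; exact: sqr_ge0.
  have -> : A * n3 ^+ 2 * l ^+ 2 = A * k ^+ 2 * v ^+ 2 by rewrite /l; field; rewrite gt_eqF.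
  apply: ler_wpM2l; first by rewrite mulr_ge0 ?sqr_ge0 // ltW.
  by rewrite exprS ler_peMl ?sqr_ge0.
have ls : l * s = k * v ^+ 3 by rewrite /l /s; field; rewrite gt_eqF.
have hyp : 2 * expR (l * s) <= expR (Phi x y' b1 b2 (- l) - l * mean x y' b1 b2).
  have hl : 0 <= l <= 2^-1 by rewrite l0 (le_trans la a42).
  have low := Phi_low x S a0 a1 hl.
  rewrite -/N -/xx -/Dl lN in low.
  apply: (@le_trans _ _ (expR 1 * expR (l * s))).
    by apply: ler_wpM2r => //; exact: expR_ge0.
  rewrite -expRD ler_expR ls.
  have v31 : 1 <= v ^+ 3 by apply: exprn_ege1.
  have kk : 2 * A * k ^+ 2 + 2 * k ^+ 2 = a ^+ 4 / 72 * k ^+ 3.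
    by rewrite [k ^+ 3]exprS mulrA kE; ring.
  have f1 := mulr_ge0 kpos (ltW v3).
  have f2 := congr1 (fun z => z * v ^+ 3) kk; rewrite /= in f2.
  lra.
have := upper_tail_lower_bound S a0 a1 l0 la s0 hyp.
move=> h; apply: le_trans h; rewrite -/K mulrC.
apply: ler_pM; [exact: expR_ge0|exact: ltW| |exact: cle1].
rewrite ler_expR lerN2 -/Dl -/N.
have g1 := ler_wpM2r (ltW v3) Cle2; rewrite /Cl in g1.
have -> : N * (2 * l) ^+ 3 = 8 * (k ^+ 3 * v ^+ 3) by rewrite -lN; ring.
have -> : Dl * (2 * l) ^+ 2 = 4 * (Dl * l ^+ 2) by ring.
lra.
Qed.

End Constants.

Theorem theorem2p3 (R : realType) :
  (* (1) *)
  (forall a : R, 0 < a ->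
    exists c C : R, 0 < c /\ 0 < C /\
    forall (d1 d2 b1 b2 : R) (y x : nat) (u : R),
      std_hyp a d1 d2 b1 b2 y -> (0 < x)%N ->
      1 <= u -> u <= (Nsc d1 d2 y) `^ (2 / 3) ->
      s6v_prob d1 d2 b1 b2
        (fun s : seed x y =>
           `|(Hr s - s6v_EH d1 d2 b1 b2 x y) / (Nsc d1 d2 y) `^ (1 / 3)| > u)
      <= C * expR (- (c * u `^ (3 / 2))) + tail2 C c u d1 d2 b1 x y)
  /\
  (* (2) *)
  (forall a A : R, 0 < a -> 0 < A ->
    exists c C : R, 0 < c /\ 0 < C /\
    forall (d1 d2 b1 b2 : R) (y x : nat) (u : R),
      std_hyp a d1 d2 b1 b2 y -> (0 < x)%N ->
      a * d1 <= 1 - kappa d1 d2 -> 1 - kappa d1 d2 <= a^-1 * d1 ->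
      `|x%:R - x0 d1 d2 b1 y| <= A * (Nsc d1 d2 y) `^ (2 / 3) ->
      1 <= u -> u <= c * (Nsc d1 d2 y) `^ (2 / 3) ->
      let p := s6v_prob d1 d2 b1 b2
        (fun s : seed x y =>
           (Hr s - s6v_EH d1 d2 b1 b2 x y) / (Nsc d1 d2 y) `^ (1 / 3) > u) in
      c * expR (- (C * u `^ (3 / 2))) <= p /\
      p <= C * expR (- (c * u `^ (3 / 2))))
  /\
  (* (3) *)
  (forall a C1 : R, 0 < a -> 0 < C1 ->
    exists C2 C c : R, 0 < C2 /\ 0 < C /\ 0 < c /\
    forall (d1 d2 b1 b2 : R) (y x : nat) (u : R),
      std_hyp a d1 d2 b1 b2 y -> (0 < x)%N ->
      a * d1 <= 1 - kappa d1 d2 -> 1 - kappa d1 d2 <= a^-1 * d1 ->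
      `|x%:R - x0 d1 d2 b1 y| <= C1 * Nsc d1 d2 y ->
      u > C2 * (Nsc d1 d2 y) `^ (2 / 3) ->
      s6v_prob d1 d2 b1 b2
        (fun s : seed x y =>
           `|Hr s - s6v_EH d1 d2 b1 b2 x y| > u * (Nsc d1 d2 y) `^ (1 / 3))
      <= C * expR (- (c * u * (Nsc d1 d2 y) `^ (1 / 3)))).
Proof.
split; [exact: moderate_tail|split; [exact: stationary_upper_tail|exact: large_tail]].
Qed.
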